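(* Let $\phi \in \mathcal{G}AP$. If the Wiener-Hopf operator $W_\phi: L^2_+(\mathbb{R})\to L^2(\mathbb{R}_+)$ is invertible and $\phi$ has a canonical right $AP$ factorization, then the Wiener-Hopf plus Hankel operator $W\!H_\phi: L^2_+(\mathbb{R})\to L^2(\mathbb{R}_+)$ is invertible.
   Context: Operators: $\mathbb{R}_+=(0,+\infty)$; $L^2_+(\mathbb{R})$ is the subspace of $L^2(\mathbb{R})$ of functions supported in the closure of $\mathbb{R}_+$; $r_+:L^2(\mathbb{R})\to L^2(\mathbb{R}_+)$ is restriction. $\mathcal{F}$ is the Fourier transformation on $L^2(\mathbb{R})$, with the convention $\mathcal{F}f(\xi)=\int_{\mathbb{R}} e^{i\xi x}f(x)\,dx$ (extended to $L^2$ as usual). $J\varphi(x)=\varphi(-x)$ is the reflection. For $\phi\in L^\infty(\mathbb{R})$, $W_\phi=r_+\mathcal{F}^{-1}\phi\cdot\mathcal{F}$ and $H_\phi=r_+\mathcal{F}^{-1}\phi\cdot\mathcal{F}J$ (both $L^2_+(\mathbb{R})\to L^2(\mathbb{R}_+)$) are the Wiener-Hopf and Hankel operators, and $W\!H_\phi=W_\phi+H_\phi$. Function classes: $e_\lambda(x)=e^{i\lambda x}$ for $\lambda, x\in\mathbb{R}$. $AP$ is the smallest closed subalgebra of $L^\infty(\mathbb{R})$ containing all $e_\lambda$, $\lambda\in\mathbb{R}$; $AP^-$ (respectively $AP^+$) is the smallest closed subalgebra of $L^\infty(\mathbb{R})$ containing all $e_\lambda$ with $\lambda\le 0$ (respectively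 $\lambda\ge 0$). $\mathcal{G}B$ denotes the group of invertible elements of a Banach algebra $B$. A canonical right $AP$ factorization of $\phi\in\mathcal{G}AP$ is a representation $\phi=\varphi_-\varphi_+$ with $\varphi_-\in\mathcal{G}AP^-$ and $\varphi_+\in\mathcal{G}AP^+$. *)

(* Defs.v *)
From mathcomp Require Import all_boot all_order all_algebra.
From mathcomp Require Import all_classical all_reals all_analysis.
From mathcomp Require Import complex.

Set Implicit Arguments.
Unset Strict Implicit.
Unset Printing Implicit Defensive.

Import Order.TTheory GRing.Theory Num.Theory.
Import numFieldNormedType.Exports.

Local Open Scope classical_set_scope.
Local Open Scope complex_scope.
Local Open Scope ring_scope.

(* MathComp-Analysis has Lebesgue spaces of real-valued functions only.  Here
   elements of the complex spaces L^p(D) are represented by functions R -> R[i]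
   whose values outside D are irrelevant, and equality in L^p(D) is almost
   everywhere equality on D. *)

Section LebesgueSpaces.
Variable R : realType.
Implicit Types (D : set R) (p : \bar R) (f g : R -> R[i]).

Definition cmeasurable_fun D f : Prop :=
  measurable_fun D (fun x => complex.Re (f x)) /\
  measurable_fun D (fun x => complex.Im (f x)).

Definition extend0 D f : R -> R[i] := patch (fun=> 0) D f.

Definition cLnorm D p f : \bar R :=
  'N[@lebesgue_measure R]_p [(fun x => (Normc.normc (extend0 D f x))%:E)]%E.

Definition Lp D p : set (R -> R[i]) :=
  [set f | cmeasurable_fun D f /\ (cLnorm D p f < +oo)%E].

Definition eq_ae D f g : Prop := f = g %[ae (@lebesgue_measure R) in D].

Definition cintegral f : R[i] :=
  (\int[@lebesgue_measure R]_(x in setT) complex.Re (f x)) +i*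
  (\int[@lebesgue_measure R]_(x in setT) complex.Im (f x)).

End LebesgueSpaces.

Section Operators.
Variable R : realType.

(* A subspace [fcarrier] of L^2(fdomain) with the norm of L^2(fdomain). *)
Record fspace := FSpace {
  fdomain : set R ;
  fcarrier : set (R -> R[i]) }.

Implicit Types (X Y : fspace) (T S : (R -> R[i]) -> (R -> R[i])).

Definition feq X (f g : R -> R[i]) : Prop := eq_ae (fdomain X) f g.
Definition fnorm X (f : R -> R[i]) : \bar R := cLnorm (fdomain X) 2%:E f.

Definition bounded_linear_op X Y T : Prop :=
  [/\ forall f, fcarrier X f -> fcarrier Y (T f),
      forall f g, fcarrier X f -> fcarrier X g ->
        feq X f g -> feq Y (T f) (T g),
      forall (a : R[i]) f g, fcarrier X f -> fcarrier X g ->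
        feq Y (T (fun x => a * f x + g x)) (fun x => a * T f x + T g x) &
      exists M : R, forall f, fcarrier X f ->
        (fnorm Y (T f) <= M%:E * fnorm X f)%E].

Definition invertible_op X Y T : Prop :=
  bounded_linear_op X Y T /\
  exists S, [/\ bounded_linear_op Y X S,
    forall f, fcarrier X f -> feq X (S (T f)) f &
    forall g, fcarrier Y g -> feq Y (T (S g)) g].

Definition Rplus : set R := `]0, +oo[.

Definition L2 : fspace := FSpace setT (Lp setT 2%:E).
Definition L2_Rplus : fspace := FSpace Rplus (Lp Rplus 2%:E).
Definition L2_plus : fspace := FSpace setT
  [set f | Lp setT 2%:E f /\ eq_ae (~` closure Rplus) f (fun=> 0)].

Definition r_plus (f : R -> R[i]) : R -> R[i] := extend0 Rplus f.

Definition reflection (f : R -> R[i]) : R -> R[i] := fun x => f (- x).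

Definition expi (t : R) : R[i] := cos t +i* sin t.

Definition fourier_integral (f : R -> R[i]) : R -> R[i] :=
  fun xi => cintegral (fun x => expi (xi * x) * f x).

(* The graph of the continuous extension of the Fourier integral from
   L^1 `&` L^2 to L^2. *)
Definition fourier_graph (f g : R -> R[i]) : Prop :=
  [/\ fcarrier L2 f, fcarrier L2 g &
      exists u : nat -> R -> R[i],
        [/\ forall n, Lp setT 1%:E (u n) /\ fcarrier L2 (u n),
            fnorm L2 (fun x => u n x - f x) @[n --> \oo] --> 0%E &
            fnorm L2 (fun x => fourier_integral (u n) x - g x)
              @[n --> \oo] --> 0%E]].

(* [xget] picks a representative of the class of functions related to the
   argument; the default 0 is reached only if there is none, which by
   Plancherel's theorem does not happen on L^2. *)
Definition fourier (f : R -> R[i]) : R -> R[i] :=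
  xget (fun=> 0) [set g | fourier_graph f g].

Definition inv_fourier (g : R -> R[i]) : R -> R[i] :=
  xget (fun=> 0) [set f | fourier_graph f g].

Definition wiener_hopf (phi f : R -> R[i]) : R -> R[i] :=
  r_plus (inv_fourier (phi \* fourier f)).

Definition hankel (phi f : R -> R[i]) : R -> R[i] :=
  r_plus (inv_fourier (phi \* fourier (reflection f))).

Definition wiener_hopf_plus_hankel (phi f : R -> R[i]) : R -> R[i] :=
  wiener_hopf phi f \+ hankel phi f.

End Operators.

Section AlmostPeriodic.
Variable R : realType.
Implicit Types (B : set (R -> R[i])).

Definition Linfty : set (R -> R[i]) := Lp setT +oo%E.

(* The last clause also makes [B] stable under almost everywhere equality. *)
Definition closed_subalgebra B : Prop :=
  [/\ B `<=` Linfty,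
      forall f g, B f -> B g -> B (f \+ g),
      forall (a : R[i]) f, B f -> B (fun x => a * f x),
      forall f g, B f -> B g -> B (f \* g) &
      forall f, Linfty f ->
        (forall e : R, 0 < e -> exists2 g, B g &
          (cLnorm setT +oo (fun x => (f x - g x)%R) < e%:E)%E) ->
        B f].

Definition expo (lambda : R) : R -> R[i] := fun x => expi (lambda * x).

Definition AP : set (R -> R[i]) := smallest closed_subalgebra (range expo).
Definition AP_minus : set (R -> R[i]) :=
  smallest closed_subalgebra (expo @` [set lambda | lambda <= 0]).
Definition AP_plus : set (R -> R[i]) :=
  smallest closed_subalgebra (expo @` [set lambda | 0 <= lambda]).

Definition invertibles B : set (R -> R[i]) :=
  [set f | B f /\ exists2 g, B g & eq_ae setT (f \* g) (fun=> 1)].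

Definition has_canonical_right_AP_factorization (phi : R -> R[i]) : Prop :=
  exists phi_minus phi_plus : R -> R[i],
    [/\ invertibles AP_minus phi_minus, invertibles AP_plus phi_plus &
        eq_ae setT phi (phi_minus \* phi_plus)].

End AlmostPeriodic.

(* Main.v *)
(* Write P for r_+, A(psi) = F^-1 psi F, and phi = phi_- phi_+. With
   psi = phi_- J(phi_+^-1) and the even function e = J(phi_+) phi_+ one has
   phi = psi e, and WH_phi f = P A(phi) (f + J f). On even functions A(e) is
   invertible and preserves evenness, while an even function is determined by
   its restriction to the half-line. Since the Fourier exponents of psi and
   psi^-1 are <= 0, A(psi) and A(psi^-1) preserve the functions supported in
   the left half-line, so P A(psi) P is invertible with inverse
   P A(psi^-1) P. Hence
     h |-> P A(e^-1) (1 + J) P A(psi^-1) P h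
   is the inverse of WH_phi.

   No surjectivity of the Fourier transformation is needed: the functions psi
   such that psi * F maps a closed subspace S of L^2 into F(S) form a closed
   subalgebra of L^oo, which contains e_lambda as soon as S is stable under
   translation by lambda. The only analytic input is that F is bounded above
   and below on L^2. Up to a constant, Plancherel's identity for step
   functions is a consequence of the scaling property of the integral of
   (1 - cos (s t)) / t^2. *)

Require Import Defs.
From mathcomp Require Import all_boot all_order all_algebra.
From mathcomp Require Import all_classical all_reals all_analysis.
From mathcomp Require Import complex.
From mathcomp Require Import measurable_realfun ess_sup_inf.
From mathcomp Require Import ring lra.

Set Implicit Arguments.
Unset Strict Implicit.
Unset Printing Implicit Defensive.

Import Order.TTheory GRing.Theory Num.Theory.
Import numFieldNormedType.Exports.

Local Open Scope classical_set_scope.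
Local Open Scope ring_scope.

(** Squared norms replace norms, and sums are split by (a + b)^2 <= 2 a^2 + 2 b^2, which keeps every
    estimate polynomial at the price of a factor 2 per splitting. This is how the exact identity on
    steps becomes bounds with constants such as 4 [kappa], 2 / [kappa], 16 [kappa] and 8 / [kappa].
    Such two-sided bounds make [fourier_graph] a functional, injective and closed relation, and they
    let a Cauchy sequence of images come from a Cauchy sequence of originals. Since [fourier] and
    [inv_fourier] pick arbitrary representatives, identities between operators are proved by
    exhibiting a pair in [fourier_graph] and identifying it almost everywhere by uniqueness. The
    signs fit together as follows. With the kernel e^{i xi x}, multiplication by e_lambda
    corresponds to f(x - lambda), a move to the left when lambda <= 0, so AP^- factors preserve
    functions vanishing on the right half-line. Conjugation by J turns psi into J psi and swaps the
    half-lines, so J(phi_+^-1) has the same property as phi_-. *)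

#[global] Instance ae_lebesgue_filter (R : realType) :
  Filter (almost_everywhere (@lebesgue_measure R)).
Proof. exact: ae_filter_ringOfSetsType. Qed.

(** * Trigonometric transforms of real functions *)

Section RealIntegrals.
Variable R : realType.
Local Notation mu := (@lebesgue_measure R).
Implicit Types (f g u v : R -> R).

(** The image of Lebesgue measure under x |-> a x + b, multiplied by [a], gives each half-open
    interval its length, so uniqueness of Lebesgue measure identifies the two measures. *)
Lemma integral_affine (a b : R) (f : R -> \bar R) : 0 < a ->
  measurable_fun setT f -> (forall x, 0 <= f x)%E ->
  (\int[mu]_x f x = a%:E * \int[mu]_x f (a * x + b)%R)%E.
Proof.
move=> a0 mf f0.
pose phi := (fun x => a * x + b) : R -> measurableTypeR R.
have mphi : measurable_fun [set: R] phi.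
  by apply: measurable_funD => //; apply: measurable_funM.
pose k := NngNum (ltW a0).
pose m : {measure set (measurableTypeR R) -> \bar R} :=
  mscale k (pushforward mu phi).
have mE A : measurable A -> mu A = m mphi A.
  move=> mA; apply: lebesgue_measure_unique => //= _ [[p q]] _ <-.
  rewrite /m /mscale/= /pushforward.
  have -> : phi @^-1` [set` `]p, q]] = [set` `](p - b) / a, (q - b) / a]].
    apply/seteqP; split => x /=; rewrite !in_itv/= /phi/=.
      by move=> /andP[h1 h2]; rewrite ltr_pdivrMr// ler_pdivlMr//; lra.
    by rewrite ltr_pdivrMr// ler_pdivlMr// => /andP[h1 h2]; lra.
  rewrite !lebesgue_measure_itv/= !lte_fin ltr_pM2r ?invr_gt0// ltrBlDr subrK.
  case: ifPn => _; last by rewrite mule0.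
  by rewrite -EFinB -EFinM; congr EFin; field; lra.
rewrite (eq_measure_integral (m mphi)) => [|A mA _]; last exact: mE.
rewrite ge0_integral_mscale//=; congr (_ * _)%E.
by rewrite ge0_integral_pushforward.
Qed.
Lemma int_le f g : measurable_fun setT g -> (forall x, 0 <= f x <= g x) ->
  measurable_fun setT f ->
  (\int[mu]_x (f x)%:E <= \int[mu]_x (g x)%:E)%E.
Proof.
move=> mg fg mf; apply: ge0_le_integral => //=.
- by move=> x _; rewrite lee_fin; have /andP[] := fg x.
- exact/measurable_EFinP.
- exact/measurable_EFinP.
- by move=> x _; rewrite lee_fin; have /andP[] := fg x.
Qed.

Lemma integral_oppr (f : R -> \bar R) : measurable_fun setT f ->
  (forall x, 0 <= f x)%E -> (\int[mu]_x f x = \int[mu]_x f (- x)%R)%E.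
Proof.
move=> mf f0.
rewrite (eq_measure_integral (pushforward mu (-%R : R -> measurableTypeR R))).
  by rewrite ge0_integral_pushforward.
by move=> A mA _; exact/esym/lebesgue_measureN.
Qed.

(** Fatou's lemma in the form used for semicontinuity of squared norms: the bound is only eventual
    and the limit only almost everywhere. *)
Lemma int_fatou (u_ : nat -> R -> R) (u : R -> R) (K : \bar R) :
  (forall n, measurable_fun setT (u_ n)) -> measurable_fun setT u ->
  (forall n x, 0 <= u_ n x) -> (forall x, 0 <= u x) ->
  {ae mu, forall x, u_ n x @[n --> \oo] --> u x} ->
  (\forall n \near \oo, \int[mu]_x (u_ n x)%:E <= K)%E ->
  (\int[mu]_x (u x)%:E <= K)%E.
Proof.
move=> mu_ mu0 u_0 u0 uu [N _ NK].
have mE n : measurable_fun setT (EFin \o u_ n) by exact/measurable_EFinP.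
rewrite (@ae_eq_integral _ _ _ mu setT (fun x => limn_einf (fun n => (u_ n x)%:E)))//.
- apply: (@le_trans _ _ (limn_einf (fun n => (\int[mu]_x (u_ n x)%:E)%E))).
    by apply: fatou => // n x _; rewrite lee_fin.
  rewrite limn_einf_lim; apply: lime_le.
    exact: is_cvg_einfs.
  (* The infimum over indices >= n is tested at [maxn n N], where the bound [K] is available. *)
  near=> n; apply: (@le_trans _ _ (\int[mu]_x (u_ (maxn n N) x)%:E)%E).
    by apply: ereal_inf_lbound; exists (maxn n N) => //=; rewrite leq_maxl.
  by apply: NK => /=; rewrite leq_maxr.
- exact/measurable_EFinP.
- apply: (emeasurable_fun_cvg (fun n x => einfs (fun k => (u_ k x)%:E) n)).
    by move=> n; exact: measurable_fun_einfs.
  by move=> x _; rewrite limn_einf_lim; exact: is_cvg_einfs.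
- apply: filterS uu => x ux _.
  have /cvg_limn_einf_sup[-> _//] : (u_ n x)%:E @[n --> \oo] --> (u x)%:E.
  by apply: cvg_EFin => //; exact: nearW.
Unshelve. all: by end_near. Qed.

(** * The integral of (1 - cos (s t)) / t^2 *)

Lemma sin_le_id (x : R) : 0 <= x -> sin x <= x.
Proof.
rewrite le_eqVlt => /predU1P[<-|x0]; first by rewrite sin0.
have [|c _] := @MVT R sin cos 0 x x0 (fun y _ => is_derive_sin y).
  by apply: continuous_subspaceT => y; exact: continuous_sin.
by rewrite sin0 !subr0 => ->; rewrite ler_piMl ?cos_le1// ltW.
Qed.

Lemma cos_ge_sqr (x : R) : 1 - cos x <= x ^+ 2.
Proof.
wlog x0 : x / 0 <= x.
  move=> h; have [|x0] := leP 0 x; first exact: h.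
  by rewrite -cosN -sqrrN; apply: h; rewrite oppr_ge0 ltW.
have -> : x = (x / 2) *+ 2 by rewrite mulr2n; field.
rewrite cos_mulr2n cos2sin2.
have h0 : 0 <= x / 2 by rewrite divr_ge0.
have := sin_le_id h0; set y := x / 2 in h0 *; move=> h1.
suff : sin y ^+ 2 <= y ^+ 2 by have := sqr_ge0 y; rewrite !mulr2n; nra.
have [s0|s0] := leP 0 (sin y); first by rewrite ler_sqr ?nnegrE.
(* For y > 1, sin^2 y <= 1 < y^2; for y <= 1, a negative sine contradicts its positivity on ]0,
   2[. *)
have [y1|y1] := leP y 1; last first.
  by have := sin2cos2 y; have := sqr_ge0 (cos y); nra.
have : 0 <= sin y.
  have [->|yn0] := eqVneq y 0; first by rewrite sin0.
  by rewrite ltW// sin2_gt0// lt_neqAle eq_sym yn0 h0/=; lra.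
by rewrite leNgt s0.
Qed.

(* Up to the factor pi, the inverse Fourier transform of the triangle
   function; at 0 it takes the junk value 0. *)
Definition cosker (s t : R) : R := (1 - cos (s * t)) / t ^+ 2.

Lemma measurable_invr : measurable_fun setT (@GRing.inv R).
Proof.
have -> : [set: R] = [set 0] `|` ~` [set 0] by rewrite setUv.
have o0 : open (~` [set (0 : R)]) by apply: closed_openC; exact: closed_eq.
apply/measurable_funU => //; first exact: open_measurable.
split; first exact: measurable_fun_set1.
apply: open_continuous_measurable_fun => // x; rewrite inE => /eqP x0.
exact: inv_continuous.
Qed.

Lemma measurable_cosker s : measurable_fun setT (cosker s).
Proof.
apply: measurable_funM.
  apply: measurable_funB => //; apply: measurableT_comp => //.
  by apply: continuous_measurable_fun => x; exact: continuous_cos.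
have -> : (fun x : R => (x ^+ 2)^-1) = (fun x => (x ^-1) ^+ 2).
  by apply/funext => x; rewrite exprVn.
apply: measurable_funX; exact: measurable_invr.
Qed.

Lemma cosker_ge0 s t : 0 <= cosker s t.
Proof. by rewrite divr_ge0 ?sqr_ge0// subr_ge0 cos_le1. Qed.

(* The value is pi; positivity and finiteness are enough. *)
Definition kappa : R := fine (\int[mu]_x (cosker 1 x)%:E).

(** Since 1 - cos x is at most x^2 and at most 2, (1 - cos x)(1 + x^2) <= 3 x^2. One majorant thus
    settles integrability both near 0 and at infinity. *)
Lemma cosker_le_oneDsqr x : cosker 1 x <= 4 / oneDsqr x.
Proof.
rewrite /cosker mul1r /oneDsqr.
have [->|x0] := eqVneq x 0.
  by rewrite cos0 subrr mul0r divr_ge0// addr_ge0// ?sqr_ge0.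
have x2 : 0 < x ^+ 2 by rewrite exprn_even_gt0.
rewrite ler_pdivrMr// mulrAC ler_pdivlMr; last lra.
have := cos_ge_sqr x; have := cos_geN1 x; nra.
Qed.

Lemma int_oneDsqr_fin : (\int[mu]_x (4 / oneDsqr x)%:E < +oo)%E.
Proof.
rewrite ge0_symfun_integralT.
- have -> : [set x : R | 0 <= x] = `[0, +oo[%classic by rewrite set_itvcy.
  under eq_integral do rewrite EFinM.
  rewrite ge0_integralZl//=.
  + by rewrite integral0y_oneDsqr -!EFinM ltry.
  + apply/measurable_EFinP; apply: measurable_funTS.
    by apply: continuous_measurable_fun; exact: continuous_oneDsqrV.
- by move=> x; rewrite divr_ge0// addr_ge0// ?sqr_ge0.
- move=> x; apply: cvgM; [exact: cvg_cst|exact: continuous_oneDsqrV].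
- by move=> x /=; rewrite /oneDsqr sqrrN.
Qed.

Lemma int_cosker1 : (\int[mu]_x (cosker 1 x)%:E = kappa%:E)%E.
Proof.
rewrite fineK// ge0_fin_numE; last first.
  by apply: integral_ge0 => x _; rewrite lee_fin cosker_ge0.
apply: le_lt_trans int_oneDsqr_fin.
apply: int_le; [|by move=> x; rewrite cosker_ge0 cosker_le_oneDsqr|exact: measurable_cosker].
apply: measurable_funM => //; apply: continuous_measurable_fun.
exact: continuous_oneDsqrV.
Qed.

(** [cosker s t] is even in s and equals s^2 [cosker 1 (s t)]; the substitution takes one factor s
    back. *)
Lemma int_cosker s : (\int[mu]_x (cosker s x)%:E = (`|s| * kappa)%:E)%E.
Proof.
wlog s0 : s / 0 <= s.
  move=> h; have [|s0] := leP 0 s; first exact: h.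
  rewrite -normrN -h; last by rewrite oppr_ge0 ltW.
  by apply: eq_integral => x _; rewrite /cosker mulNr cosN.
rewrite ger0_norm//; move: s0; rewrite le_eqVlt => /predU1P[<-|s0].
  rewrite mul0r; apply: integral0_eq => x _.
  by rewrite /cosker mul0r cos0 subrr mul0r.
have mk : measurable_fun setT (EFin \o cosker 1).
  by apply/measurable_EFinP; exact: measurable_cosker.
rewrite EFinM -int_cosker1 [in RHS](@integral_affine s 0)//; last first.
  by move=> x; rewrite lee_fin cosker_ge0.
rewrite muleA -EFinM -ge0_integralZl_EFin//.
- apply: eq_integral => x _; rewrite /= addr0 -EFinM /cosker mul1r.
  congr EFin; have [->|x0] := eqVneq x 0; first by rewrite !mulr0 expr0n/= invr0 !mulr0.
  by field; rewrite x0 gt_eqF.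
- by move=> x _; rewrite lee_fin cosker_ge0.
- by move: mk => /measurable_EFinP mk; apply/measurable_EFinP; apply: (measurableT_comp mk) => /=;
    apply: measurable_funD => //; apply: measurable_funM.
- by rewrite mulr_ge0// ltW.
Qed.

Lemma kappa_gt0 : 0 < kappa.
Proof.
rewrite lt_neqAle fine_ge0 ?andbT; last first.
  by apply: integral_ge0 => x _; rewrite lee_fin cosker_ge0.
apply/eqP => k0; have : (\int[mu]_x `|(cosker 1 x)%:E| = 0)%E.
  rewrite -[RHS]/(0%:E) k0 -int_cosker1; apply: eq_integral => x _.
  by rewrite gee0_abs// lee_fin cosker_ge0.
have mk : measurable_fun setT (EFin \o cosker 1).
  by apply/measurable_EFinP; exact: measurable_cosker.
move/(ae_eq_integral_abs mu measurableT mk) => -[N [mN N0 sN]].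
(* A zero integral makes [cosker 1] vanish off the null set [N], but on ]0, 1[ the sine is positive,
   so the cosine is not 1 there. *)
have : (mu `]0%R, 1%R[ <= mu N)%E.
  apply: le_measure; rewrite ?inE//; apply: subset_trans sN => x /=.
  rewrite in_itv/= => /andP[x0 x1] /(_ I) /eqP; rewrite eqe /cosker mul1r.
  rewrite mulf_eq0 invr_eq0 expf_eq0/= (gt_eqF x0) orbF subr_eq0 => /eqP c1.
  have : 0 < sin x by rewrite sin2_gt0// x0/=; lra.
  by have := cos2Dsin2 x; rewrite -c1; nra.
have N0' : mu N = 0%E := N0.
by rewrite N0' lebesgue_measure_itv/= lte01 oppr0 adde0 lee_fin ler10.
Qed.

(** * Cosine and sine transforms of step functions *)

Definition trig_transform (h : R -> R) u (xi : R) : R :=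
  \int[mu]_x (h (xi * x) * u x).

(** What cosine and sine share as kernels, so that both transforms are treated at once. *)
Definition osc (h : R -> R) := continuous h /\ (forall x, `|h x| <= 1).

Lemma osc_cos : osc cos.
Proof. by split; [exact: continuous_cos|exact: cos_max]. Qed.

Lemma osc_sin : osc sin.
Proof. by split; [exact: continuous_sin|exact: sin_max]. Qed.

Local Notation intR u := (mu.-integrable setT (EFin \o u)).

Lemma intRP u : intR u <->
  measurable_fun setT u /\ (\int[mu]_x `|u x|%:E < +oo)%E.
Proof.
split=> [/integrableP[/measurable_EFinP ? ?]//|[? ?]].
by apply/integrableP; split => //; exact/measurable_EFinP.
Qed.

Lemma intR_le u v : measurable_fun setT u -> (forall x, `|u x| <= `|v x|) ->
  intR v -> intR u.
Proof.
move=> mu0 uv iv; apply: (le_integrable measurableT _ _ iv).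
  exact/measurable_EFinP.
by move=> x _; rewrite /= lee_fin.
Qed.

Lemma intRZ c u : intR u -> intR (fun x => c * u x).
Proof. by move=> iu; exact: (integrableZl _ c iu). Qed.

Lemma intRD u v : intR u -> intR v -> intR (fun x => u x + v x).
Proof. by move=> iu iv; exact: (integrableD _ iu iv). Qed.

Lemma intRB u v : intR u -> intR v -> intR (fun x => u x - v x).
Proof. by move=> iu iv; exact: (integrableB _ iu iv). Qed.

Lemma osc_measurable (h : R -> R) (xi : R) : osc h ->
  measurable_fun setT (fun x : R => h (xi * x)).
Proof.
move=> [ch _]; apply: (measurableT_comp (f := h)); last exact: measurable_funM.
exact: continuous_measurable_fun.
Qed.

Lemma osc_intR h u xi : osc h -> intR u -> intR (fun x => h (xi * x) * u x).
Proof.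
move=> oh /[dup] iu /intRP[mu0 _]; apply: intR_le iu.
  by apply: measurable_funM => //; exact: osc_measurable.
by move=> x; rewrite normrM ler_piMl// oh.2.
Qed.

Lemma trig_transform_lin h c u v xi : osc h -> intR u -> intR v ->
  trig_transform h (fun x => c * u x + v x) xi =
  c * trig_transform h u xi + trig_transform h v xi.
Proof.
move=> oh iu iv; rewrite /trig_transform -RintegralZl//; last exact: osc_intR.
rewrite -RintegralD//; [|exact/intRZ/osc_intR|exact: osc_intR].
by apply: eq_Rintegral => x _; ring.
Qed.

Lemma trig_transform_bound h u xi : osc h -> intR u ->
  (`|trig_transform h u xi|%:E <= \int[mu]_x `|u x|%:E)%E.
Proof.
move=> oh iu.
have i1 := osc_intR xi oh iu.
rewrite EFin_normr_Rintegral//.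
apply: le_trans; first by apply: le_abse_integral => //; case/integrableP: i1.
move/intRP : iu => [mu0 _]; move/intRP : i1 => [m1 _].
apply: int_le; first exact: measurableT_comp.
  by move=> x; rewrite normr_ge0/= normrM ler_piMl// oh.2.
exact: measurableT_comp.
Qed.

Local Notation ind a b := (\1_`]a, b]%classic : R -> R).

(** The intervals may overlap, so sums of steps need no common refinement, and a bilinear identity
    extends from indicators by induction on each argument. *)
Inductive step : (R -> R) -> Prop :=
| step0 : step (fun=> 0)
| stepD c a b s : a <= b -> step s -> step (fun x => c * ind a b x + s x).

Lemma measurable_ind (a b : R) : measurable_fun setT (ind a b).
Proof. exact: measurable_indic. Qed.

Lemma ind_intR (a b : R) : intR (ind a b).
Proof. exact: integrable_indic_itv. Qed.

Lemma int_ind (a b : R) : a <= b -> \int[mu]_x ind a b x = b - a.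
Proof.
move=> ab; rewrite /Rintegral integral_indic//= setIT lebesgue_measure_itv/= lte_fin.
by case: ifPn => //; rewrite -leNgt => ba /=; rewrite (@le_anti _ _ a b) ?subrr// ab.
Qed.

Lemma step_intR s : step s -> intR s.
Proof.
elim=> [|c a b {}s _ _ IH]; first exact: integrable0.
by apply: intRD => //; apply: intRZ; exact: ind_intR.
Qed.

Lemma ind_trig_transform (h H : R -> R) (a b xi : R) : osc h -> xi != 0 -> a <= b ->
  (forall x : R, is_derive x 1 H (h x)) ->
  trig_transform h (ind a b) xi = (H (xi * b) - H (xi * a)) / xi.
Proof.
move=> oh xi0; rewrite le_eqVlt => /predU1P[<- _|ab dH].
  rewrite subrr mul0r /trig_transform set_itvoc0 indic0.
  by under eq_Rintegral do rewrite mulr0; rewrite /Rintegral integral0.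
have dF (x : R) : is_derive x 1 (fun x => H (xi * x) / xi) (h (xi * x)).
  have d1 : is_derive x 1 ( *%R xi) xi.
    by have := @is_deriveZ R R R id xi x 1 1 _; rewrite /GRing.scale/= mulr1; apply.
  have d2 := @is_derive1_comp _ H ( *%R xi) x _ _ (dH _) d1.
  have -> : (fun x => H (xi * x) / xi) = xi^-1 \*: (H \o *%R xi).
    by apply/funext => y /=; rewrite mulrC.
  have := @is_deriveZ R R R _ xi^-1 x 1 _ d2.
  by rewrite /GRing.scale/= mulrCA mulVf// mulr1.
have cf : continuous (fun x : R => h (xi * x)).
  by move=> x; apply: (@continuous_comp _ _ _ ( *%R xi) h);
    [exact: mulrl_continuous|exact: oh.1].
have cF : continuous (fun x : R => H (xi * x) / xi).
  by move=> x; apply/differentiable_continuous/derivable1_diffP; case: (dF x).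
transitivity (\int[mu]_(x in `]a, b]) h (xi * x)).
  rewrite [RHS]Rintegral_mkcond; apply: eq_Rintegral => x _.
  by rewrite patch_indic.
rewrite /Rintegral integral_itv_obnd_cbnd//; last first.
  by apply/measurable_EFinP; apply: measurable_funTS; exact: continuous_measurable_fun.
rewrite (continuous_FTC2 ab (F := fun x => H (xi * x) / xi))//=.
- by rewrite mulrBl.
- exact: continuous_subspaceT.
- split.
  + by move=> x _; case: (dF x).
  + by apply: cvg_at_right_filter; exact: cF.
  + by apply: cvg_at_left_filter; exact: cF.
- by move=> x _; rewrite derive1E; case: (dF x).
Qed.

(* The cosine and sine transforms of an indicator, multiplied together, are
   combinations of [cosker]: this is what makes the scaling identity
   [int_cosker] sufficient for Plancherel. *)
Definition ppair u v (xi : R) : R :=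
  trig_transform cos u xi * trig_transform cos v xi +
  trig_transform sin u xi * trig_transform sin v xi.

(** The subtraction formula leaves four cosines over xi^2, two of each sign, so each can be
    completed to 1 - cos without changing the sum; every term is then integrable on its own. *)
Lemma ind_ppair (a b c d xi : R) : xi != 0 -> a <= b -> c <= d ->
  ppair (ind a b) (ind c d) xi =
  cosker (b - c) xi + cosker (a - d) xi - (cosker (b - d) xi + cosker (a - c) xi).
Proof.
move=> xi0 ab cd; rewrite /ppair.
rewrite !(@ind_trig_transform cos sin)//; [|exact: osc_cos|exact: osc_cos].
have dsin (x : R) : is_derive x 1 (fun x => - cos x) (sin x).
  have := @is_deriveN _ _ _ cos x 1 _ (is_derive_cos x); rewrite opprK; apply.
rewrite !(@ind_trig_transform sin (fun x => - cos x))//; [|exact: osc_sin|exact: osc_sin].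
rewrite /cosker !mulrBl !cosB !(mulrC _ xi).
by field.
Qed.

(** The closed formulas for the transforms divide by the frequency and fail at 0. An explicit
    correction on the singleton carries over both measurability and integrals. *)
Lemma eq_off0 u v : (forall x : R, x != 0 -> u x = v x) ->
  u = (fun x => v x + (u 0 - v 0) * \1_[set (0 : R)] x).
Proof.
move=> uv; apply/funext => x; have [->|x0] := eqVneq x 0.
  by rewrite indicE mem_set//= mulr1 addrC subrK.
by rewrite indicE (memNset _)/= ?mulr0 ?addr0 ?uv// => xx; move: x0; rewrite xx eqxx.
Qed.

Lemma measurable_off0 u v : (forall x : R, x != 0 -> u x = v x) ->
  measurable_fun setT v -> measurable_fun setT u.
Proof.
move=> /eq_off0 -> mv; apply: measurable_funD => //.
by apply: measurable_funM => //; exact: measurable_indic.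
Qed.

Lemma intR_off0 u v : (forall x : R, x != 0 -> u x = v x) -> intR v ->
  intR u /\ \int[mu]_x u x = \int[mu]_x v x.
Proof.
move=> /eq_off0 -> iv.
have e0 : (\int[mu]_x (\1_[set (0 : R)] x)%:E = 0)%E.
  by rewrite integral_indic// setIT; exact: lebesgue_measure_set1.
have i0 : intR (\1_[set (0 : R)] : R -> R).
  apply/intRP; split; first exact: measurable_indic.
  under eq_integral do rewrite ger0_norm//.
  by rewrite e0 ltry.
split; first by apply: intRD => //; exact: intRZ.
rewrite RintegralD//; last exact: intRZ.
rewrite RintegralZl// [X in _ + _ * X](_ : _ = 0); last by rewrite /Rintegral e0.
by rewrite mulr0 addr0.
Qed.

Lemma cosker_intR s : intR (cosker s) /\ \int[mu]_x cosker s x = `|s| * kappa.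
Proof.
split; last by rewrite /Rintegral int_cosker.
apply/intRP; split; first exact: measurable_cosker.
under eq_integral do rewrite ger0_norm ?cosker_ge0//.
by rewrite int_cosker ltry.
Qed.

Lemma measurable_step_transform (h H : R -> R) s : osc h ->
  (forall x : R, is_derive x 1 H (h x)) -> continuous H -> step s ->
  measurable_fun setT (trig_transform h s).
Proof.
move=> oh dH cH; elim=> [|c a b {}s ab ss IH].
  rewrite (_ : trig_transform _ _ = fun=> 0)//; apply/funext => xi.
  rewrite /trig_transform; under eq_Rintegral do rewrite mulr0.
  by rewrite /Rintegral integral0.
rewrite (_ : trig_transform _ _ = fun xi =>
    c * trig_transform h (ind a b) xi + trig_transform h s xi); last first.
  by apply/funext => xi; rewrite trig_transform_lin//; [exact: ind_intR|exact: step_intR].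
apply: measurable_funD => //; apply: measurable_funM => //.
apply: (measurable_off0 (v := fun xi => (H (xi * b) - H (xi * a)) / xi)).
  by move=> xi xi0; exact: ind_trig_transform.
apply: measurable_funM; last exact: measurable_invr.
by apply: measurable_funB; apply: (measurableT_comp (f := H));
  (try exact: continuous_measurable_fun); apply: measurable_funM.
Qed.

Definition plancherel_pair u v := [/\ intR (ppair u v), intR (u \* v) &
  \int[mu]_x ppair u v x = 2 * kappa * \int[mu]_x (u x * v x)].

(** The right-hand side is, up to sign, half the mixed difference of |x - y| over the rectangle
    [a, b] x [c, d]. As |x - y| bends only on the diagonal, it measures the piece of the diagonal
    inside the rectangle, that is, the overlap. *)
Lemma overlap_length (a b c d : R) : a <= b -> c <= d ->
  Num.max 0 (Num.min b d - Num.max a c) =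
  (`|b - c| + `|a - d| - (`|b - d| + `|a - c|)) / 2.
Proof.
move=> ab cd.
have [bc|bc] := leP b c.
  rewrite (ler0_norm (_ : b - c <= 0)); last lra.
  rewrite (ler0_norm (_ : a - d <= 0)); last lra.
  rewrite (ler0_norm (_ : b - d <= 0)); last lra.
  rewrite (ler0_norm (_ : a - c <= 0)); last lra.
  by rewrite (min_l (_ : b <= d)) ?(max_r (_ : a <= c)) ?max_l; lra.
have [da|da] := leP d a.
  rewrite (ger0_norm (_ : 0 <= b - c)); last lra.
  rewrite (ger0_norm (_ : 0 <= a - d)); last lra.
  rewrite (ger0_norm (_ : 0 <= b - d)); last lra.
  rewrite (ger0_norm (_ : 0 <= a - c)); last lra.
  by rewrite (min_r (_ : d <= b)) ?(max_l (_ : c <= a)) ?max_l; lra.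
rewrite (ger0_norm (_ : 0 <= b - c)); last lra.
rewrite (ler0_norm (_ : a - d <= 0)); last lra.
by case: (leP b d) => bd; case: (leP a c) => ac;
  [rewrite (ler0_norm (_ : b - d <= 0))|rewrite (ler0_norm (_ : b - d <= 0))|
   rewrite (ger0_norm (_ : 0 <= b - d))|rewrite (ger0_norm (_ : 0 <= b - d))];
  try lra; [rewrite (ler0_norm (_ : a - c <= 0))|
   rewrite (ger0_norm (_ : 0 <= a - c))|rewrite (ler0_norm (_ : a - c <= 0))|
   rewrite (ger0_norm (_ : 0 <= a - c))]; rewrite ?max_r; lra.
Qed.

(** Origin of the constant 2 [kappa]: each [cosker] integrates to [kappa] times a distance, and the
    signed sum of the four distances is twice the overlap. With [kappa] = pi this is the usual 2
    pi. *)
Lemma ind_plancherel (a b c d : R) : a <= b -> c <= d ->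
  plancherel_pair (ind a b) (ind c d).
Proof.
move=> ab cd.
have [i1 j1] := cosker_intR (b - c); have [i2 j2] := cosker_intR (a - d).
have [i3 j3] := cosker_intR (b - d); have [i4 j4] := cosker_intR (a - c).
have i12 := intRD i1 i2; have i34 := intRD i3 i4.
have [i5 j5] := intR_off0 (fun xi xi0 => ind_ppair xi0 ab cd) (intRB i12 i34).
have indM : ind a b \* ind c d = ind (Num.max a c) (Num.min b d).
  apply/funext => x /=; rewrite !indicE -natrM mulnb -in_setI; congr (_ _)%:R.
  congr (x \in _); apply/seteqP; split=> y /=;
    rewrite !in_itv/= ?gt_max ?le_min.
    by move=> [/andP[-> ->] /andP[-> ->]].
  by move=> /andP[/andP[-> ->] /andP[-> ->]].
split => //; first by rewrite indM; exact: ind_intR.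
rewrite j5 RintegralB// !RintegralD// j1 j2 j3 j4.
rewrite (_ : \int[mu]_x (ind a b x * ind c d x) =
             \int[mu]_x ind (Num.max a c) (Num.min b d) x); last by rewrite -indM.
have -> : \int[mu]_x ind (Num.max a c) (Num.min b d) x =
    (`|b - c| + `|a - d| - (`|b - d| + `|a - c|)) / 2.
  rewrite -overlap_length//; have [le|lt] := leP (Num.max a c) (Num.min b d).
    by rewrite int_ind// (@max_r _ _ 0) ?subr_ge0.
  rewrite set_itv_ge ?bnd_simp -?leNgt//; last exact: ltW.
  by rewrite indic0 /Rintegral integral0/= (@max_l _ _ 0)// subr_le0 ltW.
by field.
Qed.

Lemma plancherel_pairC u v : plancherel_pair u v -> plancherel_pair v u.
Proof.
rewrite /plancherel_pair.
have -> : ppair v u = ppair u v.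
  by apply/funext => x; rewrite /ppair mulrC [X in _ + X]mulrC.
have -> : v \* u = u \* v by apply/funext => x /=; rewrite mulrC.
by under [X in _ -> [/\ _, _ & _ = _ * X]]eq_Rintegral do rewrite mulrC.
Qed.

Lemma plancherel_pairD c u v w : intR u -> intR v ->
  plancherel_pair u w -> plancherel_pair v w ->
  plancherel_pair (fun x => c * u x + v x) w.
Proof.
move=> iu iv [p1 m1 e1] [p2 m2 e2]; split.
- rewrite (_ : ppair _ _ = fun x => c * ppair u w x + ppair v w x).
    by apply: intRD => //; exact: intRZ.
  apply/funext => x; rewrite /ppair !trig_transform_lin//; [ring|exact: osc_sin|exact: osc_cos].
- rewrite (_ : _ \* _ = fun x => c * (u x * w x) + v x * w x).
    by apply: intRD => //; exact: intRZ.
  by apply/funext => x /=; ring.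
- rewrite (_ : ppair _ _ = fun x => c * ppair u w x + ppair v w x); last first.
    apply/funext => x; rewrite /ppair !trig_transform_lin//; [ring|exact: osc_sin|exact: osc_cos].
  rewrite RintegralD//; last exact: intRZ.
  rewrite RintegralZl// e1 e2.
  under [in RHS]eq_Rintegral do rewrite mulrDl -mulrA.
  rewrite RintegralD//; last exact: intRZ.
  by rewrite RintegralZl//; ring.
Qed.

Lemma plancherel_pair0 u : plancherel_pair (fun=> 0) u.
Proof.
have t0 h xi : trig_transform h (fun=> 0) xi = 0.
  rewrite /trig_transform; under eq_Rintegral do rewrite mulr0.
  by rewrite /Rintegral integral0.
have p0 : ppair (fun=> 0) u = fun=> 0.
  by apply/funext => xi; rewrite /ppair !t0 !mul0r addr0.
have m0 : (fun=> 0) \* u = fun=> 0 by apply/funext => x /=; rewrite mul0r.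
split; rewrite ?p0 ?m0; [exact: integrable0|exact: integrable0|].
under [in RHS]eq_Rintegral do rewrite mul0r.
by rewrite /Rintegral integral0/= mulr0.
Qed.

Lemma step_plancherel_pair s t : step s -> step t -> plancherel_pair s t.
Proof.
move=> + st; elim=> [|c a b {}s ab ss IH]; first exact: plancherel_pair0.
apply: plancherel_pairD; [exact: ind_intR|exact: step_intR| |exact: IH].
elim: st => [|d p q {}t pq tt {}IH]; first exact/plancherel_pairC/plancherel_pair0.
apply/plancherel_pairC/plancherel_pairD;
  [exact: ind_intR|exact: step_intR|exact: ind_plancherel|exact: plancherel_pairC].
Qed.

(** For integrable real u this is the squared L^2 norm of its Fourier integral, whose real and
    imaginary parts are the cosine and sine transforms. *)
Definition energy u : \bar R := (\int[mu]_x (ppair u u x)%:E)%E.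

Definition sqint u : \bar R := (\int[mu]_x (u x ^+ 2)%:E)%E.

Lemma ppair_ge0 u x : 0 <= ppair u u x.
Proof. by rewrite addr_ge0// -expr2 sqr_ge0. Qed.

Lemma step_energy s : step s ->
  energy s = ((2 * kappa)%:E * sqint s)%E /\ (sqint s < +oo)%E.
Proof.
move=> ss; have [i1 i2 e] := step_plancherel_pair ss ss.
have f2 := integrable_fin_num measurableT i2.
have e2 : sqint s = (\int[mu]_x (s x * s x)%:E)%E.
  by apply: eq_integral => x _; rewrite expr2.
rewrite /energy e2; split.
  rewrite -(fineK (integrable_fin_num measurableT i1)) -(fineK f2) -EFinM.
  by congr EFin; exact: e.
by move: f2; rewrite fin_numElt => /andP[].
Qed.

(** * Density of step functions in L^1 and L^2 simultaneously *)

(** The L^1 norm plus the squared L^2 norm. The first term controls the transforms uniformly in the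
    frequency, the second the L^2 distance, so one approximation serves for both. It is not
    homogeneous, whence the factor |c| + c^2 in [N12_lin]. *)
Definition N12 u : \bar R := (\int[mu]_x (`|u x| + u x ^+ 2)%:E)%E.

Lemma N12_ge0 u : (0 <= N12 u)%E.
Proof. by apply: integral_ge0 => x _; rewrite lee_fin addr_ge0// sqr_ge0. Qed.

Lemma measurable_N12 u : measurable_fun setT u ->
  measurable_fun setT (fun x => `|u x| + u x ^+ 2).
Proof.
by move=> mu0; apply: measurable_funD; [exact: measurableT_comp|exact: measurable_funX].
Qed.

Lemma N12_le u v : measurable_fun setT u -> measurable_fun setT v ->
  (forall x, `|u x| <= `|v x|) -> (N12 u <= N12 v)%E.
Proof.
move=> mu0 mv uv; apply: int_le; [exact: measurable_N12| |exact: measurable_N12].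
move=> x; rewrite addr_ge0 ?sqr_ge0//=; apply: lerD => //.
by rewrite -[u x ^+ 2]real_normK ?num_real// -[v x ^+ 2]real_normK ?num_real// ler_sqr ?nnegrE.
Qed.

Lemma N12_lin c u v : measurable_fun setT u -> measurable_fun setT v ->
  (N12 (fun x => (c * u x + v x)%R) <=
   (2 * (`|c| + c ^+ 2))%:E * N12 u + 2%:E * N12 v)%E.
Proof.
move=> mu0 mv.
have mNu := measurable_N12 mu0; have mNv := measurable_N12 mv.
have c0 : 0 <= 2 * (`|c| + c ^+ 2) by rewrite mulr_ge0// addr_ge0// sqr_ge0.
have N0 (w : R -> R) x : 0 <= `|w x| + w x ^+ 2 by rewrite addr_ge0// sqr_ge0.
rewrite /N12 -!ge0_integralZl_EFin//; try by move=> x _; rewrite lee_fin N0.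
all: try exact/measurable_EFinP.
rewrite -ge0_integralD//; last first.
- by apply/measurable_EFinP; apply: measurable_funM.
- by move=> x _; rewrite -EFinM lee_fin mulr_ge0.
- by apply/measurable_EFinP; apply: measurable_funM.
- by move=> x _; rewrite -EFinM lee_fin mulr_ge0.
rewrite [leRHS](_ : _ = \int[mu]_x (2 * (`|c| + c ^+ 2) * (`|u x| + u x ^+ 2) +
  2 * (`|v x| + v x ^+ 2))%:E)%E; last by [].
apply: int_le.
- by apply: measurable_funD; apply: measurable_funM.
- move=> x; rewrite (N0 (fun x => c * u x + v x))/=.
  have h1 := ler_normD (c * u x) (v x); rewrite normrM in h1.
  have h2 : (c * u x + v x) ^+ 2 <= 2 * (c ^+ 2 * u x ^+ 2) + 2 * v x ^+ 2.
    by have := sqr_ge0 (c * u x - v x); nra.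
  have h3 : 0 <= `|c| * `|u x| by rewrite mulr_ge0.
  have h4 : 0 <= `|c| * u x ^+ 2 by rewrite mulr_ge0// sqr_ge0.
  have h5 : 0 <= c ^+ 2 * `|u x| by rewrite mulr_ge0// sqr_ge0.
  have h6 : 0 <= `|v x| by [].
  by lra.
- by apply: measurable_N12; apply: measurable_funD => //; apply: measurable_funM.
Qed.

Lemma N12_dominated (u_ : nat -> R -> R) u g :
  (forall n, measurable_fun setT (u_ n)) -> measurable_fun setT u ->
  measurable_fun setT g -> (N12 g < +oo)%E ->
  (forall n x, `|u_ n x| <= g x) -> (forall x, u_ n x @[n --> \oo] --> u x) ->
  forall e : R, 0 < e ->
    \forall n \near \oo, (N12 (fun x => u x - u_ n x)%R <= e%:E)%E.
Proof.
move=> mu_ mu0 mg ig u_g u_u e e0.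
have ug x : `|u x| <= g x.
  have := u_u x => /cvg_norm h; rewrite -(cvg_lim _ h)//.
  by apply: limr_le; [apply/cvg_ex; eexists; exact: h|exact: nearW].
have md n : measurable_fun setT (fun x => u x - u_ n x) by exact: measurable_funB.
(* Both u and u_n are bounded by g, so |u - u_n| <= 2 g and the integrand is at most 2 g + 4 g^2. *)
have ig2 : mu.-integrable setT (fun x => (4 * (`|g x| + g x ^+ 2))%:E).
  apply/integrableP; split.
    by apply/measurable_EFinP; apply: measurable_funM => //; exact: measurable_N12.
  rewrite (_ : integral _ _ _ = (4%:E * N12 g)%E) ?lte_mul_pinfty//.
  rewrite /N12 -ge0_integralZl_EFin//.
  - apply: eq_integral => x _; rewrite abse_EFin ger0_norm -?EFinM//.
    by rewrite mulr_ge0// addr_ge0// sqr_ge0.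
  - by move=> x _; rewrite lee_fin addr_ge0// sqr_ge0.
  - by apply/measurable_EFinP; exact: measurable_N12.
pose d_ n x := (`|u x - u_ n x| + (u x - u_ n x) ^+ 2)%:E.
have mfd n : measurable_fun setT (d_ n).
  by apply/measurable_EFinP; exact: measurable_N12.
have dcvg : {ae mu, forall x, setT x -> d_ ^~ x @ \oo --> cst 0%E x}.
  apply: aeW => x _; apply: cvg_EFin; first exact: nearW.
  have uu0 : u x - u_ n x @[n --> \oo] --> (0 : R).
    by rewrite -(subrr (u x)); apply: cvgB => //; exact: cvg_cst.
  have h : `|u x - u_ n x| + (u x - u_ n x) * (u x - u_ n x) @[n --> \oo]
      --> `|(0 : R)| + 0 * 0.
    by apply: cvgD; [exact: cvg_norm|exact: cvgM].
  by rewrite normr0 mulr0 addr0 in h.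
have db : {ae mu, forall x n, setT x -> (`|d_ n x| <= (4 * (`|g x| + g x ^+ 2))%:E)%E}.
  apply: aeW => x n _; rewrite abse_EFin lee_fin ger0_norm; last first.
    by rewrite addr_ge0// sqr_ge0.
  have h1 := u_g n x; have h2 := ug x; have h3 := ler_normB (u x) (u_ n x).
  rewrite -[(u x - _) ^+ 2]real_normK ?num_real//.
  have g0 : 0 <= g x by apply: le_trans h2.
  rewrite (ger0_norm g0).
  have h4 : `|u x - u_ n x| <= 2 * g x by lra.
  have h5 : 0 <= `|u x - u_ n x| by [].
  by nra.
case: (@dominated_convergence _ (measurableTypeR R) R mu setT measurableT
  d_ (cst 0%E) _ mfd (measurable_cst _) dcvg ig2 db) => _ + _.
move=> /fine_cvgP[fin] /cvgrPdist_le/(_ _ e0); near_simpl; move: fin.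
apply: filterS2 => n /= fin.
have E : N12 (fun x => u x - u_ n x)%R = (\int[mu]_x `|d_ n x - cst 0 x|)%E.
  apply: eq_integral => x _; rewrite sube0 gee0_abs// lee_fin.
  by rewrite addr_ge0// sqr_ge0.
rewrite E -(fineK fin) lee_fin sub0r normrN; apply: le_trans.
exact: ler_norm.
Unshelve. all: by end_near. Qed.

Definition approximable u := measurable_fun setT u /\
  forall e : R, 0 < e -> exists2 s, step s & (N12 (fun x => u x - s x)%R <= e%:E)%E.

Lemma step_measurable s : step s -> measurable_fun setT s.
Proof. by move=> /step_intR /intRP[]. Qed.

Lemma step_lin c s t : step s -> step t -> step (fun x => c * s x + t x).
Proof.
move=> + st; elim=> [|d a b {}s ab ss IH].
  by under eq_fun do rewrite mulr0 add0r.
rewrite (_ : (fun _ => _) = fun x => (c * d) * ind a b x + (c * s x + t x)).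
  exact: stepD.
by apply/funext => x; ring.
Qed.

Lemma step_approximable s : step s -> approximable s.
Proof.
move=> ss; split; first exact: step_measurable.
move=> e e0; exists s => //; rewrite /N12.
by rewrite integral0_eq ?lee_fin ?ltW// => x _; rewrite subrr normr0 expr0n addr0.
Qed.

Lemma approximable_lin c u v : approximable u -> approximable v ->
  approximable (fun x => c * u x + v x).
Proof.
move=> [mu0 au] [mv av]; split.
  by apply: measurable_funD => //; apply: measurable_funM.
(* The summand 1 keeps [k] positive when c = 0. *)
move=> e e0; pose k := 2 * (`|c| + c ^+ 2) + 1.
have k0 : 0 < k by rewrite ltr_wpDl// mulr_ge0// addr_ge0// sqr_ge0.
have [s ss us] := au (e / 2 / k) (divr_gt0 (divr_gt0 e0 (ltr0n _ 2)) k0).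
have [t st vt] := av (e / 4) (divr_gt0 e0 (ltr0n _ 4)).
exists (fun x => c * s x + t x); first exact: step_lin.
have ms := step_measurable ss; have mt := step_measurable st.
rewrite (_ : (fun _ => _) = fun x => c * (u x - s x) + (v x - t x)); last first.
  by apply/funext => x; ring.
apply: le_trans.
  by apply: N12_lin; exact: measurable_funB.
have -> : (e%:E = k%:E * (e / 2 / k)%:E + 2%:E * (e / 4)%:E)%E.
  by rewrite -!EFinM -EFinD; congr EFin; field; rewrite gt_eqF.
apply: leeD; last exact: lee_wpmul2l.
apply: lee_pmul => //; [|exact: N12_ge0|].
  by rewrite lee_fin mulr_ge0// addr_ge0// sqr_ge0.
by rewrite lee_fin lerDl.
Qed.

Lemma approximable_lim u : measurable_fun setT u ->
  (forall e : R, 0 < e -> exists2 v, approximable v &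
     (N12 (fun x => u x - v x)%R <= e%:E)%E) ->
  approximable u.
Proof.
move=> mu0 au; split=> // e e0.
have [v [mv av] uv] := au (e / 8) (divr_gt0 e0 (ltr0n _ 8)).
have [s ss vs] := av (e / 4) (divr_gt0 e0 (ltr0n _ 4)).
exists s => //; have ms := step_measurable ss.
rewrite (_ : (fun _ => _) = fun x => 1 * (u x - v x) + (v x - s x)); last first.
  by apply/funext => x; ring.
apply: le_trans.
  by apply: N12_lin; exact: measurable_funB.
have -> : (e%:E = (2 * (`|1| + 1 ^+ 2))%:E * (e / 8)%:E + 2%:E * (e / 4)%:E)%E.
  by rewrite -!EFinM -EFinD; congr EFin; rewrite normr1; field.
by apply: leeD; apply: lee_wpmul2l => //; rewrite lee_fin ?normr1; lra.
Qed.

Lemma approximable_dominated (u_ : nat -> R -> R) u g :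
  measurable_fun setT g -> (N12 g < +oo)%E ->
  (forall n, approximable (u_ n)) ->
  (forall n x, `|u_ n x| <= g x) -> (forall x, u_ n x @[n --> \oo] --> u x) ->
  approximable u.
Proof.
move=> mg ig au ug uu.
have mu_ n : measurable_fun setT (u_ n) by case: (au n).
have mu0 : measurable_fun setT u.
  by apply: (measurable_fun_cvg mu_) => x _; exact: uu.
apply: approximable_lim => // e e0.
have [N _ H] := N12_dominated mu_ mu0 mg ig ug uu e0.
by exists (u_ N) => //; apply: H => /=.
Qed.

Lemma approximable_sum (I : Type) (r : seq I) (c : I -> R) (u_ : I -> R -> R) :
  (forall i, approximable (u_ i)) ->
  approximable (fun x => \sum_(i <- r) c i * u_ i x).
Proof.
move=> au; elim: r => [|i r IH].
  by under eq_fun do rewrite big_nil; exact/step_approximable/step0.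
by under eq_fun do rewrite big_cons; exact: approximable_lin.
Qed.

Lemma N12_ind (a b : R) : (N12 (ind a b) < +oo)%E.
Proof.
rewrite /N12 [ltLHS](_ : _ = \int[mu]_x (2%:E * (ind a b x)%:E))%E; last first.
  apply: eq_integral => x _; rewrite -EFinM indicE; case: (x \in _) => /=; congr EFin;
    by rewrite ?normr1 ?normr0; ring.
rewrite integralZl//; last exact: ind_intR.
by rewrite lte_mul_pinfty//; apply: integrable_lty => //; exact: ind_intR.
Qed.

Lemma sum_indic_trivIset (F : nat -> set R) (J : set R) (n : nat) (x : R) :
  trivIset setT F ->
  \sum_(i < n) 1 * \1_(F i `&` J) x =
  (x \in \big[setU/set0]_(i < n) F i `&` J)%:R :> R.
Proof.
move=> tF; elim: n => [|n IH]; first by rewrite !big_ord0 set0I in_set0.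
rewrite !big_ord_recr/= IH mul1r indicE setIUl in_setU.
case: (boolP (x \in F n `&` J)) => [|_]; last by rewrite orbF addr0.
rewrite inE => -[Fnx _]; rewrite orbT memNset ?add0r// => -[+ _].
rewrite -bigcup_mkord => -[k /= kn Fkx].
by have kE : k = n; [apply: tF => //; exists x|rewrite kE ltnn in kn].
Qed.

(** A Dynkin class argument started from half-open intervals, which are stable under intersection.
    The bounded window [J] keeps complements of finite measure, and its indicator dominates the
    partial sums of a disjoint union. *)
Lemma approximable_indic (N : nat) (A : set R) : measurable A ->
  approximable (\1_(A `&` `]- N%:R, N%:R]%classic)).
Proof.
set J := `]- N%:R, N%:R]%classic.
have aJ : approximable (\1_J : R -> R).
  apply: step_approximable; rewrite (_ : \1_J = fun x => 1 * ind (- N%:R) N%:R x + 0).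
    by apply: stepD; [rewrite ge0_cp// ?ler0n|exact: step0].
  by apply/funext => x; rewrite mul1r addr0.
pose P A := approximable (\1_(A `&` J) : R -> R).
move=> mA.
apply: (@dynkin_induction _ (measurableTypeR R) (@ocitv R) P) => //.
- exact: ocitvI.
- by rewrite /P setTI.
- move=> _ [[a b] _ <-]; rewrite /P/=; apply: step_approximable.
  have [ab|ab] := leP (Num.max a (- N%:R)) (Num.min b N%:R).
    rewrite (_ : \1_ _ = fun x => 1 * ind (Num.max a (- N%:R)) (Num.min b N%:R) x + 0).
      by apply: stepD => //; exact: step0.
    apply/funext => x; rewrite mul1r addr0 !indicE; congr (_ _)%:R.
    congr (x \in _); apply/seteqP; split=> y; rewrite /J /= !in_itv/= ?gt_max ?le_min.
      by move=> [/andP[-> ->] /andP[-> ->]].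
    by move=> /andP[/andP[-> ->] /andP[-> ->]].
  rewrite (_ : _ `&` _ = set0) ?indic0; first exact: step0.
  apply/seteqP; split=> y //; rewrite /J /= !in_itv/= => -[/andP[ay yb] /andP[Ny yN]].
  move: ab; rewrite ltNge => /negP; apply; apply: (@le_trans _ _ y).
    by rewrite ge_max !ltW.
  by rewrite le_min yb.
- move=> S mS PS; rewrite /P (_ : \1_(~` S `&` J) = fun x => (- 1) * \1_(S `&` J) x + \1_J x).
    exact: approximable_lin.
  apply/funext => x; rewrite !indicE !in_setI in_setC.
  by case: (x \in S); case: (x \in J) => /=; rewrite ?mulr0 ?mulr1 ?addr0 ?add0r ?addNr.
- move=> F mF tF PF; rewrite /P.
  apply: (@approximable_dominated (fun n x => \sum_(i < n) 1 * \1_(F i `&` J) x) _ (\1_J)).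
  + exact: measurable_ind.
  + exact: N12_ind.
  + by move=> n; apply: approximable_sum => i; exact: PF.
  + move=> n x; rewrite sum_indic_trivIset// indicE ger0_norm// ler_nat.
    by rewrite in_setI; case: (x \in J); rewrite ?andbT ?andbF// leq_b1.
  + move=> x; apply/cvgrPdist_le => e e0.
    have [[k _ Fkx]|nF] := pselect ((\bigcup_k F k) x).
      exists k.+1 => // n /= kn; rewrite sum_indic_trivIset// indicE !in_setI.
      have -> : x \in \bigcup_k F k by rewrite inE; exists k.
      have -> : x \in \big[setU/set0]_(i < n) F i.
        by rewrite inE -bigcup_mkord; exists k.
      by rewrite subrr normr0 ltW.
    exists 0%N => // n _; rewrite sum_indic_trivIset// indicE !in_setI.
    have nFn : ~ (\big[setU/set0]_(i < n) F i) x.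
      by rewrite -bigcup_mkord => -[k _ Fkx]; apply: nF; exists k.
    by rewrite (memNset nF) (memNset nFn) subrr normr0 ltW.
Qed.

Import HBNNSimple.

(** After a splitting into positive and negative parts, the simple functions increasing to u, cut to
    ]-n, n], are combinations of indicators of bounded sets, and u itself dominates them. *)
Lemma density u : measurable_fun setT u -> (N12 u < +oo)%E -> approximable u.
Proof.
wlog u0 : u / forall x, 0 <= u x.
  move=> h mu0 iu.
  have mp : measurable_fun setT u^\+ by exact: measurable_funrpos.
  have mn : measurable_fun setT u^\- by exact: measurable_funrneg.
  rewrite (_ : u = fun x => (- 1) * u^\- x + u^\+ x); last first.
    apply/funext => x; rewrite /funrpos /funrneg mulN1r; case: (lerP 0 (u x)) => ux.
      by rewrite max_r ?oppr_le0// oppr0 add0r.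
    by rewrite max_l ?addr0 ?opprK// oppr_ge0 ltW.
  have nu x : `|u x| = u^\+ x + u^\- x.
    rewrite /funrpos /funrneg; case: (lerP 0 (u x)) => ux.
      by rewrite ger0_norm// max_r ?oppr_le0// addr0.
    by rewrite ltr0_norm// max_l ?add0r// oppr_ge0 ltW.
  have [p0 n0] : (forall x, 0 <= u^\+ x) /\ (forall x, 0 <= u^\- x).
    by split=> x; [exact: funrpos_ge0|exact: funrneg_ge0].
  apply: approximable_lin; apply: h => //; apply: le_lt_trans iu; apply: N12_le => // x;
    by rewrite nu ger0_norm// ?lerDl ?lerDr.
move=> mu0 iu.
pose J n := `]- n%:R, n%:R]%classic : set R.
have mE : measurable_fun setT (EFin \o u) by exact/measurable_EFinP.
pose g n := nnsfun_approx measurableT mE n.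
apply: (@approximable_dominated (fun n (x : R) => g n x * \1_(J n) x) u u) => //.
- move=> n; rewrite (_ : (fun _ => _) = fun x : R =>
      \sum_(r <- finmap.enum_fset (fset_set (range (g n)))) r * \1_((g n @^-1` [set r]) `&` J n) x).
    by apply: approximable_sum => r; exact: approximable_indic.
  apply/funext => x; rewrite fimfunE fsbig_finite//= mulr_suml; apply: eq_bigr => r _.
  by rewrite !indicE in_setI -mulrA -natrM mulnb.
- move=> n x; rewrite ger0_norm; last by rewrite mulr_ge0// indicE.
  rewrite /g nnsfun_approxE.
  apply: (@le_trans _ _ (approx setT (EFin \o u) n x)).
    rewrite indicE ler_piMr//; last by case: (x \in _).
    by rewrite -(nnsfun_approxE measurableT mE n).
  by rewrite -lee_fin; apply: le_approx => // y _; rewrite lee_fin.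
- move=> x.
  have gu : g n x @[n --> \oo] --> u x.
    apply: (fine_cvg (f := fun n => (g n x)%:E)).
    by apply: cvg_nnsfun_approx => // y _; rewrite lee_fin.
  apply: cvg_trans gu; apply: near_eq_cvg; near=> n.
  rewrite indicE mem_set ?mulr1// /J /= in_itv/=.
  have : `|x| < n%:R by near: n; exact: nbhs_infty_gtr.
  by rewrite ltr_norml => /andP[-> /ltW].
Unshelve. all: by end_near. Qed.

(** * Two-sided bounds between the energy and the squared norm *)

Lemma sqint_ge0 u : (0 <= sqint u)%E.
Proof. by apply: integral_ge0 => x _; rewrite lee_fin sqr_ge0. Qed.

Lemma sqint_le_N12 u : measurable_fun setT u -> (sqint u <= N12 u)%E.
Proof.
move=> mu0; apply: int_le; [exact: measurable_N12| |exact: measurable_funX].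
by move=> x; rewrite sqr_ge0/= lerDr.
Qed.

Lemma sqint_lin c u v : measurable_fun setT u -> measurable_fun setT v ->
  (sqint (fun x => (c * u x + v x)%R) <=
   (2 * c ^+ 2)%:E * sqint u + 2%:E * sqint v)%E.
Proof.
move=> mu0 mv.
have mNu : measurable_fun setT (fun x => u x ^+ 2) by exact: measurable_funX.
have mNv : measurable_fun setT (fun x => v x ^+ 2) by exact: measurable_funX.
have c0 : 0 <= 2 * c ^+ 2 by rewrite mulr_ge0// sqr_ge0.
rewrite /sqint -!ge0_integralZl_EFin//; try by move=> x _; rewrite lee_fin sqr_ge0.
all: try exact/measurable_EFinP.
rewrite -ge0_integralD//; last first.
- by apply/measurable_EFinP; apply: measurable_funM.
- by move=> x _; rewrite -EFinM lee_fin mulr_ge0// sqr_ge0.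
- by apply/measurable_EFinP; apply: measurable_funM.
- by move=> x _; rewrite -EFinM lee_fin mulr_ge0// sqr_ge0.
rewrite [leRHS](_ : _ = \int[mu]_x (2 * c ^+ 2 * u x ^+ 2 + 2 * v x ^+ 2)%:E)%E; last by [].
apply: int_le.
- by apply: measurable_funD; apply: measurable_funM.
- by move=> x; rewrite sqr_ge0/=; have := sqr_ge0 (c * u x - v x); nra.
- by apply: measurable_funX; apply: measurable_funD => //; apply: measurable_funM.
Qed.

Lemma N12_intR u : measurable_fun setT u -> (N12 u < +oo)%E -> intR u.
Proof.
move=> mu0 iu; apply/intRP; split => //; apply: le_lt_trans iu.
apply: int_le; [exact: measurable_N12| |exact: measurableT_comp].
by move=> x; rewrite normr_ge0/= lerDl sqr_ge0.
Qed.

Lemma trig_transform_dist h u v xi : osc h -> measurable_fun setT u ->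
  measurable_fun setT v -> intR u -> intR v ->
  (`|trig_transform h u xi - trig_transform h v xi|%:E <=
    N12 (fun x => (u x - v x)%R))%E.
Proof.
move=> oh mu0 mv iu iv.
have -> : trig_transform h u xi - trig_transform h v xi =
    trig_transform h (fun x => u x - v x) xi.
  rewrite (_ : (fun _ => _) = fun x => (- 1) * v x + u x); last first.
    by apply/funext => x; ring.
  by rewrite trig_transform_lin//; ring.
apply: le_trans; first by apply: trig_transform_bound => //; exact: intRB.
have md : measurable_fun setT (fun x => u x - v x) by exact: measurable_funB.
apply: int_le; [exact: measurable_N12| |exact: measurableT_comp].
by move=> x; rewrite normr_ge0/= lerDl sqr_ge0.
Qed.

(** Two accuracies are requested through their minimum: [d] for every n, to be used in norm
    estimates, and 1 / (n + 1), which makes the transforms converge at each frequency. *)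
Lemma density_seq u (d : R) : measurable_fun setT u -> (N12 u < +oo)%E -> 0 < d ->
  exists s_ : nat -> R -> R, [/\ forall n, step (s_ n),
    forall n, (N12 (fun x => (u x - s_ n x)%R) <= d%:E)%E &
    forall h xi, osc h ->
      trig_transform h (s_ n) xi @[n --> \oo] --> trig_transform h u xi].
Proof.
move=> mu0 iu d0; have [_ au] := density mu0 iu.
have /choice[s_ sP] : forall n, exists s, step s /\
    (N12 (fun x => (u x - s x)%R) <= (Num.min d (n.+1%:R^-1))%:E)%E.
  move=> n; have [|s ss us] := au (Num.min d (n.+1%:R^-1)).
    by rewrite lt_min d0 invr_gt0 ltr0n.
  by exists s.
exists s_; split=> [n|n|h xi oh]; [by case: (sP n)| |].
  by case: (sP n) => _ /le_trans; apply; rewrite lee_fin ge_min lexx.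
apply/cvgrPdist_le => e e0.
near=> n; have [ss us] := sP n.
rewrite -lee_fin; apply: le_trans.
  apply: trig_transform_dist => //; [exact: step_measurable|exact: N12_intR|exact: step_intR].
apply: le_trans us _; rewrite lee_fin ge_min; apply/orP; right.
apply/ltW; near: n; exact: (near_infty_natSinv_lt (PosNum e0)).
Unshelve. all: by end_near. Qed.

Lemma measurable_trig_transform h H u : osc h -> continuous H ->
  (forall x : R, is_derive x 1 H (h x)) ->
  measurable_fun setT u -> (N12 u < +oo)%E ->
  measurable_fun setT (trig_transform h u).
Proof.
move=> oh cH dH mu0 iu; have [s_ [ss _ sc]] := density_seq mu0 iu ltr01.
apply: (measurable_fun_cvg (h := fun n => trig_transform h (s_ n))).
  by move=> n; exact: measurable_step_transform dH cH (ss n).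
by move=> xi _; exact: sc.
Qed.

Lemma measurable_cos_transform u : measurable_fun setT u -> (N12 u < +oo)%E ->
  measurable_fun setT (trig_transform cos u).
Proof.
apply: (@measurable_trig_transform cos sin); first exact: osc_cos.
exact: continuous_sin.
Qed.

Lemma measurable_sin_transform u : measurable_fun setT u -> (N12 u < +oo)%E ->
  measurable_fun setT (trig_transform sin u).
Proof.
apply: (@measurable_trig_transform sin (fun x => - cos x)); first exact: osc_sin.
  by move=> x; apply: cvgN; exact: continuous_cos.
move=> x; have := @is_deriveN _ _ _ cos x 1 _ (is_derive_cos x).
by rewrite opprK; apply.
Qed.

Lemma measurable_ppair u : measurable_fun setT u -> (N12 u < +oo)%E ->
  measurable_fun setT (ppair u u).
Proof.
move=> mu0 iu; have mc := measurable_cos_transform mu0 iu.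
have ms := measurable_sin_transform mu0 iu.
by apply: measurable_funD; apply: measurable_funM.
Qed.

Lemma energy_ge0 u : (0 <= energy u)%E.
Proof. by apply: integral_ge0 => x _; rewrite lee_fin ppair_ge0. Qed.

Lemma N12_step s : step s -> (N12 s < +oo)%E.
Proof.
elim=> [|c a b {}s ab ss IH].
  by rewrite /N12 integral0_eq// => x _; rewrite normr0 expr0n addr0.
have ms := step_measurable ss.
apply: le_lt_trans; first by apply: N12_lin => //; exact: measurable_ind.
rewrite lte_add_pinfty// lte_mul_pinfty//; last exact: N12_ind.
by rewrite lee_fin mulr_ge0// addr_ge0// sqr_ge0.
Qed.

Lemma energy_lin c u v : measurable_fun setT u -> (N12 u < +oo)%E ->
  measurable_fun setT v -> (N12 v < +oo)%E ->
  (energy (fun x => (c * u x + v x)%R) <=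
   (2 * c ^+ 2)%:E * energy u + 2%:E * energy v)%E.
Proof.
move=> mu0 iu mv iv.
have mw : measurable_fun setT (fun x => c * u x + v x).
  by apply: measurable_funD => //; apply: measurable_funM.
have iw : (N12 (fun x => (c * u x + v x)%R) < +oo)%E.
  apply: le_lt_trans; first exact: N12_lin.
  rewrite lte_add_pinfty// lte_mul_pinfty//.
  by rewrite lee_fin mulr_ge0// addr_ge0// sqr_ge0.
have mNu := measurable_ppair mu0 iu; have mNv := measurable_ppair mv iv.
have mNw := measurable_ppair mw iw.
have c0 : 0 <= 2 * c ^+ 2 by rewrite mulr_ge0// sqr_ge0.
rewrite /energy -!ge0_integralZl_EFin//; try by move=> x _; rewrite lee_fin ppair_ge0.
all: try exact/measurable_EFinP.
rewrite -ge0_integralD//; last first.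
- by apply/measurable_EFinP; apply: measurable_funM.
- by move=> x _; rewrite -EFinM lee_fin mulr_ge0// ppair_ge0.
- by apply/measurable_EFinP; apply: measurable_funM.
- by move=> x _; rewrite -EFinM lee_fin mulr_ge0// ppair_ge0.
rewrite [leRHS](_ : _ = \int[mu]_x (2 * c ^+ 2 * ppair u u x + 2 * ppair v v x)%:E)%E; last by [].
apply: int_le => //.
  by apply: measurable_funD; apply: measurable_funM.
move=> x; rewrite ppair_ge0/= /ppair.
rewrite !trig_transform_lin//; try exact: N12_intR; try exact: osc_cos; try exact: osc_sin.
set p := trig_transform cos u x; set q := trig_transform cos v x.
set r := trig_transform sin u x; set t := trig_transform sin v x.
by have := sqr_ge0 (c * p - q); have := sqr_ge0 (c * r - t); nra.
Qed.

(** Fatou's lemma along steps whose transforms converge pointwise, the energy of a step being known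
    exactly. The constant 2 [kappa] doubles when [sqint (s_ n)] is compared with [sqint u] through
    the difference. *)
Lemma energy_le u : measurable_fun setT u -> (N12 u < +oo)%E ->
  (energy u <= (4 * kappa)%:E * sqint u)%E.
Proof.
move=> mu0 iu; apply/lee_addgt0Pr => e e0.
have k0 := kappa_gt0.
(* An approximation error d enters as 2 [kappa] times 2 d, which this choice makes equal to [e]. *)
have d0 : 0 < e / (4 * kappa) by rewrite divr_gt0// mulr_gt0.
have [s_ [ss us sc]] := density_seq mu0 iu d0.
apply: (int_fatou (u_ := fun n => ppair (s_ n) (s_ n))).
- by move=> n; apply: measurable_ppair; [exact: step_measurable|exact: N12_step].
- exact: measurable_ppair.
- by move=> n x; exact: ppair_ge0.
- by move=> x; exact: ppair_ge0.
- apply: aeW => x; apply: cvgD; apply: cvgM; apply: sc;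
  by [exact: osc_cos|exact: osc_sin].
apply: nearW => n; rewrite -/(energy _) (step_energy (ss n)).1.
have ms := step_measurable (ss n).
have mus : measurable_fun setT (fun x => u x - s_ n x) by exact: measurable_funB.
have h : (sqint (s_ n) <= 2%:E * sqint u + 2%:E * (e / (4 * kappa))%:E)%E.
  rewrite [X in sqint X](_ : _ = fun x => (- 1) * (u x - s_ n x) + u x); last first.
    by apply/funext => x; ring.
  apply: le_trans; first exact: sqint_lin.
  rewrite addeC sqrrN expr1n mulr1; apply: leeD => //.
  rewrite lee_wpmul2l//; apply: le_trans (us n); exact: sqint_le_N12.
apply: (@le_trans _ _ ((2 * kappa)%:E * (2%:E * sqint u + 2%:E * (e / (4 * kappa))%:E))%E).
  by rewrite lee_wpmul2l// lee_fin mulr_ge0// ltW.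
rewrite ge0_muleDr; [|by rewrite mule_ge0// sqint_ge0|by rewrite mule_ge0// lee_fin ltW].
rewrite muleA -!EFinM; apply: leeD.
  by rewrite (_ : 2 * kappa * 2 = 4 * kappa)//; ring.
by rewrite lee_fin le_eqVlt; apply/orP; left; apply/eqP; field; rewrite gt_eqF.
Qed.

(** Fatou's lemma points the wrong way here. Instead u is compared with one close step s, where the
    identity is exact, and the energy of s is compared back with that of u, [energy_le] controlling
    the energy of u - s. *)
Lemma sqint_le u : measurable_fun setT u -> (N12 u < +oo)%E ->
  (sqint u <= (2 / kappa)%:E * energy u)%E.
Proof.
move=> mu0 iu; apply/lee_addgt0Pr => e e0.
have k0 := kappa_gt0.
(* An error d counts 2 d in splitting u, and (1 / [kappa]) times 2 times 4 [kappa] d = 8 d through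
   the energy of u - s. *)
have d0 : 0 < e / 10 by rewrite divr_gt0.
have [_ /(_ _ d0)[s ss us]] := density mu0 iu.
have ms := step_measurable ss; have is_ := N12_step ss.
have mus : measurable_fun setT (fun x => u x - s x) by exact: measurable_funB.
have ius : (N12 (fun x => (u x - s x)%R) < +oo)%E by apply: le_lt_trans us _; rewrite ltry.
have us2 : (sqint (fun x => (u x - s x)%R) <= (e / 10)%:E)%E.
  by apply: le_trans us; exact: sqint_le_N12.
have h1 : (sqint u <= 2%:E * sqint (fun x => (u x - s x)%R) + 2%:E * sqint s)%E.
  rewrite [X in (sqint X <= _)%E](_ : _ = fun x => 1 * (u x - s x) + s x); last first.
    by apply/funext => x; ring.
  by apply: le_trans; [exact: sqint_lin|rewrite expr1n mulr1].
have h2 : (energy s <= 2%:E * energy (fun x => (u x - s x)%R) + 2%:E * energy u)%E.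
  rewrite [X in (energy X <= _)%E](_ : _ = fun x => (- 1) * (u x - s x) + u x); last first.
    by apply/funext => x; ring.
  by apply: le_trans; [exact: energy_lin|rewrite sqrrN expr1n mulr1].
have h3 := energy_le mus ius.
have [h4 sfin] := step_energy ss.
have [->|Eu] := eqVneq (energy u) +oo%E.
  by rewrite gt0_muley ?lte_fin ?divr_gt0// addye// leey.
have {}Eu : energy u \is a fin_num by rewrite ge0_fin_numE ?energy_ge0// lt_neqAle Eu leey.
have fus : sqint (fun x => (u x - s x)%R) \is a fin_num.
  by rewrite ge0_fin_numE ?sqint_ge0//; apply: le_lt_trans us2 _; rewrite ltry.
have fs : sqint s \is a fin_num by rewrite ge0_fin_numE ?sqint_ge0.
have feus : energy (fun x => (u x - s x)%R) \is a fin_num.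
  by rewrite ge0_fin_numE ?energy_ge0//; apply: le_lt_trans h3 _; rewrite -(fineK fus) -EFinM ltry.
rewrite h4 in h2.
apply: le_trans h1 _; move: us2 h2 h3 fus fs feus Eu => {h4 sfin ius is_ us mus ms mu0 iu}.
move: (sqint s) (energy u) (sqint _) (energy _).
move=> [a| |]// [b| |]// [c| |]// [d| |]//; rewrite -!(EFinM, EFinD) !lee_fin.
move=> hc ha hd _ _ _ _.
have h1 : 2 * a <= (2 * d + 2 * b) / kappa by rewrite ler_pdivlMr//; lra.
have h2 : d / kappa <= 4 * c by rewrite ler_pdivrMr//; lra.
have -> : 2 / kappa * b = 2 * b / kappa by rewrite mulrAC.
lra.
Qed.

(** * Completeness of L^2 *)

(** By |v| <= 2^-j + 2^j v^2 the weighted squares control the absolute increments, whose sum is then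
    at most 2 + M. *)
Lemma cvg_telescope (c : nat -> R) (M : R) :
  (forall n, \sum_(j < n) 2 ^+ j * (c j.+1 - c j) ^+ 2 <= M) -> cvgn c.
Proof.
move=> cM; pose v j := c j.+1 - c j.
have geo n : \sum_(j < n) (2 ^+ j)^-1 = 2 - 2 * (2 ^+ n)^-1 :> R.
  elim: n => [|n IH]; first by rewrite big_ord0 expr0; field.
  by rewrite big_ord_recr/= IH exprS invfM; field; rewrite expf_neq0.
have nv : cvgn [normed series v].
  apply: nondecreasing_is_cvgn.
    by apply: nondecreasing_series => k _ _ /=; exact: normr_ge0.
  exists (2 + M) => _ [n _ <-]; rewrite /normed_series_of seriesEord/=.
  apply: (@le_trans _ _ (\sum_(j < n) ((2 ^+ j)^-1 + 2 ^+ j * v j ^+ 2))).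
    apply: ler_sum => j _; have a0 : 0 < (2 : R) ^+ j by rewrite exprn_gt0.
    rewrite -[v j ^+ 2]real_normK ?num_real//; set y := `|v j|.
    have y0 : 0 <= y by exact: normr_ge0.
    rewrite -(ler_pM2l a0) mulrDr mulfV ?gt_eqF// mulrA -expr2.
    by have := sqr_ge0 (2 ^+ j * y - 1); nra.
  rewrite big_split/= geo; apply: lerD; last exact: cM.
  by rewrite gerBl mulr_ge0// invr_ge0 exprn_ge0.
have := normed_cvg nv.
have -> : series v = (fun n => c n - c 0%N).
  by apply/funext => n; rewrite /series/= telescope_sumr.
move=> vc; rewrite (_ : c = (fun n => (c n - c 0%N) + c 0%N)); last first.
  by apply/funext => n; rewrite subrK.
by apply: is_cvgD => //; exact: is_cvg_cst.
Qed.

(** The Riesz-Fischer argument for squared norms: along a fast subsequence the weighted squared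
    increments have an almost everywhere finite sum, so [cvg_telescope] applies pointwise; Fatou's
    lemma then compares the limit with the whole sequence. *)
Lemma sqint_complete (h : nat -> R -> R) :
  (forall n, measurable_fun setT (h n)) ->
  (forall e : R, 0 < e -> exists N, forall m n, (N <= m)%N -> (N <= n)%N ->
     (sqint (fun x => (h m x - h n x)%R) <= e%:E)%E) ->
  exists2 g : R -> R, measurable_fun setT g &
    forall e : R, 0 < e -> exists N, forall n, (N <= n)%N ->
     (sqint (fun x => (g x - h n x)%R) <= e%:E)%E.
Proof.
(* Weighted by 2^j, these tolerances become 2^-(j+1), whose sum is 1. *)
move=> mh ch; pose e_ (j : nat) : R := (2 ^+ j * 2 ^+ j.+1)^-1.
have e_0 j : 0 < e_ j by rewrite invr_gt0 mulr_gt0// exprn_gt0.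
have /choice[K KP] := fun j => ch (e_ j) (e_0 j).
(* Summing the ranks makes [k] monotone and at least [K]; the successor in each term makes it tend
   to infinity. *)
pose k j := (\sum_(i < j.+1) (K i).+1)%N.
have kK j : (K j <= k j)%N by rewrite /k big_ord_recr/= (leq_trans (leqnSn _))// leq_addl.
have kj j : (j <= k j)%N.
  elim: j => // j IH; by rewrite /k big_ord_recr/= -/(k j) addnS ltnS (leq_trans IH)// leq_addr.
have kS j : (k j <= k j.+1)%N by rewrite /k [leqRHS]big_ord_recr/= leq_addr.
pose w j x := 2 ^+ j * (h (k j.+1) x - h (k j) x) ^+ 2.
have w0 j x : 0 <= w j x by apply: mulr_ge0; [exact: exprn_ge0|exact: sqr_ge0].
have md j : measurable_fun setT (fun x => (h (k j.+1) x - h (k j) x) ^+ 2).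
  by apply: measurable_funX; exact: measurable_funB.
have mw j : measurable_fun setT (w j) by exact: measurable_funM.
have mEw j : measurable_fun setT (fun x => (w j x)%:E) by exact/measurable_EFinP.
have iw j : (\int[mu]_x (w j x)%:E <= (1 / (2 ^ j.+1)%:R)%:E)%E.
  under eq_integral do rewrite EFinM.
  rewrite ge0_integralZl_EFin//.
  2: by move=> x _; rewrite lee_fin sqr_ge0.
  2: by have /measurable_EFinP := md j.
  apply: (@le_trans _ _ ((2 ^+ j)%:E * (e_ j)%:E)%E).
    by rewrite lee_wpmul2l ?lee_fin ?exprn_ge0//; apply: KP; rewrite ?(leq_trans (kK j)).
  rewrite -EFinM lee_fin /e_ invfM mulrA mulfV ?expf_neq0// !mul1r natrX.
  by [].
pose G x := (\sum_(0 <= j <oo) (w j x)%:E)%E.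
have iG : mu.-integrable setT G.
  apply/integrableP; split.
    apply: (@ge0_emeasurable_sum _ (measurableTypeR R) R setT (fun j x => (w j x)%:E)).
      by move=> j x _ _; rewrite lee_fin.
    by move=> j _; exact: mEw.
  rewrite (_ : integral _ _ _ = \int[mu]_x G x)%E; last first.
    by apply: eq_integral => x _; rewrite gee0_abs// nneseries_ge0// => *; rewrite lee_fin.
  rewrite (@integral_nneseries _ (measurableTypeR R) R mu setT measurableT
    (fun j x => (w j x)%:E))//; last by move=> j x _; rewrite lee_fin.
  apply: (@le_lt_trans _ _ 1%:E); last by rewrite ltry.
  apply: le_trans (epsilon_trick0 xpredT ler01).
  by apply: lee_nneseries => // j *; apply: integral_ge0 => x _; rewrite lee_fin.
have [N [mN N0 NG]] := integrable_ae measurableT iG.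
have cN x : ~ N x -> cvgn (fun j => h (k j) x).
  move=> Nx; have fG : G x \is a fin_num.
    by apply: contrapT => nf; apply: Nx; apply: NG => /= /(_ I).
  apply: (@cvg_telescope _ (fine (G x))) => n.
  rewrite -lee_fin fineK// -sumEFin.
  have := @nneseries_lim_ge _ (fun j => (w j x)%:E) xpredT 0 n.
  by rewrite big_mkord; apply => j _; rewrite lee_fin.
(* Setting the sequence to 0 on the exceptional null set makes it converge at every point, so the
   limit is measurable. *)
pose g_ j x := h (k j) x * \1_(~` N) x.
pose g x := limn (fun j => g_ j x).
have cg x : g_ j x @[j --> \oo] --> g x.
  suff : cvgn (fun j => g_ j x) by [].
  rewrite /g_; have [Nx|Nx] := pselect (N x).
    rewrite indicE memNset//=.
    by under eq_fun do rewrite mulr0; exact: is_cvg_cst.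
  rewrite indicE mem_set//=; under eq_fun do rewrite mulr1; exact: cN.
have mg_ j : measurable_fun setT (g_ j).
  by apply: measurable_funM => //; apply: measurable_indic; exact: measurableC.
have mg : measurable_fun setT g.
  by apply: (measurable_fun_cvg mg_) => x _; exact: cg.
exists g => // e e0; have [N1 N1P] := ch e e0.
exists N1 => n N1n; apply: (int_fatou (u_ := fun j x => (h (k j) x - h n x) ^+ 2)).
- by move=> j; apply: measurable_funX; exact: measurable_funB.
- by apply: measurable_funX; exact: measurable_funB.
- by move=> *; exact: sqr_ge0.
- by move=> *; exact: sqr_ge0.
- exists N; split => // x /= nx; apply: contrapT => Nx; apply: nx.
  have hx : h (k j) x @[j --> \oo] --> g x.
    have := cg x; rewrite /g_ indicE mem_set//=.
    by under eq_fun do rewrite mulr1.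
  by apply: cvgM; (apply: cvgB; [exact: hx|exact: cvg_cst]).
- near=> j; apply: N1P => //.
  by apply: leq_trans (kj j); near: j; exact: nbhs_infty_ge.
Unshelve. all: by end_near. Qed.
End RealIntegrals.

(** * The Fourier transformation on L^2 *)

Section ComplexL2.
Variable R : realType.
Local Notation mu := (@lebesgue_measure R).
Implicit Types (f g : R -> R[i]).

Local Notation Re := (@complex.Re R).
Local Notation Im := (@complex.Im R).

(** The squared modulus, kept polynomial so that inequalities between moduli are polynomial ones. *)
Definition sqc (z : R[i]) : R := Re z ^+ 2 + Im z ^+ 2.

Lemma sqc_ge0 z : 0 <= sqc z.
Proof. by rewrite addr_ge0// sqr_ge0. Qed.

Lemma sqc0 : sqc 0 = 0.
Proof. by rewrite /sqc/= expr0n addr0. Qed.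

Lemma sqcD z w : sqc (z + w) <= 2 * sqc z + 2 * sqc w.
Proof.
case: z w => [a b] [c d]; rewrite /sqc /=.
by have := sqr_ge0 (a - c); have := sqr_ge0 (b - d); nra.
Qed.

Lemma sqcM z w : sqc (z * w) = sqc z * sqc w.
Proof. by case: z w => [a b] [c d]; rewrite /sqc/=; ring. Qed.

Lemma sqcN z : sqc (- z) = sqc z.
Proof. by case: z => [a b]; rewrite /sqc/= !sqrrN. Qed.

Lemma sqc_eq0 z : sqc z = 0 -> z = 0.
Proof.
case: z => [a b]; rewrite /sqc/= => /eqP.
by rewrite paddr_eq0 ?sqr_ge0// !sqrf_eq0 => /andP[/eqP-> /eqP->].
Qed.

Lemma normc_sqc z : Normc.normc z ^+ 2 = sqc z.
Proof. by case: z => [a b] /=; rewrite sqr_sqrtr// addr_ge0// sqr_ge0. Qed.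

Lemma normc_ge0 (z : R[i]) : 0 <= Normc.normc z.
Proof. by case: z => [a b]; rewrite sqrtr_ge0. Qed.

Local Notation cmeas f := (cmeasurable_fun setT f).

Lemma cmeasD f g : cmeas f -> cmeas g -> cmeas (fun x => f x + g x).
Proof.
move=> [f1 f2] [g1 g2]; split.
  rewrite (_ : (fun _ => _) = (fun x => Re (f x) + Re (g x))).
    exact: measurable_funD.
  by apply/funext => x; case: (f x) (g x) => [? ?] [? ?].
rewrite (_ : (fun _ => _) = (fun x => Im (f x) + Im (g x))).
  exact: measurable_funD.
by apply/funext => x; case: (f x) (g x) => [? ?] [? ?].
Qed.

Lemma cmeasM f g : cmeas f -> cmeas g -> cmeas (fun x => f x * g x).
Proof.
move=> [f1 f2] [g1 g2]; split.
  rewrite (_ : (fun _ => _) = (fun x => Re (f x) * Re (g x) - Im (f x) * Im (g x))).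
    by apply: measurable_funB; apply: measurable_funM.
  by apply/funext => x; case: (f x) (g x) => [? ?] [? ?].
rewrite (_ : (fun _ => _) = (fun x => Re (f x) * Im (g x) + Im (f x) * Re (g x))).
  by apply: measurable_funD; apply: measurable_funM.
by apply/funext => x; case: (f x) (g x) => [? ?] [? ?].
Qed.

Lemma cmeas_cst (a : R[i]) : cmeas (fun=> a).
Proof. by split; exact: measurable_cst. Qed.

Lemma cmeasZ (a : R[i]) f : cmeas f -> cmeas (fun x => a * f x).
Proof. by apply: cmeasM; exact: cmeas_cst. Qed.

Lemma cmeasN f : cmeas f -> cmeas (fun x => - f x).
Proof.
by move=> mf; under eq_fun do rewrite -mulN1r; exact: cmeasZ.
Qed.

Lemma cmeasB f g : cmeas f -> cmeas g -> cmeas (fun x => f x - g x).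
Proof. by move=> mf /cmeasN; exact: cmeasD. Qed.

Lemma cmeas_comp f (h : R -> R) : measurable_fun setT h -> cmeas f ->
  cmeas (fun x => f (h x)).
Proof.
move=> mh [f1 f2]; split.
  exact: (measurableT_comp (f := fun x => Re (f x))).
exact: (measurableT_comp (f := fun x => Im (f x))).
Qed.

Definition sqn f : \bar R := (\int[mu]_x (sqc (f x))%:E)%E.

Lemma measurable_sqc f : cmeas f -> measurable_fun setT (fun x => sqc (f x)).
Proof. by move=> [f1 f2]; apply: measurable_funD; apply: measurable_funX. Qed.

Lemma sqn_ge0 f : (0 <= sqn f)%E.
Proof. by apply: integral_ge0 => x _; rewrite lee_fin sqc_ge0. Qed.

Lemma sqn_le f g (k : R) : 0 <= k -> cmeas f -> cmeas g ->
  {ae mu, forall x, sqc (f x) <= k * sqc (g x)} -> (sqn f <= k%:E * sqn g)%E.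
Proof.
move=> k0 mf mg fg; rewrite /sqn -ge0_integralZl_EFin//.
- apply: ae_ge0_le_integral => //.
  + by move=> x _; rewrite lee_fin sqc_ge0.
  + by apply/measurable_EFinP; exact: measurable_sqc.
  + by move=> x _; rewrite -EFinM lee_fin mulr_ge0// sqc_ge0.
  + by apply/measurable_EFinP; apply: measurable_funM => //; exact: measurable_sqc.
  + by apply: filterS fg => x h _; rewrite -EFinM lee_fin.
- by move=> x _; rewrite lee_fin sqc_ge0.
- by apply/measurable_EFinP; exact: measurable_sqc.
Qed.

Lemma sqnD f g : cmeas f -> cmeas g ->
  (sqn (fun x => (f x + g x)%R) <= 2%:E * sqn f + 2%:E * sqn g)%E.
Proof.
move=> mf mg.
have m1 := measurable_sqc mf; have m2 := measurable_sqc mg.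
rewrite /sqn -!ge0_integralZl_EFin//; try by move=> x _; rewrite lee_fin sqc_ge0.
all: try exact/measurable_EFinP.
rewrite -ge0_integralD//; last first.
- by apply/measurable_EFinP; apply: measurable_funM.
- by move=> x _; rewrite -EFinM lee_fin mulr_ge0// sqc_ge0.
- by apply/measurable_EFinP; apply: measurable_funM.
- by move=> x _; rewrite -EFinM lee_fin mulr_ge0// sqc_ge0.
rewrite [leRHS](_ : _ = \int[mu]_x (2 * sqc (f x) + 2 * sqc (g x))%:E)%E; last by [].
apply: int_le.
- by apply: measurable_funD; apply: measurable_funM.
- by move=> x; rewrite sqc_ge0/= sqcD.
- by apply: measurable_sqc; exact: cmeasD.
Qed.

Lemma sqnZ (a : R[i]) f : cmeas f -> sqn (fun x => a * f x) = ((sqc a)%:E * sqn f)%E.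
Proof.
move=> mf; rewrite /sqn -ge0_integralZl_EFin//.
- by apply: eq_integral => x _; rewrite sqcM EFinM.
- by move=> x _; rewrite lee_fin sqc_ge0.
- by apply/measurable_EFinP; exact: measurable_sqc.
- exact: sqc_ge0.
Qed.

Lemma sqnN f : sqn (fun x => - f x) = sqn f.
Proof. by apply: eq_integral => x _; rewrite sqcN. Qed.

Lemma sqn_eq0 f : cmeas f -> sqn f = 0%E -> eq_ae setT f (fun=> 0).
Proof.
move=> mf sf; have : (\int[mu]_x `|(sqc (f x))%:E| = 0)%E.
  by rewrite -[RHS]sf; apply: eq_integral => x _; rewrite gee0_abs// lee_fin sqc_ge0.
have m1 : measurable_fun setT (fun x => (sqc (f x))%:E).
  by apply/measurable_EFinP; exact: measurable_sqc.
move/(ae_eq_integral_abs mu measurableT m1); apply: filterS => x + _.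
by move=> /(_ I)[] /sqc_eq0.
Qed.

Lemma eq_ae_sqn f g : cmeas f -> cmeas g -> eq_ae setT f g -> sqn f = sqn g.
Proof.
move=> mf mg fg; apply: ae_eq_integral => //.
- by apply/measurable_EFinP; exact: measurable_sqc.
- by apply/measurable_EFinP; exact: measurable_sqc.
- by apply: filterS fg => x + _ => /(_ I) ->.
Qed.

Lemma sqn_sqint f : cmeas f ->
  sqn f = (sqint (fun x => Re (f x)) + sqint (fun x => Im (f x)))%E.
Proof.
move=> [f1 f2]; rewrite /sqint -ge0_integralD//.
- by move=> x _; rewrite lee_fin sqr_ge0.
- by apply/measurable_EFinP; exact: measurable_funX.
- by move=> x _; rewrite lee_fin sqr_ge0.
- by apply/measurable_EFinP; exact: measurable_funX.
Qed.

Lemma extend0T f : extend0 setT f = f.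
Proof. by apply/funext => x; rewrite /extend0 patchT// inE. Qed.

Lemma cLnorm2E f : cLnorm setT 2%:E f = (sqn f `^ (2^-1))%E.
Proof.
rewrite /cLnorm extend0T unlock; congr (_ `^ _)%E; apply: eq_integral => x _.
by rewrite -normc_sqc /= -powR_mulrn ?normc_ge0// ger0_norm ?normc_ge0.
Qed.

Lemma L2P f : Lp setT 2%:E f <-> cmeas f /\ (sqn f < +oo)%E.
Proof.
rewrite /Lp /= cLnorm2E; split=> -[mf h]; split => //.
  by apply: lty_poweRy h; rewrite invr_neq0.
by rewrite poweR_lty.
Qed.

Lemma cLnorm2_le (K : R) f g : 0 <= K -> (sqn f <= K%:E * sqn g)%E ->
  (cLnorm setT 2%:E f <= (Num.sqrt K)%:E * cLnorm setT 2%:E g)%E.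
Proof.
move=> K0 fg; rewrite !cLnorm2E.
apply: (@le_trans _ _ ((K%:E * sqn g) `^ 2^-1)%E).
  apply: gt0_ler_poweR => //; rewrite in_itv/= ?leey ?andbT ?sqn_ge0//.
  by rewrite mule_ge0// sqn_ge0.
by rewrite poweRM ?sqn_ge0// -[(K%:E `^ _)%E]/((K `^ 2^-1)%:E) powR12_sqrt.
Qed.

Lemma cvge_to0 (a : nat -> \bar R) : (forall n, 0 <= a n)%E ->
  (a n @[n --> \oo] --> 0%E <->
   forall e : R, 0 < e -> \forall n \near \oo, (a n <= e%:E)%E).
Proof.
move=> a0; split=> [/fine_cvgP[fin /cvgrPdist_le ac] e e0|ac].
  have {ac} := ac e e0; near_simpl; move: fin; apply: filterS2 => n fin /=.
  by rewrite sub0r normrN ger0_norm ?fine_ge0// -lee_fin fineK.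
apply/fine_cvgP; split.
  have := ac 1 ltr01; apply: filterS => n an.
  by rewrite ge0_fin_numE//; apply: le_lt_trans an _; rewrite ltry.
apply/cvgrPdist_le => e e0; near_simpl; have := ac e e0; apply: filterS => n an /=.
have fin : a n \is a fin_num.
  by rewrite ge0_fin_numE//; apply: le_lt_trans an _; rewrite ltry.
by rewrite sub0r normrN ger0_norm ?fine_ge0// -lee_fin fineK.
Qed.

(** Convergence in squared norm with explicit tolerances; [fnorm_cvgP] relates it to the convergence
    required in [fourier_graph]. *)
Definition L2cvg (u_ : nat -> R -> R[i]) f := forall e : R, 0 < e ->
  \forall n \near \oo, (sqn (fun x => (u_ n x - f x)%R) <= e%:E)%E.

Lemma fnorm_cvgP (u_ : nat -> R -> R[i]) f :
  fnorm (L2 R) (fun x => u_ n x - f x) @[n --> \oo] --> 0%E <-> L2cvg u_ f.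
Proof.
rewrite cvge_to0 => [|n]; last by rewrite /fnorm/= /cLnorm Lnorm_ge0.
rewrite /fnorm/=; split=> h e e0.
  have {h} := h (Num.sqrt e); rewrite sqrtr_gt0 => /(_ e0).
  apply: filterS => n; rewrite cLnorm2E => /(gt0_ler_poweR (ler0n R 2)).
  rewrite !in_itv/= poweR_ge0 lee_fin sqrtr_ge0 !leey => /(_ isT isT).
  rewrite -poweRrM mulVf// poweRe1 ?sqn_ge0//.
  by rewrite /= powR_mulrn ?sqrtr_ge0// sqr_sqrtr// ltW.
have {h} := h (e ^+ 2) (exprn_gt0 2 e0); apply: filterS => n.
have h2 : 0 <= (2^-1 : R) by rewrite invr_ge0.
rewrite cLnorm2E => /(gt0_ler_poweR h2).
rewrite !in_itv/= sqn_ge0 lee_fin sqr_ge0 !leey => /(_ isT isT) /le_trans; apply.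
by rewrite /= powR12_sqrt ?sqr_ge0// sqrtr_sqr ger0_norm// ltW.
Qed.

Lemma ge0_double_inj (a b : \bar R) : (0 <= a -> 0 <= b -> a + a = b + b -> a = b)%E.
Proof.
move: a b => [a| |] [b| |] //= _ _; rewrite -!EFinD => -[] ab; congr EFin; lra.
Qed.

Lemma cos_transformN (u : R -> R) (xi : R) :
  trig_transform cos u (- xi) = trig_transform cos u xi.
Proof. by apply: eq_Rintegral => x _; rewrite mulNr cosN. Qed.

Lemma sin_transformN (u : R -> R) (xi : R) :
  mu.-integrable setT (EFin \o u) ->
  trig_transform sin u (- xi) = - trig_transform sin u xi.
Proof.
move=> iu; have s1 := osc_intR xi (@osc_sin R) iu.
rewrite /trig_transform -[RHS]mulN1r -RintegralZl//.
by apply: eq_Rintegral => x _; rewrite mulNr sinN mulNr mulN1r.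
Qed.

Lemma int_D (u v : R -> R) : measurable_fun setT u -> measurable_fun setT v ->
  (forall x, 0 <= u x) -> (forall x, 0 <= v x) ->
  (\int[mu]_x (u x + v x)%:E = \int[mu]_x (u x)%:E + \int[mu]_x (v x)%:E)%E.
Proof.
move=> mu0 mv u0 v0; rewrite -ge0_integralD//.
- by move=> x _; rewrite lee_fin.
- exact/measurable_EFinP.
- by move=> x _; rewrite lee_fin.
- exact/measurable_EFinP.
Qed.

Local Notation reF f := (fun x => Re (f x)).
Local Notation imF f := (fun x => Im (f x)).

(** The intersection of L^1 and L^2 (see [L12P]), written through real and imaginary parts because
    the energy bounds concern real functions. *)
Definition L12 f := [/\ cmeas f, (N12 (reF f) < +oo)%E & (N12 (imF f) < +oo)%E].

Lemma normc_ge_Re (z : R[i]) : `|Re z| <= Normc.normc z.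
Proof.
rewrite -ler_sqr ?nnegrE ?normc_ge0// normc_sqc real_normK ?num_real//.
by rewrite lerDl sqr_ge0.
Qed.

Lemma normc_ge_Im (z : R[i]) : `|Im z| <= Normc.normc z.
Proof.
rewrite -ler_sqr ?nnegrE ?normc_ge0// normc_sqc real_normK ?num_real//.
by rewrite lerDr sqr_ge0.
Qed.

Lemma normc_le (z : R[i]) : Normc.normc z <= `|Re z| + `|Im z|.
Proof.
rewrite -ler_sqr ?nnegrE ?normc_ge0 ?addr_ge0// normc_sqc sqrrD.
rewrite !real_normK ?num_real// /sqc lerD2r lerDl.
by rewrite mulrn_wge0// mulr_ge0.
Qed.

Lemma measurable_normc f : cmeas f -> measurable_fun setT (fun x => Normc.normc (f x)).
Proof.
move=> mf; rewrite (_ : (fun _ => _) = (fun x => sqc (f x) `^ 2^-1)).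
  apply: (measurableT_comp (measurable_powR _)); exact: measurable_sqc.
by apply/funext => x; rewrite powR12_sqrt ?sqc_ge0// -normc_sqc sqrtr_sqr ger0_norm// normc_ge0.
Qed.

Lemma cLnorm1E f : cLnorm setT 1%:E f = (\int[mu]_x (Normc.normc (f x))%:E)%E.
Proof.
rewrite /cLnorm extend0T Lnorm1; apply: eq_integral => x _.
by rewrite /= ger0_norm// normc_ge0.
Qed.

Lemma L12P f : L12 f <-> Lp setT 1%:E f /\ Lp setT 2%:E f.
Proof.
split=> [[mf h1 h2]|].
  have [f1 f2] := mf.
  have m1 := measurable_N12 f1; have m2 := measurable_N12 f2.
  have hs : (\int[mu]_x (`|Re (f x)| + Re (f x) ^+ 2 + (`|Im (f x)| + Im (f x) ^+ 2))%:E < +oo)%E.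
    under eq_integral do rewrite EFinD.
    rewrite ge0_integralD//; try by move=> x _; rewrite lee_fin addr_ge0// sqr_ge0.
    by rewrite lte_add_pinfty.
    by apply/measurable_EFinP.
    by apply/measurable_EFinP.
  have ms : measurable_fun setT (fun x =>
      `|Re (f x)| + Re (f x) ^+ 2 + (`|Im (f x)| + Im (f x) ^+ 2)).
    exact: measurable_funD.
  have mn := measurable_normc mf.
  split.
    split => //; rewrite cLnorm1E; apply: le_lt_trans hs; apply: int_le => //.
    move=> x; rewrite normc_ge0/=; apply: le_trans (normc_le _) _.
    by have := sqr_ge0 (Re (f x)); have := sqr_ge0 (Im (f x)); lra.
  apply/L2P; split => //; apply: le_lt_trans hs; apply: int_le => //.
    move=> x; rewrite sqc_ge0/= /sqc.
    by have := normr_ge0 (Re (f x)); have := normr_ge0 (Im (f x)); lra.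
  exact: measurable_sqc.
move=> [[mf]]; rewrite cLnorm1E => h1 /L2P[_ h2].
have [f1 f2] := mf.
have hs : (\int[mu]_x (Normc.normc (f x) + sqc (f x))%:E < +oo)%E.
  under eq_integral do rewrite EFinD.
  rewrite ge0_integralD//.
  - by rewrite lte_add_pinfty.
  - by move=> x _; rewrite lee_fin normc_ge0.
  - by apply/measurable_EFinP; exact: measurable_normc.
  - by move=> x _; rewrite lee_fin sqc_ge0.
  - by apply/measurable_EFinP; exact: measurable_sqc.
have ms : measurable_fun setT (fun x => Normc.normc (f x) + sqc (f x)).
  by apply: measurable_funD; [exact: measurable_normc|exact: measurable_sqc].
split=> //; apply: le_lt_trans hs; apply: int_le => //; try exact: measurable_N12;
  move=> x; rewrite addr_ge0 ?sqr_ge0//=; apply: lerD;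
  by rewrite ?normc_ge_Re ?normc_ge_Im ?lerDl ?lerDr ?sqr_ge0.
Qed.

Local Notation ct u := (trig_transform cos u).
Local Notation st u := (trig_transform sin u).

Lemma L12_intR f : L12 f ->
  mu.-integrable setT (EFin \o reF f) /\ mu.-integrable setT (EFin \o imF f).
Proof. by move=> [[f1 f2] h1 h2]; split; exact: N12_intR. Qed.

Lemma fourier_integralE f xi : L12 f -> fourier_integral f xi =
  ((ct (reF f) xi - st (imF f) xi) +i* (st (reF f) xi + ct (imF f) xi))%C.
Proof.
move=> /L12_intR[i1 i2]; rewrite /fourier_integral /cintegral.
have c1 := osc_intR xi (@osc_cos R) i1; have s1 := osc_intR xi (@osc_sin R) i1.
have c2 := osc_intR xi (@osc_cos R) i2; have s2 := osc_intR xi (@osc_sin R) i2.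
congr (_ +i* _)%C.
  rewrite /trig_transform -RintegralB//.
  by apply: eq_Rintegral => x _; case: (f x).
rewrite /trig_transform -RintegralD//.
by apply: eq_Rintegral => x _; case: (f x) => a b /=; rewrite addrC.
Qed.

Lemma cmeas_fourier_integral f : L12 f -> cmeas (fourier_integral f).
Proof.
move=> hf; have [[f1 f2] h1 h2] := hf.
have c1 := measurable_cos_transform f1 h1; have s1 := measurable_sin_transform f1 h1.
have c2 := measurable_cos_transform f2 h2; have s2 := measurable_sin_transform f2 h2.
split.
  rewrite (_ : (fun _ => _) = (fun xi => ct (reF f) xi - st (imF f) xi)).
    exact: measurable_funB.
  by apply/funext => xi; rewrite fourier_integralE.
rewrite (_ : (fun _ => _) = (fun xi => st (reF f) xi + ct (imF f) xi)).
  exact: measurable_funD.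
by apply/funext => xi; rewrite fourier_integralE.
Qed.

(* The cross terms between the real and imaginary parts are odd in [xi]. *)
Lemma sqn_fourier_integral f : L12 f ->
  sqn (fourier_integral f) = (energy (reF f) + energy (imF f))%E.
Proof.
move=> hf; have [[f1 f2] h1 h2] := hf.
have mF := cmeas_fourier_integral hf; have mp1 := measurable_ppair f1 h1.
have mp2 := measurable_ppair f2 h2; have ms := measurable_sqc mF.
have [i1 i2] := L12_intR hf.
have ms' : measurable_fun setT (fun xi : R => sqc (fourier_integral f (- xi))).
  exact: (measurableT_comp (f := fun x => sqc (fourier_integral f x))).
have m12 : measurable_fun setT (fun x => ppair (reF f) (reF f) x + ppair (imF f) (imF f) x).
  exact: measurable_funD.
have p12 x : 0 <= ppair (reF f) (reF f) x + ppair (imF f) (imF f) x.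
  exact: addr_ge0 (ppair_ge0 _ _) (ppair_ge0 _ _).
have eE : (energy (reF f) + energy (imF f) = \int[mu]_x
    (ppair (reF f) (reF f) x + ppair (imF f) (imF f) x)%:E)%E.
  by apply/esym; apply: int_D => // x; exact: ppair_ge0.
have pw xi : sqc (fourier_integral f xi) + sqc (fourier_integral f (- xi)) =
    ppair (reF f) (reF f) xi + ppair (imF f) (imF f) xi +
    (ppair (reF f) (reF f) xi + ppair (imF f) (imF f) xi).
  rewrite (fourier_integralE xi hf) (fourier_integralE (- xi) hf).
  rewrite !cos_transformN (sin_transformN xi i1) (sin_transformN xi i2).
  by rewrite /sqc /ppair/=; ring.
have oE : sqn (fourier_integral f) = (\int[mu]_x (sqc (fourier_integral f (- x)))%:E)%E.
  apply: (@integral_oppr R (fun x => (sqc (fourier_integral f x))%:E)).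
    exact/measurable_EFinP.
  by move=> x; rewrite lee_fin sqc_ge0.
have sE : (sqn (fourier_integral f) + sqn (fourier_integral f) =
    \int[mu]_x (sqc (fourier_integral f x) + sqc (fourier_integral f (- x)))%:E)%E.
  apply/esym; apply: etrans (int_D ms ms' (fun x => sqc_ge0 _) (fun x => sqc_ge0 _)) _.
  exact: (f_equal2 adde erefl (esym oE)).
have key : (sqn (fourier_integral f) + sqn (fourier_integral f) =
    (energy (reF f) + energy (imF f)) + (energy (reF f) + energy (imF f)))%E.
  apply: etrans sE _; apply: etrans (f_equal2 adde (esym eE) (esym eE)).
  apply: etrans (int_D m12 m12 p12 p12).
  by apply: eq_integral => xi _; congr EFin; exact: pw.
apply: (ge0_double_inj _ _ key); first exact: sqn_ge0.
exact: adde_ge0 (energy_ge0 _) (energy_ge0 _).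
Qed.

Lemma plancherel_le f : L12 f ->
  (sqn (fourier_integral f) <= (4 * kappa R)%:E * sqn f)%E.
Proof.
move=> hf; have [[f1 f2] h1 h2] := hf.
rewrite sqn_fourier_integral// sqn_sqint// ge0_muleDr ?sqint_ge0//.
by apply: leeD; exact: energy_le.
Qed.

Lemma plancherel_ge f : L12 f ->
  (sqn f <= (2 / kappa R)%:E * sqn (fourier_integral f))%E.
Proof.
move=> hf; have [[f1 f2] h1 h2] := hf.
rewrite sqn_fourier_integral// sqn_sqint// ge0_muleDr ?energy_ge0//.
by apply: leeD; exact: sqint_le.
Qed.

Lemma L2_complete (h : nat -> R -> R[i]) : (forall n, cmeas (h n)) ->
  (forall e : R, 0 < e -> exists N, forall m n, (N <= m)%N -> (N <= n)%N ->
     (sqn (fun x => (h m x - h n x)%R) <= e%:E)%E) ->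
  exists2 g : R -> R[i], cmeas g & L2cvg h g.
Proof.
move=> mh ch.
have mR n : measurable_fun setT (reF (h n)) by case: (mh n).
have mI n : measurable_fun setT (imF (h n)) by case: (mh n).
have ReB m n x : Re (h m x) - Re (h n x) = Re (h m x - h n x).
  by case: (h m x) (h n x) => [? ?] [? ?].
have ImB m n x : Im (h m x) - Im (h n x) = Im (h m x - h n x).
  by case: (h m x) (h n x) => [? ?] [? ?].
have [|a ma ca] := @sqint_complete R (fun n => reF (h n)) mR.
  move=> e e0; have [N NP] := ch e e0; exists N => m n Nm Nn; apply: le_trans (NP m n Nm Nn).
  apply: int_le; [by apply: measurable_sqc; exact: cmeasB| |].
    by move=> x; rewrite sqr_ge0 ReB/= lerDl sqr_ge0.
  by apply: measurable_funX; exact: measurable_funB.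
have [|b mb cb] := @sqint_complete R (fun n => imF (h n)) mI.
  move=> e e0; have [N NP] := ch e e0; exists N => m n Nm Nn; apply: le_trans (NP m n Nm Nn).
  apply: int_le; [by apply: measurable_sqc; exact: cmeasB| |].
    by move=> x; rewrite sqr_ge0 ImB/= lerDr sqr_ge0.
  by apply: measurable_funX; exact: measurable_funB.
have mg : cmeas (fun x => (a x +i* b x)%C) by [].
exists (fun x => (a x +i* b x)%C) => // e e0.
have e2 : 0 < e / 2 by rewrite divr_gt0.
have [N1 N1P] := ca _ e2; have [N2 N2P] := cb _ e2.
near=> n; rewrite sqn_sqint; last exact: cmeasB.
have -> : e = e / 2 + e / 2 by field.
rewrite EFinD; apply: leeD.
  rewrite (_ : sqint _ = sqint (fun x => a x - Re (h n x))).
    by apply: N1P; near: n; exact: nbhs_infty_ge.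
  by apply: eq_integral => x _; case: (h n x) => p q /=; rewrite -sqrrN opprB.
rewrite (_ : sqint _ = sqint (fun x => b x - Im (h n x))).
  by apply: N2P; near: n; exact: nbhs_infty_ge.
by apply: eq_integral => x _; case: (h n x) => p q /=; rewrite -sqrrN opprB.
Unshelve. all: by end_near. Qed.

Local Notation isL2 f := (cmeas f /\ (sqn f < +oo)%E).

Lemma sqnB f g : cmeas f -> cmeas g ->
  (sqn (fun x => (f x - g x)%R) <= 2%:E * sqn f + 2%:E * sqn g)%E.
Proof.
move=> mf mg; rewrite -[X in (_ <= _ + _ * X)%E]sqnN; apply: sqnD => //; exact: cmeasN.
Qed.

Lemma sqn_dist f g h : cmeas f -> cmeas g -> cmeas h ->
  (sqn (fun x => (f x - h x)%R) <=
   2%:E * sqn (fun x => (f x - g x)%R) + 2%:E * sqn (fun x => (g x - h x)%R))%E.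
Proof.
move=> mf mg mh; rewrite (_ : (fun x => f x - h x) =
    fun x => (f x - g x) + (g x - h x)); last by apply/funext => x; rewrite addrA subrK.
by apply: sqnD; exact: cmeasB.
Qed.

Lemma sqn_distC f g : sqn (fun x => (f x - g x)%R) = sqn (fun x => (g x - f x)%R).
Proof. by rewrite -sqnN; congr sqn; apply/funext => x; rewrite opprB. Qed.

(** * The graph of the Fourier transformation *)

(** Comparing a limit with an approximant costs a factor 2, once for f and once for g; hence 4 C. *)
Lemma L2cvg_bound (C : R) (u_ v_ : nat -> R -> R[i]) f g : 0 <= C ->
  (forall n, cmeas (u_ n)) -> (forall n, cmeas (v_ n)) -> isL2 f -> cmeas g ->
  (forall n, (sqn (v_ n) <= C%:E * sqn (u_ n))%E) ->
  L2cvg u_ f -> L2cvg v_ g -> (sqn g <= (4 * C)%:E * sqn f)%E.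
Proof.
move=> C0 mu_ mv_ [mf ff] mg vu uf vg; apply/lee_addgt0Pr => e e0.
(* An error d in both sequences contributes 2 (C 2 d) + 2 d. *)
have C1 : 0 < 4 * C + 2 by rewrite ltr_wpDl// mulr_ge0.
have d0 : 0 < e / (4 * C + 2) by rewrite divr_gt0.
have [n [/= hu hv]] : exists n, (sqn (fun x => (u_ n x - f x)%R) <= (e / (4 * C + 2))%:E)%E
    /\ (sqn (fun x => (v_ n x - g x)%R) <= (e / (4 * C + 2))%:E)%E.
  have [N1 _ h1] := uf _ d0; have [N2 _ h2] := vg _ d0.
  by exists (maxn N1 N2); split; [apply: h1|apply: h2]; rewrite /= ?leq_maxl ?leq_maxr.
have h1 : (sqn g <= 2%:E * sqn (v_ n) + 2%:E * sqn (fun x => (v_ n x - g x)%R))%E.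
  rewrite [X in (sqn X <= _)%E](_ : _ = fun x => v_ n x - (v_ n x - g x)); last first.
    by apply/funext => x; rewrite opprB addrC subrK.
  by apply: sqnB => //; exact: cmeasB.
have h2 : (sqn (u_ n) <= 2%:E * sqn (fun x => (u_ n x - f x)%R) + 2%:E * sqn f)%E.
  rewrite [X in (sqn X <= _)%E](_ : _ = fun x => (u_ n x - f x) + f x); last first.
    by apply/funext => x; rewrite subrK.
  by apply: sqnD => //; exact: cmeasB.
have h3 := vu n; have p1 := sqn_ge0 (v_ n); have p2 := sqn_ge0 (u_ n).
have p3 := sqn_ge0 (fun x => u_ n x - f x).
have p4 := sqn_ge0 (fun x => v_ n x - g x); have p5 := sqn_ge0 f.
apply: le_trans h1 _.
move: hu hv h2 h3 ff p1 p2 p3 p4 p5 => {uf vg vu}.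
move: (sqn (v_ n)) (sqn (u_ n)) (sqn f) (sqn _) (sqn _).
move=> [v| |] [u| |] [a| |]// [b| |]// [c| |]//; rewrite -?(EFinM, EFinD) !lee_fin//.
move=> hb hc hu hv _ _ _ _ _ _.
have : (4 * C + 2) * (e / (4 * C + 2)) = e by field; rewrite gt_eqF.
have : C * u <= C * (2 * c + 2 * a) by rewrite ler_wpM2l.
set d := e / _ in hb hc *; nra.
Qed.

(** Applied to differences, the upper bound makes the relation functional and the lower bound makes
    it injective. The lower bound also turns Cauchy sequences of images into Cauchy sequences of
    originals. *)
Lemma graph_bounds f g : fourier_graph f g ->
  (sqn g <= (16 * kappa R)%:E * sqn f)%E /\ (sqn f <= (8 / kappa R)%:E * sqn g)%E.
Proof.
move=> [/L2P Lf /L2P Lg [u [Lu /fnorm_cvgP uf /fnorm_cvgP ug]]].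
have Lu12 n : L12 (u n) by apply/L12P; exact: Lu.
have mu_ n : cmeas (u n) by case: (Lu12 n).
have mU n : cmeas (fourier_integral (u n)) by exact: cmeas_fourier_integral.
have k0 := kappa_gt0 R; split.
  rewrite (_ : 16 * kappa R = 4 * (4 * kappa R)); last by ring.
  apply: L2cvg_bound uf ug => //; [by rewrite mulr_ge0// ltW|by case: Lg|].
  by move=> n; exact: plancherel_le.
rewrite (_ : 8 / kappa R = 4 * (2 / kappa R)); last by field; rewrite gt_eqF.
apply: L2cvg_bound ug uf => //; [by rewrite divr_ge0// ltW|by case: Lf|].
by move=> n; exact: plancherel_ge.
Qed.

Lemma isL2_lin (a : R[i]) f g : isL2 f -> isL2 g -> isL2 (fun x => a * f x + g x).
Proof.
move=> [mf hf] [mg hg]; have ma := cmeasZ a mf; split; first exact: cmeasD.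
apply: le_lt_trans; first exact: sqnD.
rewrite sqnZ// lte_add_pinfty// lte_mul_pinfty//.
by rewrite lte_mul_pinfty// ?lee_fin ?sqc_ge0.
Qed.

Lemma isL2_ae f g : cmeas g -> eq_ae setT f g -> isL2 f -> isL2 g.
Proof. by move=> mg fg [mf hf]; split => //; rewrite -(eq_ae_sqn mf mg fg). Qed.

Lemma N12_linlin (a b : R) (u v w : R -> R) : measurable_fun setT u ->
  measurable_fun setT v -> measurable_fun setT w ->
  (N12 u < +oo)%E -> (N12 v < +oo)%E -> (N12 w < +oo)%E ->
  (N12 (fun x => (a * u x + (b * v x + w x))%R) < +oo)%E.
Proof.
move=> mu0 mv mw hu hv hw.
have c0 (c : R) : (0%:E <= (2 * (`|c| + c ^+ 2))%:E)%E.
  by rewrite lee_fin mulr_ge0// addr_ge0// sqr_ge0.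
have mvw : measurable_fun setT (fun x => b * v x + w x).
  by apply: measurable_funD => //; apply: measurable_funM.
apply: le_lt_trans; first exact: N12_lin.
rewrite lte_add_pinfty//; first by rewrite lte_mul_pinfty.
rewrite lte_mul_pinfty//; apply: le_lt_trans; first exact: N12_lin.
by rewrite lte_add_pinfty// lte_mul_pinfty.
Qed.

Lemma L12_lin (a : R[i]) f g : L12 f -> L12 g -> L12 (fun x => a * f x + g x).
Proof.
move=> [[f1 f2] hf1 hf2] [[g1 g2] hg1 hg2]; split.
- by apply: cmeasD; [apply: cmeasZ|].
- rewrite (_ : (fun x => Re (a * f x + g x)) =
    fun x => Re a * Re (f x) + ((- Im a) * Im (f x) + Re (g x))).
    exact: N12_linlin.
  by apply/funext => x; case: (f x) (g x) a => [? ?] [? ?] [? ?] /=; ring.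
- rewrite (_ : (fun x => Im (a * f x + g x)) =
    fun x => Re a * Im (f x) + (Im a * Re (f x) + Im (g x))).
    exact: N12_linlin.
  by apply/funext => x; case: (f x) (g x) a => [? ?] [? ?] [? ?] /=; ring.
Qed.

Lemma fourier_integral_lin (a : R[i]) f g xi : L12 f -> L12 g ->
  fourier_integral (fun x => a * f x + g x) xi =
  a * fourier_integral f xi + fourier_integral g xi.
Proof.
move=> hf hg; rewrite !fourier_integralE//; last exact: L12_lin.
have [f1 f2] := L12_intR hf; have [g1 g2] := L12_intR hg.
have i1 := intRD (intRZ (- Im a) f2) g1; have i2 := intRD (intRZ (Im a) f1) g2.
rewrite (_ : (fun x => Re (a * f x + g x)) =
    fun x => Re a * Re (f x) + ((- Im a) * Im (f x) + Re (g x))); last first.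
  by apply/funext => x; case: (f x) (g x) {i1 i2} a => [? ?] [? ?] [? ?] /=; ring.
rewrite (_ : (fun x => Im (a * f x + g x)) =
    fun x => Re a * Im (f x) + (Im a * Re (f x) + Im (g x))); last first.
  by apply/funext => x; case: (f x) (g x) {i1 i2} a => [? ?] [? ?] [? ?] /=; ring.
rewrite !trig_transform_lin//; try exact: osc_cos; try exact: osc_sin.
by case: a {i1 i2} => p q /=; congr (_ +i* _)%C; ring.
Qed.

Lemma L2cvg_lin (a : R[i]) (u_ v_ : nat -> R -> R[i]) f g :
  (forall n, cmeas (u_ n)) -> (forall n, cmeas (v_ n)) -> cmeas f -> cmeas g ->
  L2cvg u_ f -> L2cvg v_ g ->
  L2cvg (fun n x => a * u_ n x + v_ n x) (fun x => a * f x + g x).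
Proof.
move=> mu_ mv_ mf mg uf vg e e0.
have k0 : 0 < 4 * (sqc a + 1) by rewrite mulr_gt0// ltr_wpDl// sqc_ge0.
have e4 : 0 < e / 4 by rewrite divr_gt0.
have := vg _ e4; have := uf _ (divr_gt0 e0 k0).
apply: filterS2 => n hu hv.
have mB := cmeasB (mu_ n) mf; have mBv := cmeasB (mv_ n) mg.
rewrite (_ : (fun _ => _) = fun x => a * (u_ n x - f x) + (v_ n x - g x)); last first.
  by apply/funext => x; ring.
apply: le_trans; first by apply: sqnD => //; exact: cmeasZ.
rewrite sqnZ//.
apply: (@le_trans _ _ (2%:E * ((sqc a)%:E * (e / (4 * (sqc a + 1)))%:E) + 2%:E * (e / 4)%:E)%E).
  by apply: leeD; rewrite !lee_wpmul2l// lee_fin sqc_ge0.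
rewrite -!(EFinM, EFinD) lee_fin.
have -> : 2 * (sqc a * (e / (4 * (sqc a + 1)))) = (e / 2) * (sqc a / (sqc a + 1)).
  by field; rewrite gt_eqF// ltr_wpDl// sqc_ge0.
suff : sqc a / (sqc a + 1) <= 1 by move=> h; nra.
by rewrite ler_pdivrMr ?mul1r ?lerDl// ltr_wpDl// sqc_ge0.
Qed.

Lemma graph_lin (a : R[i]) f g f' g' : fourier_graph f g -> fourier_graph f' g' ->
  fourier_graph (fun x => a * f x + f' x) (fun x => a * g x + g' x).
Proof.
move=> [/L2P Lf /L2P Lg [u [Lu /fnorm_cvgP uf /fnorm_cvgP ug]]].
move=> [/L2P Lf' /L2P Lg' [u' [Lu' /fnorm_cvgP uf' /fnorm_cvgP ug']]].
have U n : L12 (u n) by apply/L12P; exact: Lu.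
have U' n : L12 (u' n) by apply/L12P; exact: Lu'.
split; [by apply/L2P; exact: isL2_lin|by apply/L2P; exact: isL2_lin|].
exists (fun n x => a * u n x + u' n x); split.
- by move=> n; apply/L12P; exact: L12_lin.
- apply/fnorm_cvgP; apply: (L2cvg_lin a _ _ Lf.1 Lf'.1 uf uf').
    by move=> n; case: (U n).
  by move=> n; case: (U' n).
- apply/fnorm_cvgP; rewrite (_ : (fun n => fourier_integral _) = fun n xi =>
      a * fourier_integral (u n) xi + fourier_integral (u' n) xi); last first.
    by apply/funext => n; apply/funext => xi; exact: fourier_integral_lin.
  by apply: (L2cvg_lin a (fun n => cmeas_fourier_integral (U n))
    (fun n => cmeas_fourier_integral (U' n)) Lg.1 Lg'.1 ug ug').
Qed.

Lemma L2cvg_ae (u_ : nat -> R -> R[i]) f g : (forall n, cmeas (u_ n)) ->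
  cmeas f -> cmeas g -> eq_ae setT f g -> L2cvg u_ f -> L2cvg u_ g.
Proof.
move=> mu_ mf mg fg uf e e0; have := uf e e0; apply: filterS => n.
rewrite (@eq_ae_sqn (fun x => u_ n x - f x) (fun x => u_ n x - g x))//; try exact: cmeasB.
by apply: filterS fg => x + _ => /(_ I) ->.
Qed.

Lemma graph_ae f g f' g' : cmeas f' -> cmeas g' -> eq_ae setT f f' -> eq_ae setT g g' ->
  fourier_graph f g -> fourier_graph f' g'.
Proof.
move=> mf' mg' ff' gg' [/L2P Lf /L2P Lg [u [Lu /fnorm_cvgP uf /fnorm_cvgP ug]]].
have U n : L12 (u n) by apply/L12P; exact: Lu.
split; [by apply/L2P; exact: isL2_ae Lf|by apply/L2P; exact: isL2_ae Lg|].
exists u; split => //; apply/fnorm_cvgP.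
  by apply: L2cvg_ae uf => //; [move=> n; case: (U n)|case: Lf].
by apply: L2cvg_ae ug => //; [move=> n; exact: cmeas_fourier_integral|case: Lg].
Qed.

(** A diagonal choice: for each k, one L^1 and L^2 approximant of one pair is within 1 / (k + 1) in
    both coordinates at once. *)
Lemma graph_closed (f_ g_ : nat -> R -> R[i]) f g :
  (forall n, fourier_graph (f_ n) (g_ n)) -> isL2 f -> isL2 g ->
  L2cvg f_ f -> L2cvg g_ g -> fourier_graph f g.
Proof.
move=> Gn Lf Lg fc gc.
have /choice[w wP] : forall k : nat, exists w, [/\ L12 w,
    (sqn (fun x => (w x - f x)%R) <= (k.+1%:R^-1)%:E)%E &
    (sqn (fun x => (fourier_integral w x - g x)%R) <= (k.+1%:R^-1)%:E)%E].
  move=> k; set e : R := k.+1%:R^-1.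
  have e4 : 0 < e / 4 by rewrite divr_gt0// invr_gt0 ltr0n.
  have [N1 _ h1] := fc _ e4; have [N2 _ h2] := gc _ e4.
  pose n := maxn N1 N2.
  have := h1 n; have := h2 n; rewrite /= leq_maxl leq_maxr => /(_ isT) gn /(_ isT) fn.
  have [/L2P [mfn _] /L2P [mgn _] [u [Lu /fnorm_cvgP uf /fnorm_cvgP ug]]] := Gn n.
  have [M1 _ q1] := uf _ e4; have [M2 _ q2] := ug _ e4.
  pose m := maxn M1 M2.
  have := q1 m; have := q2 m; rewrite /= leq_maxl leq_maxr => /(_ isT) gm /(_ isT) fm.
  have U : L12 (u m) by apply/L12P; exact: Lu.
  have ee : (2%:E * (e / 4)%:E + 2%:E * (e / 4)%:E)%E = e%:E.
    by rewrite -!EFinM -EFinD; congr EFin; field; rewrite ?pnatr_eq0.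
  exists (u m); split=> //.
    apply: le_trans (sqn_dist _ mfn _) _; [by case: U|by case: Lf|].
    by rewrite -ee; apply: leeD; rewrite lee_wpmul2l.
  apply: le_trans (sqn_dist _ mgn _) _; [exact: cmeas_fourier_integral|by case: Lg|].
  by rewrite -ee; apply: leeD; rewrite lee_wpmul2l.
have small (e : R) : 0 < e -> \forall n \near \oo, (n.+1%:R^-1 <= e).
  move=> e0; near=> n; apply/ltW; near: n; exact: (near_infty_natSinv_lt (PosNum e0)).
split; [exact/L2P|exact/L2P|exists w; split].
- by move=> n; apply/L12P; case: (wP n).
- apply/fnorm_cvgP => e /small; apply: filterS => n ne.
  by case: (wP n) => _ /le_trans h _; apply: h; rewrite lee_fin.
- apply/fnorm_cvgP => e /small; apply: filterS => n ne.
  by case: (wP n) => _ _ /le_trans h; apply: h; rewrite lee_fin.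
Unshelve. all: by end_near. Qed.

Lemma isL2_lim (u_ : nat -> R -> R[i]) f : (forall n, isL2 (u_ n)) -> cmeas f ->
  L2cvg u_ f -> isL2 f.
Proof.
move=> Lu mf uf; split=> //; have [N _ /(_ N (leqnn N)) h] := uf 1 ltr01.
rewrite (_ : f = fun x => u_ N x - (u_ N x - f x)); last first.
  by apply/funext => x; rewrite opprB addrC subrK.
have [mu_ hu] := Lu N.
apply: le_lt_trans; first by apply: sqnB => //; exact: cmeasB.
rewrite lte_add_pinfty// lte_mul_pinfty//.
by apply: le_lt_trans h _; rewrite ltry.
Qed.

(** On a bounded window |v| <= 1 + v^2, so cutting a square integrable function to ]-n, n] makes it
    integrable; dominated convergence gives the limit. *)
Lemma truncation f : isL2 f -> exists u_ : nat -> R -> R[i],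
  (forall n, L12 (u_ n)) /\ L2cvg u_ f.
Proof.
move=> [mf hf]; have [f1 f2] := mf.
pose J n : set R := `]- n%:R, n%:R]%classic.
pose u_ n x := (\1_(J n) x)%:C%C * f x.
have mJ n : measurable_fun setT (\1_(J n) : R -> R) by exact: measurable_ind.
have mu_ n : cmeas (u_ n).
  by apply: cmeasM => //; split; [exact: (mJ n)|exact: (measurable_cst (0 : R))].
have reE n x : Re (u_ n x) = \1_(J n) x * Re (f x).
  by rewrite /u_; case: (f x) => a b /=; rewrite mul0r subr0.
have imE n x : Im (u_ n x) = \1_(J n) x * Im (f x).
  by rewrite /u_; case: (f x) => a b /=; rewrite mul0r addr0.
have N12J n (v : R -> R) : measurable_fun setT v -> (sqint v < +oo)%E ->
    (N12 (fun x => \1_(J n) x * v x)%R < +oo)%E.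
  move=> mv hv.
  apply: (@le_lt_trans _ _ (\int[mu]_x (\1_(J n) x + 2 * v x ^+ 2)%:E)%E).
    apply: int_le.
    - by apply: measurable_funD => //; apply: measurable_funM => //; exact: measurable_funX.
    - move=> x; rewrite addr_ge0 ?sqr_ge0//= indicE; case: (x \in J n) => /=.
        rewrite mul1r -[v x ^+ 2]real_normK ?num_real//.
        by have := sqr_ge0 (`|v x| - 1); have := sqr_ge0 (`|v x|); nra.
      by rewrite mul0r normr0 expr0n !add0r mulr_ge0// sqr_ge0.
    - by apply: measurable_N12; exact: measurable_funM.
  rewrite int_D//.
  - apply: lte_add_pinfty.
      by apply: integrable_lty => //; exact: ind_intR.
    under eq_integral do rewrite EFinM.
    rewrite ge0_integralZl_EFin//; first by rewrite lte_mul_pinfty.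
      by move=> x _; rewrite lee_fin sqr_ge0.
    by apply/measurable_EFinP; exact: measurable_funX.
  - by apply: measurable_funM => //; exact: measurable_funX.
  - by move=> x; rewrite mulr_ge0// sqr_ge0.
have [s1 s2] : (sqint (reF f) < +oo)%E /\ (sqint (imF f) < +oo)%E.
  move: hf; rewrite sqn_sqint// => h.
  by split; apply: le_lt_trans h; rewrite ?leeDl ?leeDr ?sqint_ge0.
exists u_; split=> [n|].
  split=> //.
    rewrite (_ : reF _ = fun x => \1_(J n) x * Re (f x)); last exact/funext/(reE n).
    exact: N12J.
  rewrite (_ : imF _ = fun x => \1_(J n) x * Im (f x)); last exact/funext/(imE n).
  exact: N12J.
pose d_ n x := (sqc (u_ n x - f x))%:E.
have mfd n : measurable_fun setT (d_ n).
  by apply/measurable_EFinP; apply: measurable_sqc; exact: cmeasB.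
have dE n x : sqc (u_ n x - f x) = (x \notin J n)%:R * sqc (f x).
  rewrite /u_ indicE; case: (x \in J n) => /=.
    by rewrite mul1r subrr sqc0 mul0r.
  by rewrite mul0r sub0r sqcN mul1r.
have dcvg : {ae mu, forall x, setT x -> d_ ^~ x @ \oo --> cst 0%E x}.
  apply: aeW => x _; apply: cvg_near_cst; near=> n.
  rewrite /d_ dE mem_set ?mul0r// /J /= in_itv/=.
  have : `|x| < n%:R by near: n; exact: nbhs_infty_gtr.
  by rewrite ltr_norml => /andP[-> /ltW].
have ig2 : mu.-integrable setT (fun x => (sqc (f x))%:E).
  apply/integrableP; split; first by apply/measurable_EFinP; exact: measurable_sqc.
  apply: le_lt_trans hf; rewrite le_eqVlt; apply/orP; left; apply/eqP.
  by apply: eq_integral => x _; rewrite gee0_abs// lee_fin sqc_ge0.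
have db : {ae mu, forall x n, setT x -> (`|d_ n x| <= (sqc (f x))%:E)%E}.
  apply: aeW => x n _; rewrite /d_ dE gee0_abs ?lee_fin ?mulr_ge0 ?sqc_ge0//.
  by case: (_ \notin _); rewrite ?mul1r// mul0r sqc_ge0.
case: (@dominated_convergence _ (measurableTypeR R) R mu setT measurableT
  d_ (cst 0%E) _ mfd (measurable_cst _) dcvg ig2 db) => _ _.
rewrite integral_cst// mul0e => /cvge_to0; apply.
by move=> n; apply: integral_ge0 => x _; rewrite lee_fin sqc_ge0.
Unshelve. all: by end_near. Qed.

(** The upper bound makes the transforms of the truncations Cauchy, and completeness supplies the
    value. This rules out the default value of [fourier] on L^2. *)
Lemma fourier_total f : isL2 f -> exists g, fourier_graph f g.
Proof.
move=> /[dup] Lf /truncation[u_ [Lu uf]].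
have mu_ n : cmeas (u_ n) by case: (Lu n).
have k0 := kappa_gt0 R.
have [|g mg gc] := L2_complete (fun n => cmeas_fourier_integral (Lu n)).
  (* 16 = 4 (2 + 2): [plancherel_le] is applied to a difference of truncations, itself split through
     f. *)
  move=> e e0; pose d := e / (16 * kappa R).
  have d0 : 0 < d by rewrite divr_gt0// mulr_gt0.
  have [N _ NP] := uf _ d0; exists N => m n Nm Nn.
  rewrite (_ : (fun _ => _) = fourier_integral (fun x => -1 * u_ n x + u_ m x)); last first.
    by apply/funext => x; rewrite fourier_integral_lin//; ring.
  apply: le_trans; first by apply: plancherel_le; exact: L12_lin.
  rewrite (_ : (fun _ => _) = fun x => (u_ m x - u_ n x)); last first.
    by apply/funext => x; ring.
  apply: (@le_trans _ _ ((4 * kappa R)%:E * (2%:E * d%:E + 2%:E * d%:E))%E).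
    apply: lee_wpmul2l; first by rewrite lee_fin mulr_ge0// ltW.
    apply: le_trans (sqn_dist _ Lf.1 _) _ => //.
    by rewrite leeD// lee_wpmul2l//; [exact: NP|rewrite sqn_distC; exact: NP].
  rewrite -!(EFinM, EFinD) lee_fin le_eqVlt; apply/orP; left; apply/eqP.
  by rewrite /d; field; rewrite gt_eqF.
have Lg : isL2 g.
  apply: (isL2_lim _ mg gc) => n; split; first exact: cmeas_fourier_integral.
  apply: le_lt_trans; first exact: plancherel_le.
  rewrite lte_mul_pinfty ?lee_fin ?mulr_ge0 ?ltW//.
  by have /L12P[_ /L2P[]] := Lu n.
exists g; split; [exact/L2P|exact/L2P|exists u_; split].
- by move=> n; apply/L12P.
- exact/fnorm_cvgP.
- exact/fnorm_cvgP.
Qed.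

(** * Translations and the reflection *)

(** Invariance of integrals of non-negative functions is the form from which signed integrals,
    squared norms and null sets all transfer. *)
Definition measure_preserving (h : R -> R) := measurable_fun setT h /\
  forall F : R -> \bar R, measurable_fun setT F -> (forall x, 0 <= F x)%E ->
    (\int[mu]_x F x = \int[mu]_x F (h x))%E.

Lemma measure_preserving_shift (a : R) : measure_preserving (fun x => x + a).
Proof.
split; first exact: measurable_funD.
move=> F mF F0; rewrite (integral_affine a ltr01)// mul1e.
by apply: eq_integral => x _; rewrite mul1r.
Qed.

Lemma measure_preserving_opp : measure_preserving (fun x => - x).
Proof.
split; first exact: measurable_funN.
by move=> F mF F0; exact: integral_oppr.
Qed.

Lemma Rintegral_preserving h (v : R -> R) : measure_preserving h -> measurable_fun setT v ->
  \int[mu]_x v x = \int[mu]_x v (h x).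
Proof.
move=> [mh ph] mv.
have mE : measurable_fun setT (EFin \o v) by exact/measurable_EFinP.
rewrite /Rintegral; congr fine.
rewrite [LHS]integralE [RHS]integralE; congr (_ - _)%E.
- rewrite (ph ((EFin \o v)^\+)%E (measurable_funepos mE) (fun x => funepos_ge0 _ x)).
  by apply: eq_integral => x _; rewrite !funepos.unlock.
- rewrite (ph ((EFin \o v)^\-)%E (measurable_funeneg mE) (fun x => funeneg_ge0 _ x)).
  by apply: eq_integral => x _; rewrite !funeneg.unlock.
Qed.

Lemma sqn_preserving h f : measure_preserving h -> cmeas f ->
  sqn (fun x => f (h x)) = sqn f.
Proof.
move=> [mh ph] mf; rewrite /sqn [RHS]ph//.
  by apply/measurable_EFinP; exact: measurable_sqc.
by move=> x; rewrite lee_fin sqc_ge0.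
Qed.

Lemma N12_preserving h (v : R -> R) : measure_preserving h -> measurable_fun setT v ->
  N12 (fun x => v (h x)) = N12 v.
Proof.
move=> [mh ph] mv; rewrite /N12 [RHS]ph//.
  by apply/measurable_EFinP; exact: measurable_N12.
by move=> x; rewrite lee_fin addr_ge0// sqr_ge0.
Qed.

Lemma cmeas_preserving h f : measure_preserving h -> cmeas f -> cmeas (fun x => f (h x)).
Proof. by move=> [mh _]; exact: cmeas_comp. Qed.

Lemma isL2_preserving h f : measure_preserving h -> isL2 f -> isL2 (fun x => f (h x)).
Proof.
by move=> ph [mf hf]; split; [exact: cmeas_preserving|rewrite sqn_preserving].
Qed.

Lemma L12_preserving h f : measure_preserving h -> L12 f -> L12 (fun x => f (h x)).
Proof.
move=> ph [/[dup] mf [f1 f2] h1 h2]; split; first exact: cmeas_preserving.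
  by rewrite (N12_preserving ph f1).
by rewrite (N12_preserving ph f2).
Qed.

Lemma L2cvg_preserving h (u_ : nat -> R -> R[i]) f : measure_preserving h ->
  (forall n, cmeas (u_ n)) -> cmeas f -> L2cvg u_ f ->
  L2cvg (fun n x => u_ n (h x)) (fun x => f (h x)).
Proof.
move=> ph mu_ mf uf e e0; have := uf e e0; apply: filterS => n.
by rewrite -(sqn_preserving ph (cmeasB (mu_ n) mf)).
Qed.

Lemma eq_ae_preserving h f g : measure_preserving h -> eq_ae setT f g ->
  eq_ae setT (fun x => f (h x)) (fun x => g (h x)).
Proof.
move=> [mh ph] [N [mN N0 Nfg]].
have mi : measurable_fun setT (\1_N : R -> R) by exact: measurable_indic.
exists (h @^-1` N); split.
- by rewrite -[X in measurable X]setTI; exact: mh.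
- have i0 : (\int[mu]_x (\1_N x)%:E = 0)%E by rewrite integral_indic// setIT.
  rewrite ph in i0; last 2 first.
  + exact/measurable_EFinP.
  + by move=> x; rewrite lee_fin indicE.
  have mhN : measurable (h @^-1` N) by rewrite -[X in measurable X]setTI; exact: mh.
  have := @integral_indic _ (measurableTypeR R) R mu setT measurableT _ mhN.
  by rewrite setIT => <-.
- by move=> x /= nfg; apply: Nfg => /= fg; apply: nfg => _; exact: fg.
Qed.

Lemma graph_reflection f g : fourier_graph f g ->
  fourier_graph (fun x => f (- x)) (fun x => g (- x)).
Proof.
have ph := measure_preserving_opp.
move=> [/L2P Lf /L2P Lg [u [Lu /fnorm_cvgP uf /fnorm_cvgP ug]]].
have U n : L12 (u n) by apply/L12P; exact: Lu.
have mu_ n : cmeas (u n) by case: (U n).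
split; [by apply/L2P; exact: isL2_preserving|by apply/L2P; exact: isL2_preserving|].
exists (fun n x => u n (- x)); split.
- by move=> n; apply/L12P; exact: L12_preserving.
- by apply/fnorm_cvgP; exact: L2cvg_preserving ph mu_ Lf.1 uf.
- apply/fnorm_cvgP; rewrite (_ : (fun n => fourier_integral _) =
    fun n xi => fourier_integral (u n) (- xi)).
    exact: L2cvg_preserving ph (fun n => cmeas_fourier_integral (U n)) Lg.1 ug.
  apply/funext => n; apply/funext => xi; have [f1 f2] := mu_ n.
  have mc (h : R -> R) (v : R -> R) : osc h -> measurable_fun setT v ->
      measurable_fun setT (fun x => h (xi * x) * v (- x)).
    move=> oh mv; apply: measurable_funM; first exact: osc_measurable.
    by apply: (measurableT_comp mv); exact: measurable_funN.
  have tE (h : R -> R) (v : R -> R) : osc h -> measurable_fun setT v ->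
      trig_transform h (fun x => v (- x)) xi = trig_transform h v (- xi).
    move=> oh mv; rewrite /trig_transform (Rintegral_preserving ph); last exact: mc.
    by apply: eq_Rintegral => x _; rewrite opprK mulrN mulNr.
  rewrite !fourier_integralE//; last exact: L12_preserving.
  have oc := @osc_cos R; have os := @osc_sin R.
  by rewrite -(tE cos (reF (u n)))// -(tE cos (imF (u n)))//
    -(tE sin (reF (u n)))// -(tE sin (imF (u n))).
Qed.

Lemma sqc_expi (t : R) : sqc (expi t) = 1.
Proof. by rewrite /sqc /= cos2Dsin2. Qed.

Lemma cmeas_expo (lambda : R) : cmeas (expo lambda).
Proof.
by split; apply: osc_measurable; [exact: osc_cos|exact: osc_sin].
Qed.

Lemma sqn_expo (lambda : R) f : sqn (fun x => expo lambda x * f x) = sqn f.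
Proof. by apply: eq_integral => x _; rewrite sqcM sqc_expi mul1r. Qed.

Lemma fourier_integral_shift (lambda : R) f xi : L12 f ->
  fourier_integral (fun x => f (x - lambda)) xi = expo lambda xi * fourier_integral f xi.
Proof.
move=> hf; have ph := measure_preserving_shift (- lambda).
have hs := L12_preserving ph hf.
have [i1 i2] := L12_intR hf; have [[f1 f2] _ _] := hf.
(* One statement for both addition formulas: [a] and [b] will be the cosine and sine of lambda xi,
   up to sign. *)
have tE (h h1 h2 : R -> R) (v : R -> R) (a b : R) : osc h -> osc h1 -> osc h2 ->
    (forall x : R, h (xi * x + xi * lambda) = a * h1 (xi * x) + b * h2 (xi * x)) ->
    mu.-integrable setT (EFin \o v) ->
    trig_transform h (fun x => v (x - lambda)) xi =
    a * trig_transform h1 v xi + b * trig_transform h2 v xi.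
  move=> oh o1 o2 hE iv; have /intRP[mv _] := iv.
  rewrite /trig_transform (Rintegral_preserving (measure_preserving_shift lambda)); last first.
    apply: measurable_funM; first exact: osc_measurable.
    by apply: (measurableT_comp mv); exact: measurable_funD.
  rewrite -RintegralZl//; last exact: osc_intR.
  rewrite -RintegralZl//; last exact: osc_intR.
  rewrite -RintegralD//; [|by apply: intRZ; exact: osc_intR..].
  by apply: eq_Rintegral => x _; rewrite addrK mulrDr hE; ring.
have oc := @osc_cos R; have os := @osc_sin R.
have cE (v : R -> R) : mu.-integrable setT (EFin \o v) ->
    ct (fun x => v (x - lambda)) xi =
    cos (lambda * xi) * ct v xi + (- sin (lambda * xi)) * st v xi.
  by apply: tE => // x; rewrite cosD (mulrC lambda); ring.
have sE (v : R -> R) : mu.-integrable setT (EFin \o v) ->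
    st (fun x => v (x - lambda)) xi =
    cos (lambda * xi) * st v xi + sin (lambda * xi) * ct v xi.
  by apply: tE => // x; rewrite sinD (mulrC lambda); ring.
rewrite !fourier_integralE// (cE _ i1) (cE _ i2) (sE _ i1) (sE _ i2).
by rewrite /expo /expi; congr (_ +i* _)%C => /=; ring.
Qed.

Lemma graph_shift (lambda : R) f g : fourier_graph f g ->
  fourier_graph (fun x => f (x - lambda)) (fun x => expo lambda x * g x).
Proof.
have ph := measure_preserving_shift (- lambda).
move=> [/L2P Lf /L2P Lg [u [Lu /fnorm_cvgP uf /fnorm_cvgP ug]]].
have U n : L12 (u n) by apply/L12P; exact: Lu.
have mu_ n : cmeas (u n) by case: (U n).
split; first by apply/L2P; exact: isL2_preserving.
  by apply/L2P; rewrite sqn_expo; split; [exact: cmeasM (cmeas_expo _) Lg.1|exact: Lg.2].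
exists (fun n x => u n (x - lambda)); split.
- by move=> n; apply/L12P; exact: L12_preserving.
- by apply/fnorm_cvgP; exact: L2cvg_preserving ph mu_ Lf.1 uf.
- apply/fnorm_cvgP => e e0; have := ug e e0; apply: filterS => n.
  rewrite -(sqn_expo lambda) (_ : (fun x => expo lambda x * _) = fun x =>
    fourier_integral (fun x => u n (x - lambda)) x - expo lambda x * g x)//.
  by apply/funext => xi; rewrite fourier_integral_shift// mulrBr.
Qed.

Local Notation "f =a g" := (eq_ae setT f g) (at level 70).

Lemma eqa_refl f : f =a f.
Proof. exact: aeW. Qed.

Lemma eqa_sym f g : f =a g -> g =a f.
Proof. by apply: filterS => x + _ => /(_ I) ->. Qed.

Lemma eqa_trans f g h : f =a g -> g =a h -> f =a h.
Proof. by apply: filterS2 => x + + _ => /(_ I) -> /(_ I) ->. Qed.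

Lemma graph_isL2 f g : fourier_graph f g -> isL2 f /\ isL2 g.
Proof. by move=> [/L2P ? /L2P ? _]. Qed.

Lemma graph_diff f g f' g' : fourier_graph f g -> fourier_graph f' g' ->
  fourier_graph (fun x => f x - f' x) (fun x => g x - g' x).
Proof.
move=> G G'; have := graph_lin (-1) G' G.
by rewrite (_ : (fun x => -1 * f' x + f x) = (fun x => f x - f' x));
  [rewrite (_ : (fun x => -1 * g' x + g x) = (fun x => g x - g' x))//|];
  apply/funext => x; ring.
Qed.

Lemma sqn_sub_eq0 f g : cmeas f -> cmeas g -> f =a g ->
  sqn (fun x => (f x - g x)%R) = 0%E.
Proof.
move=> mf mg fg; rewrite (@eq_ae_sqn _ (fun=> 0)).
- by apply: integral0_eq => x _; rewrite sqc0.
- exact: cmeasB.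
- exact: cmeas_cst.
- by apply: filterS fg => x + _ => /(_ I) ->; rewrite subrr.
Qed.

Lemma sqn_sub_eqa f g : cmeas f -> cmeas g ->
  (sqn (fun x => (f x - g x)%R) <= 0)%E -> f =a g.
Proof.
move=> mf mg h; have s0 : sqn (fun x => f x - g x) = 0%E.
  by apply/eqP; rewrite eq_le h sqn_ge0.
have := sqn_eq0 (cmeasB mf mg) s0; apply: filterS => x + _ => /(_ I) /eqP.
by rewrite subr_eq0 => /eqP.
Qed.

Lemma graph_unique f g f' g' : fourier_graph f g -> fourier_graph f' g' ->
  f =a f' -> g =a g'.
Proof.
move=> G G' ff'; have [Lf Lg] := graph_isL2 G; have [Lf' Lg'] := graph_isL2 G'.
apply: sqn_sub_eqa; [by case: Lg|by case: Lg'|].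
have [+ _] := graph_bounds (graph_diff G G').
by rewrite (sqn_sub_eq0 Lf.1 Lf'.1 ff') mule0.
Qed.

Lemma graph_inj f g f' g' : fourier_graph f g -> fourier_graph f' g' ->
  g =a g' -> f =a f'.
Proof.
move=> G G' ff'; have [Lf Lg] := graph_isL2 G; have [Lf' Lg'] := graph_isL2 G'.
apply: sqn_sub_eqa; [by case: Lf|by case: Lf'|].
have [_ +] := graph_bounds (graph_diff G G').
by rewrite (sqn_sub_eq0 Lg.1 Lg'.1 ff') mule0.
Qed.

Lemma fourierP f : isL2 f -> fourier_graph f (fourier f).
Proof.
move=> /fourier_total[g Gg].
by apply: (@xgetPex _ _ [set g | fourier_graph f g]); exists g.
Qed.

Lemma inv_fourierP f g : fourier_graph f g -> fourier_graph (inv_fourier g) g.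
Proof.
by move=> G; apply: (@xgetPex _ _ [set f | fourier_graph f g]); exists f.
Qed.

(** * Essentially bounded functions *)

Lemma cLnormyE f : cLnorm setT +oo%E f = ess_sup mu (fun x => (Normc.normc (f x))%:E).
Proof.
rewrite /cLnorm extend0T unlock/= ifT; last first.
  by rewrite -set_itvNyy lebesgue_measure_itv/= ltry.
congr ess_sup; apply/funext => x.
by rewrite /= ger0_norm// normc_ge0.
Qed.

Lemma cLnormy_lt (e : R) f : (cLnorm setT +oo%E f < e%:E)%E ->
  {ae mu, forall x, sqc (f x) <= e ^+ 2}.
Proof.
rewrite cLnormyE => he; have := ess_sup_ge mu (fun x => (Normc.normc (f x))%:E).
apply: filterS => x /le_lt_trans /(_ he); rewrite lte_fin => h.
have n0 : 0 <= Normc.normc (f x) by exact: normc_ge0.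
by rewrite -normc_sqc ler_sqr ?nnegrE// ltW// (le_lt_trans n0 h).
Qed.

Lemma LinftyP f : Linfty f <->
  cmeas f /\ exists2 M : R, 0 <= M & {ae mu, forall x, sqc (f x) <= M}.
Proof.
split=> [[mf hf]|[mf [M M0 fM]]].
  split=> //; have h0 : (0 <= cLnorm setT +oo f)%E by exact: Lnorm_ge0.
  have fin : cLnorm setT +oo f \is a fin_num by rewrite ge0_fin_numE.
  exists ((fine (cLnorm setT +oo f) + 1) ^+ 2); first exact: sqr_ge0.
  by apply: cLnormy_lt; rewrite -{1}(fineK fin) lte_fin ltrDl.
split=> //=; rewrite cLnormyE; apply: (@le_lt_trans _ _ (Num.sqrt M)%:E); last by rewrite ltry.
apply/ess_supP; apply: filterS fM => x h.
by rewrite lee_fin -ler_sqr ?nnegrE ?normc_ge0 ?sqrtr_ge0// normc_sqc sqr_sqrtr.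
Qed.

Lemma LinftyD f g : Linfty f -> Linfty g -> Linfty (f \+ g).
Proof.
move=> /LinftyP[mf [M M0 hM]] /LinftyP[mg [N N0 hN]]; apply/LinftyP; split.
  exact: cmeasD.
exists (2 * M + 2 * N); first by rewrite addr_ge0// mulr_ge0.
apply: filterS2 hM hN => x hM hN; apply: le_trans (sqcD _ _) _.
by rewrite lerD// ler_wpM2l.
Qed.

Lemma LinftyM f g : Linfty f -> Linfty g -> Linfty (f \* g).
Proof.
move=> /LinftyP[mf [M M0 hM]] /LinftyP[mg [N N0 hN]]; apply/LinftyP; split.
  exact: cmeasM.
exists (M * N); first exact: mulr_ge0.
by apply: filterS2 hM hN => x hM hN /=; rewrite sqcM ler_pM// sqc_ge0.
Qed.

Lemma LinftyZ (a : R[i]) f : Linfty f -> Linfty (fun x => a * f x).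
Proof.
apply: (@LinftyM (fun=> a)); apply/LinftyP; split; first exact: cmeas_cst.
by exists (sqc a); [exact: sqc_ge0|exact: aeW].
Qed.

Lemma Linfty_expo (lambda : R) : Linfty (expo lambda).
Proof.
apply/LinftyP; split; first exact: cmeas_expo.
by exists 1 => //; apply: aeW => x; rewrite sqc_expi.
Qed.

Lemma Linfty_mul psi g (M : R) : 0 <= M -> cmeas psi ->
  {ae mu, forall x, sqc (psi x) <= M} -> isL2 g ->
  isL2 (fun x => psi x * g x) /\ (sqn (fun x => (psi x * g x)%R) <= M%:E * sqn g)%E.
Proof.
move=> M0 mp hM [mg hg].
have mpg : cmeas (fun x => psi x * g x) by exact: cmeasM.
have h : (sqn (fun x => (psi x * g x)%R) <= M%:E * sqn g)%E.
  apply: sqn_le => //; apply: filterS hM => x hM.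
  by rewrite sqcM ler_wpM2r// sqc_ge0.
by split => //; split => //; apply: le_lt_trans h _; rewrite lte_mul_pinfty.
Qed.

(** * Fourier multipliers *)

Definition L2_subspace (S : set (R -> R[i])) := [/\ forall f, S f -> isL2 f,
  forall a f g, S f -> S g -> S (fun x => a * f x + g x) &
  forall (u_ : nat -> R -> R[i]) f, (forall n, S (u_ n)) -> isL2 f -> L2cvg u_ f -> S f].

(** For S = L^2 this ensures that [inv_fourier] is applied inside the range of the transformation;
    for smaller S it says that F^-1 psi F preserves S. *)
Definition multiplier (S : set (R -> R[i])) (psi : R -> R[i]) := Linfty psi /\
  forall f g, S f -> fourier_graph f g ->
    exists2 f', S f' & fourier_graph f' (psi \* g).

Lemma L2cvg_cauchy (u_ : nat -> R -> R[i]) f : (forall n, cmeas (u_ n)) -> cmeas f ->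
  L2cvg u_ f -> forall e : R, 0 < e -> exists N, forall m n, (N <= m)%N -> (N <= n)%N ->
     (sqn (fun x => (u_ m x - u_ n x)%R) <= e%:E)%E.
Proof.
move=> mu_ mf uf e e0; have e4 : 0 < e / 4 by rewrite divr_gt0.
have [N _ NP] := uf _ e4; exists N => m n Nm Nn.
apply: le_trans (sqn_dist (mu_ m) mf (mu_ n)) _.
have -> : (e%:E = 2%:E * (e / 4)%:E + 2%:E * (e / 4)%:E)%E.
  by rewrite -!EFinM -EFinD; congr EFin; field; rewrite ?pnatr_eq0.
apply: leeD; apply: lee_wpmul2l => //; first exact: NP.
by rewrite sqn_distC; exact: NP.
Qed.

(** The delicate point is uniform limits: q_n g tends to p g in L^2, the lower bound in
    [graph_bounds] makes the preimages Cauchy, and their limit is caught by the closedness of S and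
    of the graph. *)
Lemma multiplier_closed_subalgebra S : L2_subspace S ->
  closed_subalgebra [set psi | multiplier S psi].
Proof.
move=> [SL Slin Scl]; split.
- by move=> psi [].
- move=> p q [Lp_ Mp] [Lq Mq]; split; first exact: LinftyD.
  move=> f g Sf G; have [f1 S1 G1] := Mp _ _ Sf G; have [f2 S2 G2] := Mq _ _ Sf G.
  exists (fun x => 1 * f1 x + f2 x); first exact: Slin.
  rewrite (_ : _ \* g = fun x => 1 * (p \* g) x + (q \* g) x); first exact: graph_lin.
  by apply/funext => x /=; ring.
- move=> a p [Lp_ Mp]; split; first exact: LinftyZ.
  move=> f g Sf G; have [f1 S1 G1] := Mp _ _ Sf G.
  (* The combination -1 f + f stands for 0, since [L2_subspace] offers combinations only in the form
     a f + g. *)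
  exists (fun x => a * f1 x + (-1 * f x + f x)); first by apply: (Slin) => //; apply: (Slin).
  rewrite (_ : _ \* g = fun x => a * (p \* g) x + (-1 * g x + g x)).
    by apply: graph_lin => //; exact: graph_lin.
  by apply/funext => x /=; ring.
- move=> p q [Lp_ Mp] [Lq Mq]; split; first exact: LinftyM.
  move=> f g Sf G; have [f1 S1 G1] := Mq _ _ Sf G; have [f2 S2 G2] := Mp _ _ S1 G1.
  exists f2 => //; rewrite (_ : _ \* g = p \* (q \* g))//.
  by apply/funext => x /=; ring.
- move=> p Lp_ ap; split=> // f g Sf G; have [Lf Lg] := graph_isL2 G.
  have [mg hg] := Lg; have /LinftyP[mp [M M0 hM]] := Lp_.
  have gfin : sqn g \is a fin_num by rewrite ge0_fin_numE ?sqn_ge0.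
  have /choice[q qP] : forall n : nat, exists q, multiplier S q /\
      (cLnorm setT +oo (fun x => (p x - q x)%R) < (n.+1%:R^-1)%:E)%E.
    by move=> n; have [|q Mq pq] := ap (n.+1%:R^-1); [rewrite invr_gt0 ltr0n|exists q].
  have /choice[f_ fP] : forall n : nat, exists f', S f' /\ fourier_graph f' (q n \* g).
    by move=> n; have [[_ Mq] _] := qP n; have [f' ? ?] := Mq _ _ Sf G; exists f'.
  have mq n : cmeas (q n) by have [[/LinftyP[]]] := qP n.
  have mqg n : cmeas (q n \* g) by exact: cmeasM.
  have mpg : cmeas (p \* g) by exact: cmeasM.
  have Lpg : isL2 (p \* g) := (Linfty_mul M0 mp hM Lg).1.
  have gc : L2cvg (fun n => q n \* g) (p \* g).
    move=> e e0.
    (* The summand 1 covers g = 0. The squared distance 1 / (n + 1)^2 will be bounded by 1 / (n +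
       1). *)
    have d0 : 0 < e / (fine (sqn g) + 1).
      by rewrite divr_gt0// ltr_wpDl// fine_ge0// sqn_ge0.
    near=> n; have [_ /cLnormy_lt hq] := qP n.
    rewrite sqn_distC (_ : (fun x => _) = fun x => (p x - q n x) * g x); last first.
      by apply/funext => x /=; ring.
    have [_] := Linfty_mul (sqr_ge0 _) (cmeasB mp (mq n)) hq Lg.
    move=> /le_trans; apply; rewrite -(fineK gfin) -EFinM lee_fin.
    have n1 : n.+1%:R^-1 <= e / (fine (sqn g) + 1).
      apply/ltW; near: n; exact: (near_infty_natSinv_lt (PosNum d0)).
    have n0 : 0 <= n.+1%:R^-1 :> R by rewrite invr_ge0.
    have n2 : n.+1%:R^-1 <= 1 :> R by rewrite invf_le1 ?ltr0n// ler1n.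
    have g0 : 0 <= fine (sqn g) by rewrite fine_ge0// sqn_ge0.
    have n3 : n.+1%:R^-1 * (fine (sqn g) + 1) <= e by rewrite -ler_pdivlMr// ltr_wpDl.
    have : n.+1%:R^-1 ^+ 2 * fine (sqn g) <= n.+1%:R^-1 * fine (sqn g).
      by rewrite ler_wpM2r// expr2 ler_piMr.
    by move=> /le_trans; apply; apply: le_trans n3; rewrite ler_wpM2l// lerDl.
  have mf_ n : cmeas (f_ n) by have [/SL[]] := fP n.
  have [|f' mf' fc] := L2_complete mf_.
    move=> e e0; pose C := 8 / kappa R.
    have C0 : 0 < C by rewrite divr_gt0// kappa_gt0.
    have [N NP] := L2cvg_cauchy mqg mpg gc (divr_gt0 e0 C0).
    exists N => m n Nm Nn; have [_ Gm] := fP m; have [_ Gn] := fP n.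
    have [_ /le_trans] := graph_bounds (graph_diff Gm Gn); apply.
    apply: (@le_trans _ _ (C%:E * (e / C)%:E)%E).
      by apply: lee_wpmul2l; [rewrite lee_fin ltW|exact: NP].
    by rewrite -EFinM mulrC divfK// gt_eqF.
  have Lf' : isL2 f' by apply: isL2_lim mf' fc => n; apply: SL; case: (fP n).
  exists f'; first by apply: Scl fc => // n; case: (fP n).
  by apply: graph_closed fc gc => // n; case: (fP n).
Unshelve. all: by end_near. Qed.

(** * Functions vanishing on a set, and their multipliers *)

Lemma extend0E (D : set R) f x : extend0 D f x = ((\1_D x)%:C)%C * f x.
Proof.
rewrite /extend0 /patch indicE; case: ifP => _; last by rewrite mul0r.
by rewrite mul1r.
Qed.

Lemma cmeas_extend0 (D : set R) f : measurable D -> cmeas f -> cmeas (extend0 D f).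
Proof.
move=> mD mf; rewrite (_ : extend0 D f = fun x => ((\1_D x)%:C)%C * f x); last first.
  by apply/funext => x; rewrite extend0E.
apply: cmeasM => //; split; last exact: measurable_cst.
exact: measurable_indic.
Qed.

Lemma sqc_extend0_le (D : set R) f x : sqc (extend0 D f x) <= sqc (f x).
Proof. by rewrite /extend0 /patch; case: ifP => // _; rewrite sqc0 sqc_ge0. Qed.

Lemma sqn_extend0_le (D : set R) f : measurable D -> cmeas f ->
  (sqn (extend0 D f) <= sqn f)%E.
Proof.
move=> mD mf; rewrite -[leRHS]mul1e; apply: sqn_le => //; first exact: cmeas_extend0.
by apply: aeW => x; rewrite mul1r sqc_extend0_le.
Qed.

Lemma isL2_extend0 (D : set R) f : measurable D -> isL2 f -> isL2 (extend0 D f).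
Proof.
move=> mD [mf hf]; split; first exact: cmeas_extend0.
by apply: le_lt_trans hf; exact: sqn_extend0_le.
Qed.

Lemma extend0_lin (D : set R) (a : R[i]) f g :
  extend0 D (fun x => a * f x + g x) = fun x => a * extend0 D f x + extend0 D g x.
Proof. by apply/funext => x; rewrite !extend0E; ring. Qed.

(* With [D := Rplus] this is the orthogonal complement of L^2_+. *)
Definition L2_vanishing (D : set R) : set (R -> R[i]) :=
  [set f | isL2 f /\ extend0 D f =a (fun=> 0)].

Lemma L2_vanishing_subspace (D : set R) : measurable D -> L2_subspace (L2_vanishing D).
Proof.
move=> mD; split; first by move=> f [].
  move=> a f g [Lf zf] [Lg zg]; split; first exact: isL2_lin.
  rewrite extend0_lin; apply: filterS2 zf zg => x + + _ => /(_ I) -> /(_ I) ->.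
  by rewrite mulr0 addr0.
move=> u_ f uZ Lf uf; split => //; have [mf _] := Lf.
have mu_ n : cmeas (u_ n) by have [[]] := uZ n.
have m0 := cmeas_cst 0; have mef := cmeas_extend0 mD mf.
apply: sqn_sub_eqa => //; apply/lee_addgt0Pr => e e0; rewrite add0e.
have [N _ /(_ N (leqnn N)) h] := uf _ e0; apply: le_trans h.
rewrite [leRHS]sqn_distC; have [_ zN] := uZ N.
have mD1 := cmeasB mf (mu_ N).
(* Almost everywhere on [D] the function u_N vanishes, so f and f - u_N have the same restriction
   there, bounded by the full distance. *)
apply: le_trans (sqn_extend0_le mD mD1).
rewrite (@eq_ae_sqn _ (extend0 D (fun x => f x - u_ N x))) //.
- exact: cmeasB.
- exact: cmeas_extend0.
- apply: filterS zN => x + _ => /(_ I); rewrite !extend0E => h.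
  by rewrite mulrBr h.
Qed.

Lemma multiplier_expo S (lambda : R) : (forall f, S f -> S (fun x => f (x - lambda))) ->
  multiplier S (expo lambda).
Proof.
move=> Sh; split; first exact: Linfty_expo.
by move=> f g Sf G; exists (fun x => f (x - lambda)); [exact: Sh|exact: graph_shift].
Qed.

Lemma L2_vanishing_shift (D : set R) (lambda : R) f :
  (forall x, D x -> D (x - lambda)) -> L2_vanishing D f ->
  L2_vanishing D (fun x => f (x - lambda)).
Proof.
move=> Dl [Lf zf]; have ph := measure_preserving_shift (- lambda); split.
  exact: isL2_preserving Lf.
apply: filterS (eq_ae_preserving ph zf) => x + _ => /(_ I).
rewrite !extend0E !indicE; have [Dx|_] := boolP (x \in D); last by rewrite mul0r.
by rewrite mem_set//; exact/Dl/set_mem.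
Qed.

Lemma L2_vanishing_reflection (D : set R) f : L2_vanishing D f ->
  L2_vanishing (-%R @^-1` D) (fun x => f (- x)).
Proof.
move=> [Lf zf]; have ph := measure_preserving_opp; split; first exact: isL2_preserving Lf.
apply: filterS (eq_ae_preserving ph zf) => x + _ => /(_ I).
by rewrite !extend0E !indicE.
Qed.

(** F commutes with J, so conjugation by J turns multiplication by psi into multiplication by J psi,
    and vanishing on D into vanishing on -D. *)
Lemma multiplier_reflection (D : set R) psi : multiplier (L2_vanishing D) psi ->
  multiplier (L2_vanishing (-%R @^-1` D)) (reflection psi).
Proof.
move=> [/LinftyP[mp [M M0 hM]] h]; have ph := measure_preserving_opp; split.
  apply/LinftyP; split; first exact: cmeas_preserving.
  exists M => //.
  (* [eq_ae_preserving] transports equalities only, so the essential bound is encoded as the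
     vanishing of the indicator of the set where it fails. *)
  pose c x : R[i] := if sqc (psi x) <= M then 0 else 1.
  have /(eq_ae_preserving ph) : c =a (fun=> 0).
    by apply: filterS hM => x hx _; rewrite /c hx.
  apply: filterS => x /(_ I); rewrite /c; case: ifP => // _ /eqP.
  by rewrite oner_eq0.
have oppD : -%R @^-1` (-%R @^-1` D) = D.
  rewrite -comp_preimage (_ : _ \o _ = id)//.
  by apply/funext => x /=; rewrite opprK.
move=> f g Zf G; have := L2_vanishing_reflection Zf; rewrite oppD => Zf'.
have [f' Sf' G'] := h _ _ Zf' (graph_reflection G).
exists (fun x => f' (- x)); first exact: L2_vanishing_reflection.
have := graph_reflection G'; rewrite /reflection.
by under [in X in fourier_graph _ X -> _]eq_fun do rewrite /= opprK.
Qed.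

(** Multipliers of S form one of the closed subalgebras that [smallest] intersects, so only the
    generators have to be tested. *)
Lemma smallest_multiplier S (A : set (R -> R[i])) : L2_subspace S ->
  (forall psi, A psi -> multiplier S psi) ->
  forall psi, smallest (@closed_subalgebra R) A psi -> multiplier S psi.
Proof.
move=> Ssub AS psi; apply; split; last exact: AS.
exact: multiplier_closed_subalgebra.
Qed.

Lemma isL2_subspace : L2_subspace (fun f => isL2 f).
Proof. by split=> // a f g; exact: isL2_lin. Qed.

Lemma measurable_Rplus : measurable (@Rplus R).
Proof. exact: measurable_itv. Qed.

(** For lambda <= 0 the function f(x - lambda) is f moved to the left, so it still vanishes on the
    right half-line if f does. *)
Lemma AP_minus_multiplier psi : AP_minus psi ->
  multiplier (fun f => isL2 f) psi /\ multiplier (L2_vanishing (@Rplus R)) psi.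
Proof.
move=> Ap; split; apply: smallest_multiplier Ap.
- exact: isL2_subspace.
- move=> _ [l _ <-]; apply: multiplier_expo => f.
  exact: isL2_preserving (measure_preserving_shift _).
- exact: L2_vanishing_subspace measurable_Rplus.
- move=> _ [l /= l0 <-]; apply: multiplier_expo => f.
  apply: L2_vanishing_shift => x; rewrite /Rplus/= !in_itv/= !andbT => x0.
  by rewrite subr_gt0 (le_lt_trans l0).
Qed.

Lemma AP_multiplier psi : AP psi -> multiplier (fun f => isL2 f) psi.
Proof.
apply: smallest_multiplier; first exact: isL2_subspace.
move=> _ [l _ <-]; apply: multiplier_expo => f.
exact: isL2_preserving (measure_preserving_shift _).
Qed.

Lemma multiplier_isL2_reflection psi : multiplier (fun f => isL2 f) psi ->
  multiplier (fun f => isL2 f) (reflection psi).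
Proof.
(* All of L^2 is the case of the empty set, which is its own reflection. *)
have E : (fun f => isL2 f) = L2_vanishing set0.
  apply/funext => f; apply/propext; split=> [Lf|[]//]; split=> //.
  by apply: aeW => x _; rewrite extend0E indic0 mul0r.
by rewrite E => /multiplier_reflection; rewrite preimage_set0.
Qed.

(** Mirror image of the previous case: frequencies >= 0 preserve vanishing on the left half-line,
    and the reflection exchanges the half-lines. *)
Lemma AP_plus_multiplier psi : AP_plus psi -> multiplier (fun f => isL2 f) psi /\
  multiplier (L2_vanishing (@Rplus R)) (reflection psi).
Proof.
move=> Ap; split.
  apply: smallest_multiplier Ap; first exact: isL2_subspace.
  move=> _ [l _ <-]; apply: multiplier_expo => f.
  exact: isL2_preserving (measure_preserving_shift _).
have -> : @Rplus R = -%R @^-1` `]-oo, 0[%classic.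
  by apply/seteqP; split=> x /=; rewrite /Rplus/= !in_itv/= andbT oppr_lt0.
apply: multiplier_reflection; apply: smallest_multiplier Ap.
  exact: L2_vanishing_subspace.
move=> _ [l /= l0 <-]; apply: multiplier_expo => f.
apply: L2_vanishing_shift => x; rewrite /= !in_itv/= => x0.
by rewrite subr_lt0 (lt_le_trans x0).
Qed.

Lemma multiplierM S psi chi : L2_subspace S -> multiplier S psi -> multiplier S chi ->
  multiplier S (psi \* chi).
Proof. by move=> /multiplier_closed_subalgebra[_ _ _ h _] /h; exact. Qed.

Local Notation L2mul psi := (multiplier (fun f => isL2 f) psi).

(** * The operators F^-1 psi F on L^2 *)

Definition fourier_mul (psi f : R -> R[i]) : R -> R[i] := inv_fourier (psi \* fourier f).

Lemma fourier_mul_graph psi f : L2mul psi -> isL2 f ->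
  fourier_graph (fourier_mul psi f) (psi \* fourier f).
Proof.
move=> [_ h] Lf; have [f' _ G] := h _ _ Lf (fourierP Lf).
exact: inv_fourierP G.
Qed.

Lemma isL2_fourier_mul psi f : L2mul psi -> isL2 f -> isL2 (fourier_mul psi f).
Proof. by move=> h Lf; case: (graph_isL2 (fourier_mul_graph h Lf)). Qed.

(** The identification principle for these operators: any pair exhibited in the graph determines the
    value almost everywhere, whatever representatives [fourier] and [inv_fourier] pick. *)
Lemma fourier_mul_unique psi f g h : L2mul psi -> fourier_graph f g ->
  fourier_graph h (psi \* g) -> fourier_mul psi f =a h.
Proof.
move=> Mp G Gh; have [Lf _] := graph_isL2 G.
apply: graph_inj (fourier_mul_graph Mp Lf) Gh _.
apply: filterS (graph_unique (fourierP Lf) G (eqa_refl f)) => x + _ => /(_ I).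
by move=> /= ->.
Qed.

Lemma fourier_mul_ae psi chi f g : L2mul psi -> L2mul chi -> isL2 f -> isL2 g ->
  psi =a chi -> f =a g -> fourier_mul psi f =a fourier_mul chi g.
Proof.
move=> Mp Mc Lf Lg pc fg.
apply: graph_inj (fourier_mul_graph Mp Lf) (fourier_mul_graph Mc Lg) _.
have := graph_unique (fourierP Lf) (fourierP Lg) fg.
by apply: filterS2 pc => x /(_ I) /= -> + _ => /(_ I) ->.
Qed.

Lemma fourier_mul_lin psi (a : R[i]) f g : L2mul psi -> isL2 f -> isL2 g ->
  fourier_mul psi (fun x => a * f x + g x) =a
  fun x => a * fourier_mul psi f x + fourier_mul psi g x.
Proof.
move=> Mp Lf Lg.
apply: (fourier_mul_unique Mp (graph_lin a (fourierP Lf) (fourierP Lg))).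
rewrite (_ : _ \* _ = fun x => a * (psi \* fourier f) x + (psi \* fourier g) x).
  exact: graph_lin (fourier_mul_graph Mp Lf) (fourier_mul_graph Mp Lg).
by apply/funext => x /=; ring.
Qed.

Lemma fourier_mul_bound psi : L2mul psi -> exists2 C : R, 0 <= C &
  forall f, isL2 f -> (sqn (fourier_mul psi f) <= C%:E * sqn f)%E.
Proof.
move=> Mp; have [/LinftyP[mp [M M0 hM]] _] := Mp; have k0 := kappa_gt0 R.
(* From right to left: the upper bound of F, the essential bound of |psi|^2, and the lower bound of
   F. *)
exists (8 / kappa R * (M * (16 * kappa R))).
  by rewrite !mulr_ge0// ?invr_ge0// ltW.
move=> f Lf; have Gf := fourierP Lf; have [_ Lg] := graph_isL2 Gf.
have [_ b1] := graph_bounds (fourier_mul_graph Mp Lf).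
have [b2 _] := graph_bounds Gf.
have [_ b3] := Linfty_mul M0 mp hM Lg.
rewrite (EFinM (8 / kappa R)) -muleA; apply: le_trans b1 _.
apply: lee_wpmul2l; first by rewrite lee_fin divr_ge0// ltW.
by apply: le_trans b3 _; rewrite (EFinM M) -muleA; apply: lee_wpmul2l.
Qed.

Lemma fourier_mulM psi chi f : L2mul psi -> L2mul chi -> isL2 f ->
  fourier_mul (psi \* chi) f =a fourier_mul psi (fourier_mul chi f).
Proof.
move=> Mp Mc Lf; have G := fourier_mul_graph Mc Lf; have [Lcf _] := graph_isL2 G.
have Mpc := multiplierM isL2_subspace Mp Mc; have Gp := fourier_mul_graph Mp Lcf.
apply: fourier_mul_unique Mpc (fourierP Lf) _.
have [[mf' _] [mg' _]] := graph_isL2 Gp; have [_ [mcg _]] := graph_isL2 G.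
have [_ [mf _]] := graph_isL2 (fourierP Lf).
have [[/LinftyP[mp _] _] [/LinftyP[mc _] _]] := (Mp, Mc).
apply: graph_ae Gp => //.
- by apply: cmeasM mf; exact: cmeasM.
- exact: eqa_refl.
- have := graph_unique (fourierP Lcf) G (eqa_refl _).
  by apply: filterS => x + _ => /(_ I) /= ->; rewrite mulrA.
Qed.

Lemma fourier_mul1 psi f : L2mul psi -> psi =a (fun=> 1) -> isL2 f ->
  fourier_mul psi f =a f.
Proof.
move=> Mp p1 Lf; have G := fourierP Lf; have [[mf _] [mg _]] := graph_isL2 G.
have [/LinftyP[mp _] _] := Mp.
apply: (fourier_mul_unique Mp G); apply: graph_ae G => //.
- exact: cmeasM.
- exact: eqa_refl.
- by apply: filterS p1 => x + _ => /(_ I) /= ->; rewrite mul1r.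
Qed.

Lemma fourier_mul_reflection psi f : L2mul psi -> isL2 f ->
  fourier_mul (reflection psi) (reflection f) =a reflection (fourier_mul psi f).
Proof.
move=> Mp Lf; have Mr := multiplier_isL2_reflection Mp.
apply: (fourier_mul_unique Mr (graph_reflection (fourierP Lf))).
exact: graph_reflection (fourier_mul_graph Mp Lf).
Qed.

Lemma fourier_mul_vanishing (D : set R) psi f : L2mul psi ->
  multiplier (L2_vanishing D) psi -> L2_vanishing D f -> L2_vanishing D (fourier_mul psi f).
Proof.
move=> Mp [_ h] Zf; have [Lf _] := Zf; have [f' [_ zf'] G'] := h _ _ Zf (fourierP Lf).
split; first exact: isL2_fourier_mul.
have := fourier_mul_unique Mp (fourierP Lf) G'.
apply: filterS2 zf' => x /(_ I) + /(_ I) + _; rewrite !extend0E.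
by move=> + ->.
Qed.

Lemma r_plus_congr f g : f =a g -> r_plus f =a r_plus g.
Proof. by apply: filterS => x + _ => /(_ I) h; rewrite /r_plus !extend0E h. Qed.

Lemma r_plusD f g x : r_plus (fun x => f x + g x) x = r_plus f x + r_plus g x.
Proof. by rewrite /r_plus !extend0E mulrDr. Qed.

Lemma r_plus_idem f : r_plus (r_plus f) = r_plus f.
Proof. by apply/funext => x; rewrite /r_plus /extend0 /patch; case: ifP => // ->. Qed.

Lemma isL2_r_plus f : isL2 f -> isL2 (r_plus f).
Proof. exact: isL2_extend0 measurable_Rplus. Qed.

Lemma isL2_reflection f : isL2 f -> isL2 (reflection f).
Proof. exact: isL2_preserving measure_preserving_opp. Qed.

Lemma isL2D f g : isL2 f -> isL2 g -> isL2 (fun x => f x + g x).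
Proof.
move=> Lf Lg; have := isL2_lin 1 Lf Lg.
by under [X in isL2 X -> _]eq_fun do rewrite mul1r.
Qed.

Lemma fourier_mulD psi f g : L2mul psi -> isL2 f -> isL2 g ->
  fourier_mul psi (fun x => f x + g x) =a fun x => fourier_mul psi f x + fourier_mul psi g x.
Proof.
move=> Mp Lf Lg; have := fourier_mul_lin 1 Mp Lf Lg.
by under eq_fun do rewrite mul1r; under [X in _ =a X -> _]eq_fun do rewrite mul1r.
Qed.

Lemma fourier_mul_congr psi f g : L2mul psi -> isL2 f -> isL2 g -> f =a g ->
  fourier_mul psi f =a fourier_mul psi g.
Proof. by move=> Mp Lf Lg; apply: fourier_mul_ae => //; exact: eqa_refl. Qed.

Lemma fourier_mulK psi chi f : L2mul psi -> L2mul chi -> psi \* chi =a (fun=> 1) ->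
  isL2 f -> fourier_mul psi (fourier_mul chi f) =a f.
Proof.
move=> Mp Mc h Lf; apply: eqa_trans (eqa_sym (fourier_mulM Mp Mc Lf)) _.
by apply: fourier_mul1 => //; exact: multiplierM isL2_subspace _ _.
Qed.

(** In operator form P A(psi) = P A(psi) P: the difference f - g vanishes on the half-line, and so
    does its image. Used for psi and psi^-1, this triangularity makes the two compressions mutually
    inverse. *)
Lemma r_plus_fourier_mul psi f g : L2mul psi -> multiplier (L2_vanishing (@Rplus R)) psi ->
  isL2 f -> isL2 g -> r_plus f =a r_plus g ->
  r_plus (fourier_mul psi f) =a r_plus (fourier_mul psi g).
Proof.
move=> Mp Vp Lf Lg fg.
have Z : L2_vanishing (@Rplus R) (fun x => -1 * g x + f x).
  split; first exact: isL2_lin.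
  rewrite extend0_lin; apply: filterS fg => x + _ => /(_ I).
  by rewrite /r_plus => ->; ring.
have [_ +] := fourier_mul_vanishing Mp Vp Z.
have := fourier_mul_lin (-1) Mp Lg Lf; rewrite /r_plus.
move: (fourier_mul psi _) (fourier_mul psi g) (fourier_mul psi f) => u v w.
apply: filterS2 => x /(_ I) h /(_ I); rewrite !extend0E h => {}h _.
by apply/eqP; rewrite -subr_eq0 -h; apply/eqP; ring.
Qed.

(** * Inversion of the Wiener-Hopf plus Hankel operator *)

Definition even_sum f : R -> R[i] := fun x => f x + f (- x).

Lemma even_sum_congr f g : f =a g -> even_sum f =a even_sum g.
Proof.
move=> fg; have := eq_ae_preserving measure_preserving_opp fg.
by apply: filterS2 fg => x /(_ I) h1 /(_ I) h2 _; rewrite /even_sum h1 h2.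
Qed.

Lemma isL2_even_sum f : isL2 f -> isL2 (even_sum f).
Proof. by move=> Lf; apply: isL2D => //; exact: isL2_reflection. Qed.

Lemma even_sum_even f : reflection (even_sum f) = even_sum f.
Proof. by apply/funext => x; rewrite /reflection/even_sum opprK addrC. Qed.

Lemma ae_neq0 : {ae mu, forall x, x != 0}.
Proof.
exists [set 0]; split; [exact: measurable_set1|exact: lebesgue_measure_set1|].
by move=> x /= /negP; rewrite negbK => /eqP.
Qed.

Lemma Rplus_opp x : x != 0 -> (- x \in @Rplus R) = ~~ (x \in @Rplus R).
Proof.
move=> x0; rewrite !mem_setE /= !in_itv/= !andbT oppr_gt0 -leNgt.
by rewrite lt_neqAle x0.
Qed.

(** For x != 0 exactly one of x and -x is positive, and evenness makes the two values agree. Thus 1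
    + J inverts the restriction on even functions. *)
Lemma even_sum_r_plus f : reflection f =a f -> even_sum (r_plus f) =a f.
Proof.
apply: filterS2 ae_neq0 => x x0 + _ => /(_ I); rewrite /reflection => h.
rewrite /even_sum /r_plus /extend0 /patch (Rplus_opp x0).
by case: ifP; rewrite ?addr0 ?add0r.
Qed.

Lemma r_plus_even_sum f : r_plus (even_sum (r_plus f)) =a r_plus f.
Proof.
apply: filterS ae_neq0 => x x0 _.
rewrite /even_sum /r_plus /extend0 /patch (Rplus_opp x0).
by case: (x \in _); rewrite ?addr0.
Qed.

Lemma fourier_mul_even psi f : L2mul psi -> isL2 f -> reflection psi = psi ->
  reflection f = f -> reflection (fourier_mul psi f) =a fourier_mul psi f.
Proof.
move=> Mp Lf ep ef; apply: eqa_sym; have := fourier_mul_reflection Mp Lf.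
by rewrite ep ef.
Qed.

(** [Rplus] and its closure differ by the null set {0}, so the support condition is the fixed point
    equation of [r_plus]. *)
Lemma L2_plusP f : fcarrier (@L2_plus R) f <-> isL2 f /\ r_plus f =a f.
Proof.
have E : eq_ae (~` closure (@Rplus R)) f (fun=> 0) <-> r_plus f =a f.
  split=> [fz|fz].
    apply: filterS2 ae_neq0 fz => x x0 fz _; rewrite /r_plus /extend0 /patch.
    case: ifPn => // xR; rewrite fz// => cx.
    have : 0 <= x.
      apply: closed_ge; apply: closure_subset cx => y.
      by rewrite /Rplus/= in_itv/= andbT => /ltW.
    rewrite le_eqVlt eq_sym (negbTE x0)/= => xp.
    by move/negP: xR; apply; apply/mem_set; rewrite /Rplus/= in_itv/= xp.
  apply: filterS fz => x /(_ I) + cx; rewrite /r_plus /extend0 /patch.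
  by case: ifPn => // /set_mem /subset_closure /cx.
by rewrite -E; split=> -[/L2P].
Qed.

Lemma L2_Rplus_norm f : fnorm (@L2_Rplus R) f = cLnorm setT 2%:E (r_plus f).
Proof. by rewrite /fnorm/cLnorm/= extend0T. Qed.

(** Values off the half-line are arbitrary in this space; extension by zero yields the
    representative to which results on the whole line apply. *)
Lemma L2_RplusP f : fcarrier (@L2_Rplus R) f <-> isL2 (r_plus f).
Proof.
have E : cmeasurable_fun (@Rplus R) f <-> cmeas (r_plus f).
  have mR := measurable_Rplus; rewrite /cmeasurable_fun.
  have -> : (fun x => Re (r_plus f x)) = (fun x => Re (f x)) \_ (@Rplus R).
    by apply/funext => x; rewrite /r_plus /extend0 /patch; case: ifP.
  have -> : (fun x => Im (r_plus f x)) = (fun x => Im (f x)) \_ (@Rplus R).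
    by apply/funext => x; rewrite /r_plus /extend0 /patch; case: ifP.
  by split=> -[? ?]; split; apply/(measurable_restrictT _ mR).
split=> [[mf nf]|/L2P[mf nf]]; last first.
  by split; [exact/E|move: nf; rewrite -L2_Rplus_norm].
apply/L2P; split; first exact/E.
by rewrite -L2_Rplus_norm.
Qed.

Lemma L2_Rplus_eq f g : feq (@L2_Rplus R) f g <-> r_plus f =a r_plus g.
Proof.
split; apply: filterS => x.
  move=> h _; rewrite /r_plus /extend0 /patch; case: ifPn => // /set_mem.
  exact: h.
by move=> /(_ I) + /= /mem_set xR; rewrite /r_plus /extend0 /patch xR.
Qed.

(** * Bounded operators on the line and on the half-line *)

(** Working on the whole line gives one class stable under sums and composition; boundedness between
    the half-line spaces is read off afterwards. *)
Definition L2_bounded_op (T : (R -> R[i]) -> R -> R[i]) :=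
  [/\ forall f, isL2 f -> isL2 (T f),
      forall f g, isL2 f -> isL2 g -> f =a g -> T f =a T g,
      forall (a : R[i]) f g, isL2 f -> isL2 g ->
        T (fun x => a * f x + g x) =a (fun x => a * T f x + T g x) &
      exists2 C : R, 0 <= C & forall f, isL2 f -> (sqn (T f) <= C%:E * sqn f)%E].

Lemma L2_bounded_op_comp T T' : L2_bounded_op T -> L2_bounded_op T' ->
  L2_bounded_op (fun f => T (T' f)).
Proof.
move=> [T1 T2 T3 [C C0 T4]] [T1' T2' T3' [C' C0' T4']]; split.
- by move=> f Lf; apply/T1/T1'.
- by move=> f g Lf Lg fg; apply: T2; [exact: T1'|exact: T1'|exact: T2'].
- move=> a f g Lf Lg; have [L1 L2'] := (T1' _ Lf, T1' _ Lg).
  apply: eqa_trans (T3 a _ _ L1 L2'); apply: T2; last exact: T3'.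
  + exact/T1'/isL2_lin.
  + exact: isL2_lin.
- exists (C * C'); first exact: mulr_ge0.
  move=> f Lf; apply: le_trans (T4 _ (T1' _ Lf)) _.
  by rewrite EFinM -muleA; apply: lee_wpmul2l => //; exact: T4'.
Qed.

Lemma L2_bounded_opD T T' : L2_bounded_op T -> L2_bounded_op T' ->
  L2_bounded_op (fun f x => T f x + T' f x).
Proof.
move=> [T1 T2 T3 [C C0 T4]] [T1' T2' T3' [C' C0' T4']]; split.
- by move=> f Lf; apply: isL2D; [exact: T1|exact: T1'].
- move=> f g Lf Lg fg; apply: filterS2 (T2 _ _ Lf Lg fg) (T2' _ _ Lf Lg fg).
  by move=> x /(_ I) h1 /(_ I) h2 _; rewrite h1 h2.
- move=> a f g Lf Lg; apply: filterS2 (T3 a _ _ Lf Lg) (T3' a _ _ Lf Lg).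
  by move=> x /(_ I) h1 /(_ I) h2 _; rewrite h1 h2; ring.
- exists (2 * C + 2 * C'); first by rewrite addr_ge0// mulr_ge0.
  move=> f Lf; have [[m1 _] [m2 _]] := (T1 _ Lf, T1' _ Lf).
  apply: le_trans (sqnD m1 m2) _.
  have -> : ((2 * C + 2 * C')%:E * sqn f = 2%:E * (C%:E * sqn f) + 2%:E * (C'%:E * sqn f))%E.
    by rewrite !muleA -!EFinM -ge0_muleDl ?lee_fin ?mulr_ge0.
  by apply: leeD; apply: lee_wpmul2l => //; [exact: T4|exact: T4'].
Qed.

Lemma L2_bounded_op_id : L2_bounded_op id.
Proof.
split=> //; first by move=> a f g _ _; exact: eqa_refl.
by exists 1 => // f _; rewrite mul1e.
Qed.

Lemma L2_bounded_op_reflection : L2_bounded_op (@reflection R).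
Proof.
have ph := measure_preserving_opp; split.
- exact: isL2_reflection.
- by move=> f g _ _; exact: eq_ae_preserving.
- by move=> a f g _ _; exact: eqa_refl.
- by exists 1 => // f [mf _]; rewrite mul1e sqn_preserving.
Qed.

Lemma L2_bounded_op_r_plus : L2_bounded_op (@r_plus R).
Proof.
split.
- exact: isL2_r_plus.
- by move=> f g _ _; exact: r_plus_congr.
- by move=> a f g _ _; rewrite /r_plus extend0_lin; exact: eqa_refl.
- by exists 1 => // f [mf _]; rewrite mul1e; exact: sqn_extend0_le measurable_Rplus _.
Qed.

Lemma L2_bounded_op_fourier_mul psi : L2mul psi -> L2_bounded_op (fourier_mul psi).
Proof.
move=> Mp; split.
- by move=> f; exact: isL2_fourier_mul.
- by move=> f g; exact: fourier_mul_congr.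
- by move=> a f g; exact: fourier_mul_lin.
- exact: fourier_mul_bound.
Qed.

Lemma L2_bounded_op_even_sum : L2_bounded_op even_sum.
Proof. exact: L2_bounded_opD L2_bounded_op_id L2_bounded_op_reflection. Qed.

Lemma bounded_linear_op_from_plus T : L2_bounded_op T ->
  bounded_linear_op (@L2_plus R) (@L2_Rplus R) T.
Proof.
move=> [T1 T2 T3 [C C0 T4]]; split.
- by move=> f /L2_plusP[Lf _]; apply/L2_RplusP/isL2_r_plus/T1.
- move=> f g /L2_plusP[Lf _] /L2_plusP[Lg _] fg; apply/L2_Rplus_eq/r_plus_congr.
  exact: T2.
- move=> a f g /L2_plusP[Lf _] /L2_plusP[Lg _]; apply/L2_Rplus_eq/r_plus_congr.
  exact: T3.
- exists (Num.sqrt C) => f /L2_plusP[Lf _]; rewrite L2_Rplus_norm; apply: cLnorm2_le => //.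
  apply: le_trans (T4 _ Lf); apply: (sqn_extend0_le measurable_Rplus).
  by case: (T1 _ Lf).
Qed.

(** Two cuts: the inner [r_plus] discards the arbitrary values off the half-line, the outer one
    enforces the support condition of [L2_plus]. *)
Lemma bounded_linear_op_to_plus T : L2_bounded_op T ->
  bounded_linear_op (@L2_Rplus R) (@L2_plus R) (fun h => r_plus (T (r_plus h))).
Proof.
move=> bT; have [T1 T2 T3 [C C0 T4]] := L2_bounded_op_comp L2_bounded_op_r_plus bT.
split.
- move=> h /L2_RplusP Lh; apply/L2_plusP; split; first exact: T1.
  by rewrite r_plus_idem; exact: eqa_refl.
- by move=> f g /L2_RplusP Lf /L2_RplusP Lg /L2_Rplus_eq; exact: T2.
- move=> a f g /L2_RplusP Lf /L2_RplusP Lg; rewrite /r_plus extend0_lin; exact: T3.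
- exists (Num.sqrt C) => h /L2_RplusP Lh; rewrite L2_Rplus_norm; apply: cLnorm2_le => //.
  exact: T4.
Qed.

Lemma wiener_hopf_plus_hankelE phi f : L2mul phi -> isL2 f ->
  wiener_hopf_plus_hankel phi f =a r_plus (fourier_mul phi (even_sum f)).
Proof.
move=> Mp Lf; have Lr := isL2_reflection Lf.
apply: eqa_trans (r_plus_congr (eqa_sym (fourier_mulD Mp Lf Lr))).
by apply: aeW => x _; rewrite r_plusD.
Qed.

Lemma L2_bounded_op_wiener_hopf_plus_hankel phi : L2mul phi ->
  L2_bounded_op (wiener_hopf_plus_hankel phi).
Proof.
move=> Mp; have bA := L2_bounded_op_fourier_mul Mp; have bP := L2_bounded_op_r_plus.
have bPA := L2_bounded_op_comp bP bA.
exact: L2_bounded_opD bPA (L2_bounded_op_comp bPA L2_bounded_op_reflection).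
Qed.

(** Isolates what the factorization supplies: a factor that, like its inverse, preserves vanishing
    on the half-line, and an even factor with an even inverse. *)
Lemma wiener_hopf_plus_hankel_invertible phi psi psi' even even' :
  L2mul phi -> L2mul psi -> L2mul psi' -> L2mul even -> L2mul even' ->
  multiplier (L2_vanishing (@Rplus R)) psi -> multiplier (L2_vanishing (@Rplus R)) psi' ->
  reflection even = even -> reflection even' = even' ->
  phi =a psi \* even -> psi \* psi' =a (fun=> 1) -> even \* even' =a (fun=> 1) ->
  invertible_op (@L2_plus R) (@L2_Rplus R) (wiener_hopf_plus_hankel phi).
Proof.
move=> Mphi Mp Mp' Me Me' Vp Vp' re re' phiE pp' ee'.
have p'p : psi' \* psi =a (fun=> 1).
  by apply: eqa_trans pp'; apply: aeW => x _ /=; rewrite mulrC.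
have e'e : even' \* even =a (fun=> 1).
  by apply: eqa_trans ee'; apply: aeW => x _ /=; rewrite mulrC.
have phiA f : isL2 f -> fourier_mul phi f =a fourier_mul psi (fourier_mul even f).
  move=> Lf; apply: eqa_trans (fourier_mulM Mp Me Lf).
  by apply: fourier_mul_ae => //; [exact: multiplierM isL2_subspace _ _|exact: eqa_refl].
split.
  exact: bounded_linear_op_from_plus (L2_bounded_op_wiener_hopf_plus_hankel Mphi).
pose T k := fourier_mul even' (even_sum (r_plus (fourier_mul psi' k))).
have bT : L2_bounded_op T.
  apply: L2_bounded_op_comp (L2_bounded_op_fourier_mul Me') _.
  apply: L2_bounded_op_comp L2_bounded_op_even_sum _.
  exact: L2_bounded_op_comp L2_bounded_op_r_plus (L2_bounded_op_fourier_mul Mp').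
have [T1 T2 _ _] := bT.
have [W1 W2 _ _] := L2_bounded_op_wiener_hopf_plus_hankel Mphi.
exists (fun h => r_plus (T (r_plus h))); split.
- exact: bounded_linear_op_to_plus.
(* Left inverse: P A(psi') P followed by 1 + J recovers the even function [y] from P A(psi) y; then
   A(even') gives (1 + J) f, whose restriction is f by the support condition. *)
- move=> f /L2_plusP[Lf fP]; apply: (eqa_trans _ fP).
  have Lef := isL2_even_sum Lf; pose y := fourier_mul even (even_sum f).
  have Ly : isL2 y by exact: isL2_fourier_mul.
  have Lpy : isL2 (fourier_mul psi y) by exact: isL2_fourier_mul.
  have yev : reflection y =a y.
    by apply: fourier_mul_even => //; exact: even_sum_even.
  have Wf : r_plus (wiener_hopf_plus_hankel phi f) =a r_plus (fourier_mul psi y).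
    apply: eqa_trans (r_plus_congr (wiener_hopf_plus_hankelE Mphi Lf)) _.
    rewrite r_plus_idem; exact: r_plus_congr (phiA _ Lef).
  have Py : r_plus (fourier_mul psi' (r_plus (fourier_mul psi y))) =a r_plus y.
    apply: eqa_trans (r_plus_congr (fourier_mulK Mp' Mp p'p Ly)).
    apply: r_plus_fourier_mul => //; first exact: isL2_r_plus.
    by rewrite r_plus_idem; exact: eqa_refl.
  apply: eqa_trans (r_plus_congr (_ : _ =a even_sum f)) _; last first.
    have := r_plus_even_sum f; apply: eqa_trans; apply: r_plus_congr.
    by apply: even_sum_congr; exact: eqa_sym.
  apply: eqa_trans (T2 _ _ _ _ Wf) _.
  + exact/isL2_r_plus/W1.
  + exact: isL2_r_plus.
  apply: eqa_trans (fourier_mulK Me' Me e'e Lef).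
  rewrite /T; apply: (fourier_mul_congr Me').
  + exact/isL2_even_sum/isL2_r_plus/isL2_fourier_mul/isL2_r_plus.
  + exact: Ly.
  + by apply: eqa_trans (even_sum_congr Py) _; exact: even_sum_r_plus.
(* Right inverse: [w] is even, so 1 + J undoes its restriction and A(even) returns (1 + J) z. This
   agrees with [v] on the half-line, so after A(psi) the restrictions agree too, and A(psi) A(psi')
   cancels. *)
- move=> h /L2_RplusP Lh; apply/L2_Rplus_eq.
  set k := r_plus h in Lh *; pose v := fourier_mul psi' k; pose z := r_plus v.
  have Lv : isL2 v by exact: isL2_fourier_mul.
  have Lz : isL2 z by exact: isL2_r_plus.
  have Lez := isL2_even_sum Lz; pose w := fourier_mul even' (even_sum z).
  have Lw : isL2 w by exact: isL2_fourier_mul.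
  have wev : reflection w =a w.
    by apply: fourier_mul_even => //; exact: even_sum_even.
  have Lew : isL2 (even_sum (r_plus w)) by exact/isL2_even_sum/isL2_r_plus.
  have LPw : isL2 (r_plus w) by exact: isL2_r_plus.
  apply: eqa_trans (r_plus_congr (wiener_hopf_plus_hankelE Mphi LPw)) _.
  rewrite r_plus_idem.
  have Lfew : isL2 (fourier_mul even w) by exact: isL2_fourier_mul.
  have ewz : fourier_mul even w =a even_sum z by exact: fourier_mulK.
  apply: (@eqa_trans _ (r_plus (fourier_mul psi (even_sum z)))).
    apply: r_plus_congr; apply: (@eqa_trans _ (fourier_mul phi w)).
      by apply: fourier_mul_congr => //; exact: even_sum_r_plus.
    apply: eqa_trans (phiA _ Lw) _; exact: fourier_mul_congr.
  apply: (@eqa_trans _ (r_plus (fourier_mul psi v))).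
    by apply: r_plus_fourier_mul => //; exact: r_plus_even_sum.
  apply: eqa_trans (r_plus_congr (fourier_mulK Mp Mp' pp' Lh)) _.
  by rewrite r_plus_idem; exact: eqa_refl.
Qed.

End ComplexL2.

Theorem corollary5p3 (R : realType) (phi : R -> R[i])
  (hphi : invertibles (@AP R) phi)
  (hW : invertible_op (@L2_plus R) (@L2_Rplus R) (wiener_hopf phi))
  (hfact : has_canonical_right_AP_factorization phi) :
  invertible_op (@L2_plus R) (@L2_Rplus R) (wiener_hopf_plus_hankel phi).
Proof.
case: hfact => [m [p [[Am [m' Am' mm']] [Ap [p' Ap' pp']] phiE]]].
have [Lm Vm] := AP_minus_multiplier Am; have [Lm' Vm'] := AP_minus_multiplier Am'.
have [Lp Vp] := AP_plus_multiplier Ap; have [Lp' Vp'] := AP_plus_multiplier Ap'.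
have [rLp rLp'] := (multiplier_isL2_reflection Lp, multiplier_isL2_reflection Lp').
have sub := @isL2_subspace R; have V := L2_vanishing_subspace (@measurable_Rplus R).
(* The reflected identity J p J p' = 1 allows the pair to be inserted between the factors of phi = m
   p. *)
have rpp' := eq_ae_preserving (@measure_preserving_opp R) pp'.
apply: (@wiener_hopf_plus_hankel_invertible _ _ (m \* reflection p') (m' \* reflection p)
  (reflection p \* p) (reflection p' \* p')).
- by case: hphi => /AP_multiplier.
- exact: multiplierM.
- exact: multiplierM.
- exact: multiplierM.
- exact: multiplierM.
- exact: multiplierM.
- exact: multiplierM.
- by apply/funext => x; rewrite /reflection/= opprK mulrC.
- by apply/funext => x; rewrite /reflection/= opprK mulrC.
- apply: filterS2 phiE rpp' => x /(_ I) /= -> /(_ I) /= h _; rewrite /reflection.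
  by rewrite -mulrA [_ * (_ * p x)]mulrA [p' _ * _]mulrC h mul1r.
- apply: filterS2 mm' rpp' => x /(_ I) /= h1 /(_ I) /= h2 _; rewrite /reflection.
  by rewrite mulrACA h1 mul1r mulrC.
- apply: filterS2 pp' rpp' => x /(_ I) /= h1 /(_ I) /= h2 _; rewrite /reflection.
  by rewrite mulrACA h1 h2 mul1r.
Qed.
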